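(* Let $V=\mathbf{k}^n$ with $n\geq 3$ and let $K\subseteq\bigwedge^2V$ be a subspace of dimension $m$. Then \[W_j(V,K)=0\ \text{ for }j\gg 0 \quad\Longleftrightarrow\quad W_j(V,K)=0\ \text{ for all }j\geq 2n-7.\] Moreover, if $m=2n-3$, $p=\operatorname{char}(\mathbf{k})>0$, and the vanishing above holds, then the following are equivalent: (a) $W_{2n-8}(V,K)\neq 0$; (b) $W_{2n-8}(V,K)\simeq\mathbf{k}$ is one-dimensional; (c) $n=3+p^k$ for some integer $k\geq 0$.
   Context: $\mathbf{k}$ is an algebraically closed field. Let $S=\operatorname{Sym}(V)$, and let $S(j)$ be the free graded rank one module with $S(j)_d=S_{d+j}$. Let $\delta_1:V\otimes S\to S$ be the multiplication map and $\delta_2:\bigwedge^2V\otimes S\to V\otimes S$ the Koszul differential $(v\wedge v')\otimes f\mapsto v\otimes(v'f)-v'\otimes(vf)$. The Koszul module $W(V,K)$ is the graded $S$-module defined as the middle homology of the complex of graded free $S$-modules \[K\otimes S\xrightarrow{\ \delta_2|_{K\otimes S}\ }V\otimes S(1)\xrightarrow{\ \delta_1\ }S(2),\] and $W_j(V,K)$ is its degree $j$ component (so $W(V,K)$ is generated in degree $0$). *)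

(* Defs.v *)
From HB Require Import structures.
From mathcomp Require Import all_boot all_order all_algebra.
From mathcomp Require Import boolp.
From mathcomp Require Import generic_quotient ring_quotient.
From mathcomp Require Import mpoly.

Set Implicit Arguments.
Unset Strict Implicit.
Unset Printing Implicit Defensive.

Import GRing.Theory.
Local Open Scope ring_scope.
Local Open Scope quotient_scope.

(* V = k^n is 'cV[k]_n, Sym(V) is {mpoly k[n]} with the i-th basis vector of V
   sent to 'X_i, V (x) S is 'cV[S]_n and wedge^2(V) (x) S lies in 'M[S]_n.    *)

Section Exterior.
Variables (k : fieldType) (n : nat).

(* v /\ w is represented by the matrix v w^T - w v^T.  In every characteristic,
   2 included, this identifies wedge^2(V) with the space of alternating
   matrices: see alt_decomp and mem_ext2.                                     *)
Definition wedge (v w : 'cV[k]_n) : 'M[k]_n := v *m w^T - w *m v^T.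

Definition ext2 : {vspace 'M[k]_n} :=
  <<[seq wedge (delta_mx i 0) (delta_mx j 0) | i <- enum 'I_n, j <- enum 'I_n]>>.

Lemma wedge_alternating v : wedge v v = 0.
Proof. exact: subrr. Qed.

Lemma wedgeDl v v' w : wedge (v + v') w = wedge v w + wedge v' w.
Proof. by rewrite /wedge mulmxDl linearD /= mulmxDr opprD addrACA. Qed.

Lemma wedgeZl a v w : wedge (a *: v) w = a *: wedge v w.
Proof. by rewrite /wedge linearZ /= -scalemxAl -scalemxAr scalerBr. Qed.

Lemma wedgeC v w : wedge v w = - wedge w v.
Proof. by rewrite /wedge opprB. Qed.

Lemma wedge_suml I (r : seq I) (P : pred I) (F : I -> 'cV[k]_n) w :
  wedge (\sum_(i <- r | P i) F i) w = \sum_(i <- r | P i) wedge (F i) w.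
Proof.
apply: (big_morph (fun v => wedge v w)) => [v v'|]; first exact: wedgeDl.
by rewrite /wedge mul0mx trmx0 mulmx0 subrr.
Qed.

Lemma wedge_delta (i j r s : 'I_n) :
  wedge (delta_mx i 0) (delta_mx j 0) r s
  = ((r == i) && (s == j))%:R - ((r == j) && (s == i))%:R.
Proof. by rewrite /wedge !trmx_delta !mul_delta_mx !mxE. Qed.

Lemma wedge_delta_ext2 i j : wedge (delta_mx i 0) (delta_mx j 0) \in ext2.
Proof.
apply: memv_span; apply/allpairsP; exists (i, j).
by rewrite !mem_enum.
Qed.

Lemma wedge_ext2 v w : wedge v w \in ext2.
Proof.
have wd j : wedge v (delta_mx j 0) \in ext2.
  rewrite [v]matrix_sum_delta wedge_suml memv_suml // => i _.
  by rewrite big_ord1 wedgeZl memvZ ?wedge_delta_ext2.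
rewrite wedgeC memvN [w]matrix_sum_delta wedge_suml memv_suml // => j _.
by rewrite big_ord1 wedgeZl memvZ // wedgeC memvN.
Qed.

Lemma alt_decomp (A : 'M[k]_n) : A^T = - A -> (forall i, A i i = 0) ->
  A = \sum_(i < n) \sum_(j < n | (i < j)%N)
        A i j *: wedge (delta_mx i 0) (delta_mx j 0).
Proof.
move=> At A0; have Aji i j : A j i = - A i j by move/matrixP/(_ i j): At; rewrite !mxE.
have pick (r s : 'I_n) :
    \sum_(i < n) \sum_(j < n | (i < j)%N) A i j * ((r == i) && (s == j))%:R
    = A r s *+ (r < s)%N.
  rewrite (bigD1 r) //= [X in _ + X]big1 ?addr0 => [|i /negbTE ir]; last first.
    by rewrite big1 // => j _; rewrite eq_sym ir mulr0.
  rewrite big_mkcond (bigD1 s) //= big1 ?addr0 => [|j /negbTE js]; last first.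
    by rewrite [s == j]eq_sym js andbF mulr0 if_same.
  by rewrite !eqxx mulr1; case: ifP.
apply/matrixP=> r s; rewrite summxE.
under eq_bigr => i _.
  rewrite summxE.
  under eq_bigr => j _ do
    rewrite mxE wedge_delta mulrBr [(r == j) && _]andbC.
  rewrite sumrB; over.
rewrite sumrB !pick; case: ltngtP => [||/val_inj ->].
- by rewrite subr0.
- by rewrite sub0r Aji.
- by rewrite subr0 A0.
Qed.

Lemma mem_ext2 (A : 'M[k]_n) :
  reflect (A^T = - A /\ forall i, A i i = 0) (A \in ext2).
Proof.
apply: (iffP idP) => [|[At A0]]; last first.
  rewrite (alt_decomp At A0).
  by do 2!rewrite memv_suml // => *; rewrite memvZ ?wedge_delta_ext2.
set X := [seq wedge (delta_mx i 0) (delta_mx j 0) | i <- enum 'I_n, j <- enum 'I_n].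
rewrite -[ext2]/(<<in_tuple X>>)%VS => /coord_span ->.
have nthX (l : 'I_(size X)) : exists ij : 'I_n * 'I_n,
    (in_tuple X)`_l = wedge (delta_mx ij.1 0) (delta_mx ij.2 0).
  have /allpairsP[ij [_ _ e]] := mem_nth 0 (ltn_ord l : (l < size X)%N).
  by exists ij.
split=> [|r].
  rewrite linear_sum -sumrN; apply: eq_bigr => l _.
  rewrite linearZ -scalerN /=; congr (_ *: _).
  have [[i j] -> /=] := nthX l; apply/matrixP=> s t.
  by rewrite mxE [RHS]mxE !wedge_delta opprB ![(s == _) && _]andbC.
rewrite summxE big1 // => l _; rewrite mxE; have [[i j] -> /=] := nthX l.
by rewrite wedge_delta andbC subrr mulr0.
Qed.

End Exterior.

Section Koszul.
Variables (k : fieldType) (n : nat).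
Local Notation S := {mpoly k[n]}.

(* The embedding of V into S = Sym(V). *)
Definition sym_of (v : 'cV[k]_n) : S := \sum_i v i 0 *: 'X_i.

(* The pure tensor a (x) f. *)
Definition ptens m1 m2 (a : 'M[k]_(m1, m2)) (f : S) : 'M[S]_(m1, m2) :=
  f *: map_mx (@mpolyC n k) a.

Definition delta1 (u : 'cV[S]_n) : S := \sum_i 'X_i * u i 0.

Definition delta2 (T : 'M[S]_n) : 'cV[S]_n := T *m \col_i 'X_i.

Lemma delta1_is_linear : linear_for *%R delta1.
Proof.
move=> f u v; rewrite /delta1 mulr_sumr -big_split; apply: eq_bigr => i _ /=.
by rewrite !mxE mulrDr mulrCA.
Qed.
HB.instance Definition _ :=
  GRing.isLinear.Build S 'cV[S]_n S *%R delta1 delta1_is_linear.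

Lemma delta2_is_linear : linear delta2.
Proof. by move=> f T U; rewrite /delta2 mulmxDl scalemxAl. Qed.
HB.instance Definition _ :=
  GRing.isLinear.Build S 'M[S]_n 'cV[S]_n *:%R delta2 delta2_is_linear.

Lemma delta1_ptens v f : delta1 (ptens v f) = sym_of v * f.
Proof.
rewrite /delta1 /sym_of mulr_suml; apply: eq_bigr => i _.
by rewrite !mxE -mul_mpolyC -mulrA [LHS]mulrA mulrC.
Qed.

Lemma delta2_ptens_wedge v w f :
  delta2 (ptens (wedge v w) f) = ptens v (sym_of w * f) - ptens w (sym_of v * f).
Proof.
have E (u : 'cV[k]_n) :
    (map_mx (@mpolyC n k) u)^T *m (\col_i 'X_i) = (sym_of u)%:M.
  apply/matrixP=> i j; rewrite !ord1 !mxE mulr1n; apply: eq_bigr => l _.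
  by rewrite !mxE mul_mpolyC.
rewrite /delta2 /ptens /wedge -scalemxAl map_mxB !map_mxM -!map_trmx mulmxBl.
rewrite -!mulmxA !E !mul_mx_scalar scalerBr !scalerA.
by rewrite [f * _]mulrC [f * sym_of v]mulrC.
Qed.

(* S_d is the degree d component of S, zero for d < 0. *)
Definition in_sym_deg (d : int) (f : S) : bool :=
  match d with Posz e => f \is e.-homog | Negz _ => f == 0 end.

Fact in_sym_deg0 d : in_sym_deg d 0.
Proof. by case: d => [e|e] /=; rewrite ?dhomog0. Qed.

Fact in_sym_degP d (c : k) f g :
  in_sym_deg d f -> in_sym_deg d g -> in_sym_deg d (c *: f + g).
Proof.
case: d => [e|e] /=; first by move=> fd gd; rewrite rpredD // rpredZ.
by move=> /eqP-> /eqP->; rewrite scaler0 addr0.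
Qed.

Definition cycle_pred : {pred 'cV[S]_n} := fun u => delta1 u == 0.

Fact cycle_submod_closed : submod_closed cycle_pred.
Proof.
split=> [|f u v]; rewrite !unfold_in ?linear0 // => /eqP u0 /eqP v0.
by rewrite linearP /= u0 v0 mulr0 addr0.
Qed.
HB.instance Definition _ :=
  GRing.isSubmodClosed.Build S 'cV[S]_n cycle_pred cycle_submod_closed.

(* The S-module Ker delta1. *)
Record cycle := Cycle { cycle_val : 'cV[S]_n; _ : cycle_val \in cycle_pred }.

HB.instance Definition _ := [isSub for cycle_val].
HB.instance Definition _ := [Choice of cycle by <:].
HB.instance Definition _ := [SubChoice_isSubLmodule of cycle by <:].

Variable K : {vspace 'M[k]_n}.

(* T lies in K (x) S, a submodule of wedge^2(V) (x) S. *)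
Definition in_tens (T : 'M[S]_n) : Prop :=
  exists2 s : seq ('M[k]_n * S),
    {in s, forall t, t.1 \in K} & T = \sum_(t <- s) ptens t.1 t.2.

Definition boundary : {pred cycle} :=
  fun z => `[< exists2 T, in_tens T & val z = delta2 T >].

Lemma in_tensD T U : in_tens T -> in_tens U -> in_tens (T + U).
Proof.
case=> [s sK ->] [t tK ->]; exists (s ++ t); last by rewrite big_cat.
by move=> x; rewrite mem_cat => /orP[/sK|/tK].
Qed.

Lemma in_tensZ f T : in_tens T -> in_tens (f *: T).
Proof.
case=> [s sK ->]; exists [seq (t.1, f * t.2) | t <- s].
  by move=> _ /mapP[t /sK tK ->].
by rewrite big_map scaler_sumr; apply: eq_bigr => t _; rewrite /ptens scalerA.
Qed.

Fact boundary_submod_closed : submod_closed boundary.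
Proof.
split=> [|f u v].
  apply/asboolP; exists 0; last by rewrite !linear0.
  by exists [::]; rewrite ?big_nil.
move=> /asboolP[T KT uT] /asboolP[U KU vU]; apply/asboolP.
exists (f *: T + U); first by apply: in_tensD => //; exact: in_tensZ.
by rewrite linearP /= uT vU [RHS]linearP.
Qed.
HB.instance Definition _ :=
  GRing.isSubmodClosed.Build S cycle boundary boundary_submod_closed.

(* The Koszul module W(V, K) = Ker delta1 / delta2 (K (x) S). *)
Definition koszul := Quotient.quot boundary.

HB.instance Definition _ := Choice.on koszul.
HB.instance Definition _ := GRing.Zmodule.on koszul.

Definition koszul_class (z : cycle) : koszul := \pi z.

Lemma koszul_class_eq0 z : (koszul_class z == 0) = (z \in boundary).
Proof.
have pi0 : \pi_(Quotient.quot boundary) 0 = 0 by exact: pi_zeror.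
by rewrite /koszul_class -{1}pi0 -Quotient.idealrBE subr0.
Qed.

Lemma koszul_classB : zmod_morphism koszul_class.
Proof. exact: pi_is_zmod_morphism. Qed.
HB.instance Definition _ :=
  GRing.isZmodMorphism.Build cycle koszul koszul_class koszul_classB.

Lemma koszul_class_repr w : koszul_class (repr w) = w.
Proof. exact: reprK. Qed.

Definition koszul_scale (f : S) (w : koszul) : koszul :=
  koszul_class (f *: repr w).

Lemma koszul_class_scale f z :
  koszul_class (f *: z) = koszul_scale f (koszul_class z).
Proof.
apply/eqP; rewrite -subr_eq0 -raddfB -scalerBr koszul_class_eq0.
by rewrite rpredZ // -koszul_class_eq0 raddfB /= koszul_class_repr subrr.
Qed.

Fact koszul_scaleA f g w :
  koszul_scale f (koszul_scale g w) = koszul_scale (f * g) w.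
Proof.
by rewrite -[w]koszul_class_repr -!koszul_class_scale scalerA.
Qed.

Fact koszul_scale1 : left_id 1 koszul_scale.
Proof. by move=> w; rewrite -[w]koszul_class_repr -koszul_class_scale scale1r. Qed.

Fact koszul_scaleDr : right_distributive koszul_scale +%R.
Proof.
move=> f u v; rewrite -[u]koszul_class_repr -[v]koszul_class_repr.
by rewrite -raddfD -!koszul_class_scale scalerDr raddfD.
Qed.

Fact koszul_scaleDl w : {morph koszul_scale^~ w : f g / f + g}.
Proof.
move=> f g; rewrite -[w]koszul_class_repr.
by rewrite -!koszul_class_scale scalerDl raddfD.
Qed.

HB.instance Definition _ := GRing.Zmodule_isLmodule.Build S koszul
  koszul_scaleA koszul_scale1 koszul_scaleDr koszul_scaleDl.

(* W_j: the classes of the cycles of degree j in V (x) S(1). *)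
Definition koszul_deg (j : int) : {pred koszul} := fun w =>
  `[< exists2 z : cycle,
        forall i, in_sym_deg (j + 1) (val z i 0) & w = koszul_class z >].

Fact koszul_deg_zmod_closed j : zmod_closed (koszul_deg j).
Proof.
split=> [|u v /asboolP[y yd ->] /asboolP[z zd ->]]; apply/asboolP.
  exists 0; last by rewrite raddf0.
  move=> i; rewrite raddf0 mxE; exact: in_sym_deg0.
exists (y - z); last by rewrite raddfB.
move=> i.
rewrite raddfB !mxE -scaleN1r addrC; exact: in_sym_degP.
Qed.
HB.instance Definition _ j :=
  GRing.isZmodClosed.Build koszul (koszul_deg j) (koszul_deg_zmod_closed j).

Section Component.
Variable j : int.

Record koszul_comp :=
  KoszulComp { koszul_comp_val : koszul; _ : koszul_comp_val \in koszul_deg j }.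

HB.instance Definition _ := [isSub for koszul_comp_val].
HB.instance Definition _ := [Choice of koszul_comp by <:].
HB.instance Definition _ := [SubChoice_isSubZmodule of koszul_comp by <:].

Fact koszul_comp_scale_subproof (c : k) (w : koszul_comp) :
  c%:MP *: val w \in koszul_deg j.
Proof.
have /asboolP[z zd ->] := valP w; apply/asboolP; exists (c%:MP *: z).
  move=> i; rewrite linearZ mxE mul_mpolyC -[_ *: _]addr0 in_sym_degP //.
  exact: in_sym_deg0.
exact/esym/koszul_class_scale.
Qed.

Definition koszul_comp_scale c w := KoszulComp (koszul_comp_scale_subproof c w).

Fact koszul_comp_scaleA c d w :
  koszul_comp_scale c (koszul_comp_scale d w) = koszul_comp_scale (c * d) w.
Proof. by apply: val_inj; rewrite /= scalerA mpolyCM. Qed.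

Fact koszul_comp_scale1 : left_id 1 koszul_comp_scale.
Proof. by move=> w; apply: val_inj; rewrite /= mpolyC1 scale1r. Qed.

Fact koszul_comp_scaleDr : right_distributive koszul_comp_scale +%R.
Proof. move=> c u v; apply: val_inj; exact: scalerDr. Qed.

Fact koszul_comp_scaleDl w : {morph koszul_comp_scale^~ w : c d / c + d}.
Proof. by move=> c d; apply: val_inj; rewrite /= mpolyCD scalerDl. Qed.

HB.instance Definition _ := GRing.Zmodule_isLmodule.Build k koszul_comp
  koszul_comp_scaleA koszul_comp_scale1 koszul_comp_scaleDr koszul_comp_scaleDl.

End Component.

End Koszul.

(* Main.v *)
Require Import Defs.
From HB Require Import structures.
From mathcomp Require Import all_boot all_order all_algebra.
From mathcomp Require Import boolp functions.
From mathcomp Require Import mpoly ring zify.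

Set Implicit Arguments.
Unset Strict Implicit.
Unset Printing Implicit Defensive.

Import GRing.Theory Num.Theory.
Local Open Scope ring_scope.

(* Let S = k[x_1, .., x_n].  The presentation S(2) <- V (x) S(1) <- K (x) S of W is continued to a
   complex X of free S-modules by a map wedge^n K (x) S -> K (x) S, built from the maximal minors
   of K (x) S -> V (x) S, followed by the terms wedge^(n + s) K (x) [w] (x) D^(s - |w|) V', where V'
   is dual to V and [w] runs over the words of a cobar construction on the divided powers of
   sum_i x_i e_i, which are there to make X exact after inverting any variable in all
   characteristics.  If W has finite length, then in positive positions the homology of X, and of
   its reductions modulo x_1, .., x_l, is killed by a power of x_(l+1).
   Let F be a cycle modulo x_1, .., x_l with x^N F = d G, where x = x_(l+1).  Modulo x, G becomes a
   cycle one position higher; if that is a boundary, G can be divided by x modulo boundaries, and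
   N decreases.  So vanishing of homology in position r + 1 and degrees > e modulo x_1, .., x_(l+1)
   gives it in position r and degrees >= e modulo x_1, .., x_l.  After n steps only the degrees of
   the generators count: in position n + 1 the largest is 3n - 8 (2n - 4 if n = 3), which yields
   W_q = 0 for q >= 2n - 7.
   If dim K = 2n - 3, the same division identifies W_(2n - 8) with the homology of X (x) k in
   position n + 1 and degree 3n - 8, which is the quotient of k by the binomial coefficients
   C(n - 3, p) with 0 < p < n - 3.  These all vanish in k iff n - 3 is a power of char k. *)

(** * Contraction and multiplication on exterior powers *)

(** The kernel Z of [delta1] has rank n - 1 and is not free. After inverting a variable its dual is
    V'/(l) with l = sum_i x_i e_i, and the Buchsbaum-Rim complex of K (x) S -> Z has the terms
    wedge^(n + s) K (x) D^s(V'/(l)). The divided power algebra of V'/(l) is D(V') modulo all l^(a)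
    with a > 0; in characteristic p these are not all multiples of l, so a Koszul complex on l alone
    does not resolve it. The bar construction over the divided power algebra of one generator does
    so in every characteristic, and its terms are free over S. Its letters explain both numerical
    answers. For n > 3 the largest generator degree in position n + 1 is that of the one-letter word
    [n - 3]. This generator lies over wedge^(2n - 3) K, a line if dim K = 2n - 3, and it is hit only
    by the words [p, n - 3 - p], with coefficient C(n - 3, p). What may survive is thus an
    indecomposable element of the divided power algebra in degree n - 3, and in characteristic p
    these occur exactly in the degrees that are powers of p. *)

Section Exterior.
Variables (T : comNzRingType) (m : nat) (N : lmodType T).
Implicit Types (a b : 'I_m) (J : {set 'I_m}) (g : {set 'I_m} -> N).

Definition inv_sign a J := #|[set b in J | (b < a)%N]|.

Lemma inv_signU a b J : b \notin J ->
  inv_sign a (b |: J) = ((b < a) + inv_sign a J)%N.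
Proof.
move=> bJ; rewrite /inv_sign; case: ltnP => ba /=.
  rewrite (_ : [set _ in _ | _] = b |: [set c in J | (c < a)%N]).
    by rewrite cardsU1 !inE (negbTE bJ).
  by apply/setP=> c; rewrite !inE; case: eqP => // ->; rewrite ba.
rewrite add0n; apply: eq_card => c; rewrite !inE; case: eqP => // ->.
by rewrite [in RHS]andbC ltnNge ba.
Qed.

Lemma inv_signUu a J : inv_sign a (a |: J) = inv_sign a J.
Proof.
case: (boolP (a \in J)) => aJ; first by rewrite (setUidPr _) ?sub1set.
by rewrite inv_signU ?ltnn.
Qed.

(** An element of the exterior algebra is stored as its coefficients on the basis [e_J], so
    operators read backwards: contraction by the dual of [e_a] takes its coefficient at [J] from
    [e_(a |: J)], and multiplication by [e_a] from [e_(J :\ a)]. *)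
Definition contr1 a g : {set 'I_m} -> N := fun J =>
  if a \in J then 0 else (-1) ^+ inv_sign a J *: g (a |: J).

Definition emul1 a g : {set 'I_m} -> N := fun J =>
  if a \in J then (-1) ^+ inv_sign a J *: g (J :\ a) else 0.

Fact contr1_is_linear a : linear (contr1 a).
Proof.
move=> c g h; apply/funext => J; rewrite /contr1 !fctE; case: ifP => _.
  by rewrite scaler0 add0r.
by rewrite scalerDr !scalerA mulrC.
Qed.
HB.instance Definition _ a := GRing.isLinear.Build T
  ({set 'I_m} -> N) ({set 'I_m} -> N) *:%R (contr1 a) (contr1_is_linear a).

Fact emul1_is_linear a : linear (emul1 a).
Proof.
move=> c g h; apply/funext => J; rewrite /emul1 !fctE; case: ifP => _.
  by rewrite scalerDr !scalerA mulrC.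
by rewrite scaler0 add0r.
Qed.
HB.instance Definition _ a := GRing.isLinear.Build T
  ({set 'I_m} -> N) ({set 'I_m} -> N) *:%R (emul1 a) (emul1_is_linear a).

Lemma contr1_sqr a g : contr1 a (contr1 a g) = 0.
Proof.
apply/funext => J; rewrite /contr1 !inE eqxx /=; case: ifP => // _.
by rewrite scaler0.
Qed.

Lemma contr1C a b g : contr1 a (contr1 b g) = - contr1 b (contr1 a g).
Proof.
have [->|ab] := eqVneq a b; first by rewrite contr1_sqr oppr0.
have ba: b != a by rewrite eq_sym.
apply/funext => J; rewrite opprfctE /contr1 !inE (negbTE ab) (negbTE ba) /=.
case aJ: (a \in J); case bJ: (b \in J); rewrite ?scaler0 ?oppr0 //=.
rewrite !inv_signU ?aJ ?bJ // !scalerA setUCA !exprD -scaleNr; congr (_ *: _).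
have := ab; rewrite -val_eqE neq_ltn => /orP[] lt; rewrite lt ltnNge (ltnW lt) /=; ring.
Qed.

Lemma contr1_emul1 a b g :
  contr1 a (emul1 b g) + emul1 b (contr1 a g) = (a == b)%:R *: g.
Proof.
apply/funext => J; rewrite !fctE /contr1 /emul1 !inE.
have [->|ab] := eqVneq a b.
  rewrite /= scale1r; case: (boolP (b \in J)) => bJ; rewrite ?addr0 ?add0r.
    rewrite setD1K // scalerA -exprD /inv_sign.
    rewrite (_ : [set c in J :\ b | _] = [set c in J | (c < b)%N]).
      by rewrite addnn -signr_odd odd_double expr0 scale1r.
    by apply/setP=> c; rewrite !inE; case: eqP => // ->; rewrite ltnn !andbF.
  by rewrite scalerA -exprD inv_signUu addnn -signr_odd odd_double expr0 scale1r setU1K.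
rewrite scale0r /=.
case bJ: (b \in J); last by rewrite scaler0 if_same add0r.
case aJ: (a \in J); first by rewrite scaler0 add0r.
have ->: (a |: J) :\ b = a |: (J :\ b).
  apply/setP=> c; rewrite !inE; case: eqP => // ->.
  by rewrite eq_sym (negbTE ab).
rewrite !scalerA -scalerDl (_ : _ + _ = 0) ?scale0r //.
have {1 4}-> : J = b |: (J :\ b) by rewrite setD1K.
rewrite (@inv_signU a b) ?(@inv_signU b a) ?inE ?eqxx ?aJ ?andbF //=.
rewrite setD1K // !exprD.
have := ab; rewrite -val_eqE neq_ltn => /orP[] lt; rewrite lt ltnNge (ltnW lt) /=; ring.
Qed.

Definition contr (phi : 'I_m -> T) g := \sum_a phi a *: contr1 a g.
Definition emul (sigma : 'I_m -> T) g := \sum_a sigma a *: emul1 a g.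

Fact contr_is_linear phi : linear (contr phi).
Proof.
move=> c g h; rewrite /contr scaler_sumr -big_split; apply: eq_bigr => a _ /=.
by rewrite linearP scalerDr !scalerA mulrC.
Qed.
HB.instance Definition _ phi := GRing.isLinear.Build T
  ({set 'I_m} -> N) ({set 'I_m} -> N) *:%R (contr phi) (contr_is_linear phi).

Fact emul_is_linear phi : linear (emul phi).
Proof.
move=> c g h; rewrite /emul scaler_sumr -big_split; apply: eq_bigr => a _ /=.
by rewrite linearP scalerDr !scalerA mulrC.
Qed.
HB.instance Definition _ phi := GRing.isLinear.Build T
  ({set 'I_m} -> N) ({set 'I_m} -> N) *:%R (emul phi) (emul_is_linear phi).

Lemma contr_contrE phi psi g :
  contr phi (contr psi g) = \sum_a \sum_b (phi a * psi b) *: contr1 a (contr1 b g).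
Proof.
rewrite {1}/contr; apply: eq_bigr => a _.
rewrite linear_sum scaler_sumr; apply: eq_bigr => b _.
by rewrite linearZ scalerA.
Qed.

Lemma contrC phi psi g : contr phi (contr psi g) = - contr psi (contr phi g).
Proof.
rewrite !contr_contrE exchange_big -sumrN; apply: eq_bigr => b _ /=.
rewrite -sumrN; apply: eq_bigr => a _.
by rewrite contr1C scalerN mulrC.
Qed.

Lemma contr_sqr phi g : contr phi (contr phi g) = 0.
Proof.
rewrite contr_contrE.
have E a : \sum_b (phi a * phi b) *: contr1 a (contr1 b g) =
    \sum_(b : 'I_m | (b < a)%N) (phi a * phi b) *: contr1 a (contr1 b g)
  + \sum_(b : 'I_m | (a < b)%N) (phi a * phi b) *: contr1 a (contr1 b g).
  rewrite (bigD1 a) //= contr1_sqr scaler0 add0r.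
  rewrite (bigID (fun b : 'I_m => (b < a)%N)) /=; congr (_ + _); apply: eq_bigl => b.
    by rewrite -val_eqE; case: ltngtP.
  by rewrite -val_eqE; case: ltngtP.
under eq_bigr do rewrite E.
rewrite big_split /= [X in _ + X](exchange_big_dep predT) //= -big_split.
apply: big1 => a _ /=; rewrite -big_split; apply: big1 => b _ /=.
by rewrite contr1C scalerN mulrC addNr.
Qed.

(** The Clifford relation. Where the pairing of [phi] and [sigma] is invertible, it makes
    [emul sigma] a contracting homotopy for [contr phi]; all the homotopies on exterior powers below
    come from it. *)
Lemma contr_emul phi sigma g :
  contr phi (emul sigma g) + emul sigma (contr phi g)
  = (\sum_a phi a * sigma a) *: g.
Proof.
rewrite {1}/contr {2}/emul.
under eq_bigr => a _ do rewrite [emul sigma g]/emul linear_sum scaler_sumr.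
under [X in _ + X]eq_bigr => a _ do rewrite [contr phi g]/contr linear_sum scaler_sumr.
rewrite [X in _ + X]exchange_big -big_split scaler_suml; apply: eq_bigr => a _ /=.
rewrite -big_split (bigD1 a) //= [X in _ + X]big1 ?addr0 => [|b ba].
  by rewrite !linearZ /= !scalerA [sigma a * _]mulrC -scalerDr contr1_emul1 eqxx scale1r.
rewrite !linearZ /= !scalerA [sigma b * _]mulrC -scalerDr contr1_emul1.
by rewrite eq_sym (negbTE ba) scale0r scaler0.
Qed.

End Exterior.

(** * Divided powers *)

Lemma trinomial a b c : (a + b <= c)%N ->
  ('C(c, a) * 'C(c - a, b) = 'C(c, a + b) * 'C(a + b, a))%N.
Proof.
move=> abc; have ac : (a <= c)%N by lia.
have bca : (b <= c - a)%N by lia.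
apply/eqP; rewrite -(eqn_pmul2r (_ : 0 < a`! * (b`! * (c - a - b)`!))%N); last first.
  by rewrite !muln_gt0 !fact_gt0.
have e1 := bin_fact ac; have e2 := bin_fact bca.
have e3 := bin_fact abc; have e4 := bin_fact (leq_addr b a).
rewrite addKn in e4; rewrite subnDA in e3; apply/eqP.
transitivity c`!; [rewrite -e1 -e2 | rewrite -e3 -e4]; ring.
Qed.

Section DividedPowerSequence.
Variables (T : comNzRingType) (M : lmodType T).
Implicit Types P Q : nat -> {linear M -> M}.

(** The identities between the divided powers of one element. The whole sequence is recorded,
    because in characteristic p the operator [P 1] does not determine it. *)
Definition dps P := [/\ forall g, P 0%N g = g &
  forall a b g, P a (P b g) = 'C(a + b, a)%:R *: P (a + b)%N g].

Lemma sum_shift_bin (a b : nat) (R : nat -> M) (i : nat) : (i <= a)%N ->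
  \sum_(j < b.+1) ('C(i + j, i) * 'C(a + b - (i + j), a - i))%:R *: R (i + j)%N
  = \sum_(s < (a + b).+1) ('C(s, i) * 'C(a + b - s, a - i))%:R *: R s.
Proof.
move=> ia.
rewrite -(big_mkord predT (fun s => ('C(s, i) * 'C(a + b - s, a - i))%:R *: R s)).
rewrite -(big_mkord predT
  (fun j => ('C(i + j, i) * 'C(a + b - (i + j), a - i))%:R *: R (i + j)%N)).
rewrite [RHS](big_cat_nat (n := i)) //=; last by rewrite (leq_trans ia) // leqW // leq_addr.
rewrite [X in _ = X + _]big_nat_cond [X in _ = X + _]big1 ?add0r; last first.
  by move=> s /andP[/andP[_ si] _]; rewrite (bin_small si) mul0n scale0r.
rewrite [RHS](big_cat_nat (n := (i + b).+1)) //=; last 2 first.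
- by rewrite leqW // leq_addr.
- by rewrite ltnS leq_add2r.
rewrite [X in _ = _ + X]big_nat_cond [X in _ = _ + X]big1 ?addr0; last first.
  move=> s /andP[/andP[si sab] _].
  by rewrite ['C(a + b - s, _)]bin_small ?muln0 ?scale0r //; lia.
rewrite -[X in _ = \sum_(X <= _ < _) _](add0n i) big_addn.
have -> : ((i + b).+1 - i = b.+1)%N by lia.
by apply: eq_bigr => j _; rewrite [(j + i)%N]addnC.
Qed.

(** The divided powers of a sum of two commuting elements; collecting the terms with equal total
    exponents is Vandermonde's identity. *)
Lemma dps_prod P Q (PQ : nat -> {linear M -> M}) : dps P -> dps Q ->
    (forall a b g, P a (Q b g) = Q b (P a g)) ->
    (forall a g, PQ a g = \sum_(b < a.+1) P b (Q (a - b)%N g)) ->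
  dps PQ.
Proof.
move=> [P0 PP] [Q0 QQ] PQC PQE; split=> [g|a b g].
  by rewrite PQE big_ord1 subn0 P0 Q0.
rewrite !PQE scaler_sumr.
transitivity (\sum_(i < a.+1) \sum_(j < b.+1)
    ('C(i + j, i) * 'C(a + b - (i + j), a - i))%:R
      *: P (i + j)%N (Q (a + b - (i + j))%N g)).
  apply: eq_bigr => i _; rewrite !linear_sum; apply: eq_bigr => j _.
  rewrite -PQC QQ PP linearZ /= scalerA natrM.
  have -> : (a - i + (b - j) = a + b - (i + j))%N by have := ltn_ord i; have := ltn_ord j; lia.
  by [].
under eq_bigr => i _.
  rewrite (@sum_shift_bin a b (fun s => P s (Q (a + b - s)%N g)));
    last by rewrite -ltnS; exact: ltn_ord.
  over.
rewrite exchange_big /=; apply: eq_bigr => s _.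
rewrite -scaler_suml -natr_sum; congr (_%:R *: _).
rewrite -[in RHS](@subnKC s (a + b)); last by rewrite -ltnS; exact: ltn_ord.
by rewrite -binomial.Vandermonde.
Qed.

End DividedPowerSequence.

Section DividedPowers.
Variables (T : comNzRingType) (n : nat).
Local Notation D := ('X_{1..n} -> T^o).
Implicit Types (g : D) (j k : 'I_n).

Definition der j g : D := fun m => g (m + U_(j))%MM.
(** The shift of exponents, not multiplication by [e_j], which would bring in the factor [m j]. It
    is a right inverse of [der j] in every characteristic. *)
Definition raise j g : D := fun m => if (0 < m j)%N then g (m - U_(j))%MM else 0.
(** Multiplication by the divided power [e_j^(b)]. The truncated subtraction is harmless, since the
    binomial coefficient vanishes when [m j < b]. *)
Definition mulE j (b : nat) g : D :=
  fun m => 'C(m j, b)%:R * g (m - U_(j) *+ b)%MM.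

Fact der_is_linear j : linear (der j).
Proof. by []. Qed.
HB.instance Definition _ j := GRing.isLinear.Build T D D *:%R (der j) (der_is_linear j).

Fact raise_is_linear j : linear (raise j).
Proof.
move=> c g h; apply/funext => m; rewrite /raise !fctE; case: ifP => // _.
by rewrite scaler0 addr0.
Qed.
HB.instance Definition _ j :=
  GRing.isLinear.Build T D D *:%R (raise j) (raise_is_linear j).

Fact mulE_is_linear j b : linear (mulE j b).
Proof.
move=> c g h; apply/funext => m; rewrite /mulE !fctE mulrDr; congr (_ + _).
by rewrite /GRing.scale /= mulrCA.
Qed.
HB.instance Definition _ j b :=
  GRing.isLinear.Build T D D *:%R (mulE j b) (mulE_is_linear j b).

Lemma derC j k g : der j (der k g) = der k (der j g).
Proof. by apply/funext => m; rewrite /der -!addmA [(U_(j) + _)%MM]addmC. Qed.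

Lemma mulE0 j g : mulE j 0 g = g.
Proof. by apply/funext => m; rewrite /mulE bin0 mul1r mulm0n subm0. Qed.

Lemma mulED j a b g :
  mulE j a (mulE j b g) = 'C(a + b, a)%:R *: mulE j (a + b) g.
Proof.
apply/funext => m; rewrite /mulE !fctE /GRing.scale /= !mulrA -!natrM.
rewrite !mnmBE !mulmnE !mnm1E eqxx mul1n.
have [lt|le] := ltnP (m j) (a + b).
  rewrite [in RHS](bin_small lt) muln0 mul0r.
  have [lta|lea] := ltnP (m j) a; first by rewrite (bin_small lta) !mul0r.
  by rewrite [X in (_ * X)%N]bin_small ?muln0 ?mul0r //; lia.
congr (_%:R * g _); last by apply/mnmP => i; rewrite !mnmBE !mulmnE; lia.
by rewrite trinomial // mulnC.
Qed.

Lemma mulEC i j a b g : mulE i a (mulE j b g) = mulE j b (mulE i a g).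
Proof.
have [->|ij] := eqVneq i j.
  by rewrite !mulED [in RHS]addnC -bin_sub ?leq_addr // addKn.
apply/funext => m; rewrite /mulE !mnmBE !mulmnE !mnm1E [j == i]eq_sym (negbTE ij).
rewrite !mul0n !subn0 mulrCA; congr (_ * (_ * g _)).
by rewrite !submDA [(_ *+ a + _)%MM]addmC.
Qed.

Lemma der_mulE_neq j k b g : j != k -> der k (mulE j b g) = mulE j b (der k g).
Proof.
move=> jk; apply/funext => m; rewrite /der /mulE mnmDE mnm1E.
rewrite eq_sym (negbTE jk) addn0; congr (_ * g _).
apply/mnmP => i; rewrite !(mnmBE, mnmDE, mulmnE, mnm1E).
case: (eqVneq j i) => [<-|]; last by rewrite mul0n !subn0.
by rewrite eq_sym (negbTE jk) !addn0.
Qed.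

Lemma der_mulE j b g :
  der j (mulE j b.+1 g) = mulE j b.+1 (der j g) + mulE j b g.
Proof.
apply/funext => m; rewrite /der /mulE !fctE mnmDE mnm1E eqxx addn1 binS.
rewrite natrD mulrDl; congr (_ + _).
  have [lt|le] := ltnP (m j) b.+1; first by rewrite bin_small // !mul0r.
  congr (_ * g _); apply/mnmP => i; rewrite !(mnmBE, mnmDE, mulmnE, mnm1E).
  by case: (eqVneq j i) => [<-|]; lia.
congr (_ * g _); apply/mnmP => i; rewrite !(mnmBE, mnmDE, mulmnE, mnm1E).
by case: (eqVneq j i) => [<-|]; lia.
Qed.

Lemma der_mulE0 j k g : der k (mulE j 0 g) = mulE j 0 (der k g).
Proof. by rewrite !mulE0. Qed.

Lemma der_raise j k g : j != k -> der k (raise j g) = raise j (der k g).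
Proof.
move=> jk; apply/funext => m; rewrite /der /raise mnmDE mnm1E.
rewrite [k == j]eq_sym (negbTE jk) addn0; case: ifP => // m0; congr g.
apply/mnmP => i; rewrite !(mnmBE, mnmDE, mnm1E).
by case: (eqVneq j i) => [<-|_]; [rewrite eq_sym (negbTE jk)|]; lia.
Qed.

Lemma der_raisej j g : der j (raise j g) = g.
Proof.
apply/funext => m; rewrite /der /raise mnmDE mnm1E eqxx addn1 /=.
by congr g; apply/mnmP => i; rewrite !(mnmBE, mnmDE, mnm1E) addnK.
Qed.

Lemma raise_der j g m : raise j (der j g) m = if m j == 0%N then 0 else g m.
Proof.
rewrite /der /raise lt0n; case: eqP => //= /eqP; rewrite -lt0n => m0; congr g.
apply/mnmP => i; rewrite !(mnmBE, mnmDE, mnm1E); case: (eqVneq j i) => [<-|_]; lia.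
Qed.

Variable x : 'I_n -> T.

(* [ldiv js a] multiplies by the divided power l^(a) of l = \sum_(j <- js) x_j e_j. *)
Fixpoint ldiv (js : seq 'I_n) (a : nat) (g : D) : D :=
  if js is j :: js' then \sum_(b < a.+1) x j ^+ b *: mulE j b (ldiv js' (a - b) g)
  else if a == 0%N then g else 0.

Fact ldiv_is_linear js a : linear (ldiv js a).
Proof.
elim: js a => [|j js IH] a c g h /=; first by case: ifP; rewrite // scaler0 addr0.
rewrite scaler_sumr -big_split; apply: eq_bigr => b _ /=.
by rewrite IH linearP scalerDr !scalerA mulrC.
Qed.
HB.instance Definition _ js a :=
  GRing.isLinear.Build T D D *:%R (ldiv js a) (ldiv_is_linear js a).

Lemma mulE_ldiv j b js a g : mulE j b (ldiv js a g) = ldiv js a (mulE j b g).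
Proof.
elim: js a => [|i js IH] a /=; first by case: ifP; rewrite // linear0.
rewrite linear_sum; apply: eq_bigr => c _ /=.
by rewrite linearZ /= mulEC IH.
Qed.

Definition xmulE j b g : D := x j ^+ b *: mulE j b g.
Fact xmulE_is_linear j b : linear (xmulE j b).
Proof. by move=> c g h; rewrite /xmulE linearP scalerDr !scalerA mulrC. Qed.
HB.instance Definition _ j b :=
  GRing.isLinear.Build T D D *:%R (xmulE j b) (xmulE_is_linear j b).

Lemma dps_ldiv js : dps (fun a => (ldiv js a : {linear D -> D})).
Proof.
elim: js => [|j js IH].
  split=> // a b g; case: a => [|a] /=; first by rewrite bin0 scale1r add0n.
  by case: b => [|b] /=; rewrite ?scaler0.
apply: (@dps_prod _ _ (fun a => xmulE j a : {linear D -> D})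
  (fun a => ldiv js a : {linear D -> D})) => //.
- split=> [g|a b g] /=; first by rewrite /xmulE expr0 scale1r mulE0.
  by rewrite /xmulE linearZ /= mulED !scalerA exprD; congr (_ *: _); ring.
- by move=> a b g /=; rewrite /xmulE linearZ /= mulE_ldiv.
Qed.

Lemma ldiv0 js g : ldiv js 0 g = g.
Proof. by have [H _] := dps_ldiv js; exact: H. Qed.

Lemma ldivD js a b g :
  ldiv js a (ldiv js b g) = 'C(a + b, a)%:R *: ldiv js (a + b) g.
Proof. by have [_ H] := dps_ldiv js; exact: H. Qed.

(** [der k] is a derivation taking l^(a + 1) to x_k l^(a). This is where inverting x_k separates l
    from the other variables. *)
Lemma der_ldiv k js a g : uniq js ->
  der k (ldiv js a.+1 g)
  = ldiv js a.+1 (der k g) + ((k \in js)%:R * x k) *: ldiv js a g.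
Proof.
elim: js a => [|j js IH] a /=.
  by rewrite mul0r scale0r addr0 => _; exact: linear0.
case/andP=> jjs ujs; rewrite inE.
rewrite linear_sum /=; have [kj|kj] := eqVneq k j.
  subst j.
  rewrite mul1r big_ord_recl [X in _ = X + _]big_ord_recl /= !subn0.
  rewrite linearZ /= der_mulE0 IH // (negbTE jjs) mul0r scale0r addr0 -addrA.
  congr (_ + _); rewrite scaler_sumr -big_split; apply: eq_bigr => b _ /=.
  rewrite linearZ /= der_mulE scalerDr /bump /= add1n subSS.
  have -> : der k (ldiv js (a - b) g) = ldiv js (a - b) (der k g).
    case: (a - b)%N => [|c]; first by rewrite !ldiv0.
    by rewrite IH // (negbTE jjs) mul0r scale0r addr0.
  by rewrite scalerA -exprS.
rewrite orFb big_ord_recr [X in _ = X + _]big_ord_recr /= subnn.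
rewrite -addrA [X in _ = _ + X]addrC addrA.
congr (_ + _); last by rewrite linearZ /= der_mulE_neq 1?eq_sym // !ldiv0.
rewrite scaler_sumr -big_split; apply: eq_bigr => b _ /=.
rewrite linearZ /= der_mulE_neq 1?eq_sym // subSn; last by rewrite -ltnS; exact: ltn_ord.
rewrite IH // linearD /= scalerDr; congr (_ + _).
by rewrite linearZ /= !scalerA mulrC.
Qed.

Lemma ldiv_x0 js a g : (forall j, x j = 0) -> ldiv js a g = if a == 0%N then g else 0.
Proof.
move=> x0; elim: js a => [|j js IH] a //=.
rewrite big_ord_recl big1 ?addr0 => [|b _]; last by rewrite x0 expr0n /= scale0r.
by rewrite expr0 scale1r subn0 mulE0 IH.
Qed.

End DividedPowers.

(** * The cobar construction *)

Lemma triangle_sum (V : zmodType) (m : nat) (G : nat -> nat -> V) :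
  \sum_(a < m) \sum_(c < m - a) G a c = \sum_(N < m) \sum_(a < N.+1) G a (N - a)%N.
Proof.
elim: m => [|m IH]; first by rewrite !big_ord0.
rewrite [RHS]big_ord_recr /= -IH.
transitivity (\sum_(a < m.+1) (\sum_(c < m - a) G a c + G a (m - a)%N)).
  apply: eq_bigr => a _.
  by rewrite subSn ?big_ord_recr //; rewrite -ltnS; exact: ltn_ord.
rewrite big_split /=; congr (_ + _).
by rewrite big_ord_recr /= subnn big_ord0 addr0.
Qed.

Lemma alternating_bin (T : comNzRingType) c :
  \sum_(i < c.+1) (-1) ^+ i * 'C(c, i)%:R = (c == 0%N)%:R :> T.
Proof.
have := exprBn (1 : T) 1 c; rewrite subrr expr0n => ->.
by apply: eq_bigr => i _; rewrite !expr1n !mulr1 mulr_natr.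
Qed.

Section Bar.
Variables (T : comNzRingType) (M : lmodType T).
Variables (L : nat -> {linear M -> M}) (K : {linear M -> M}) (B : nat).
Implicit Types (F G : seq nat -> M) (w : seq nat).

(* The cobar differential of the divided power algebra on one generator, which acts by [L]
   (with letters below [B]), twisted by the commuting differential [K]. *)
Fixpoint bdel F w : M :=
  if w is a :: w' then
    - (\sum_(p < a.+1) 'C(a, p)%:R *: F (val p :: (a - p)%N :: w'))
    - bdel (fun v => F (a :: v)) w'
  else 0.

(** In coordinates: the first letter of a word acts on the module, two neighbouring letters are
    multiplied, and [K] acts with a sign. The bound [B] keeps the sum finite; it loses nothing as
    long as [F] vanishes on large letters, whence the hypothesis of [bar_sqr]. *)
Definition bar F w : M :=
  \sum_(a < B) L a (F (val a :: w)) + bdel F w + (-1) ^+ size w *: K (F w).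

Lemma bdel_linear_comb c F G w : bdel (c *: F + G) w = c *: bdel F w + bdel G w.
Proof.
elim: w F G => [|a w IH] F G /=; first by rewrite scaler0 addr0.
rewrite (_ : (fun v => _) = c *: (fun v => F (a :: v)) + (fun v => G (a :: v))) //.
rewrite IH scalerDr opprD !scalerN [in RHS]addrACA; congr (_ + _).
rewrite -opprD; congr (- _); rewrite scaler_sumr -big_split; apply: eq_bigr => p _ /=.
by rewrite !fctE scalerDr !scalerA mulrC.
Qed.

Lemma bar_linear_comb c F G w : bar (c *: F + G) w = c *: bar F w + bar G w.
Proof.
rewrite /bar bdel_linear_comb !scalerDr.
have -> : \sum_(a < B) L a ((c *: F + G) (val a :: w))
  = c *: (\sum_(a < B) L a (F (val a :: w))) + \sum_(a < B) L a (G (val a :: w)).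
  by rewrite scaler_sumr -big_split; apply: eq_bigr => a _; rewrite !fctE linearP.
have -> : (-1) ^+ size w *: K ((c *: F + G) w)
  = c *: ((-1) ^+ size w *: K (F w)) + (-1) ^+ size w *: K (G w).
  by rewrite !fctE linearP scalerDr !scalerA mulrC.
by rewrite [X in X + _]addrACA [LHS]addrACA.
Qed.

Lemma bdelD F G w : bdel (fun v => F v + G v) w = bdel F w + bdel G w.
Proof. by have := bdel_linear_comb 1 F G w; rewrite !scale1r. Qed.

Lemma bdel_map (f : {linear M -> M}) F w : bdel (fun v => f (F v)) w = f (bdel F w).
Proof.
elim: w F => [|a w IH] F /=; first by rewrite linear0.
rewrite IH linearB linearN (linear_sum f) /=; congr (- _ - _).
by apply: eq_bigr => p _; rewrite linearZ.
Qed.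

Lemma eq_bdel F G w : F =1 G -> bdel F w = bdel G w.
Proof. by move=> /funext ->. Qed.

Lemma bdel0 w : bdel (fun=> 0) w = 0.
Proof.
elim: w => [|a w IH] //=; rewrite IH subr0 big1 ?oppr0 // => p _.
by rewrite scaler0.
Qed.

Lemma bdel_sum (I : Type) (r : seq I) (P : pred I) (F : I -> seq nat -> M) w :
  bdel (fun v => \sum_(i <- r | P i) F i v) w = \sum_(i <- r | P i) bdel (F i) w.
Proof.
elim: r => [|i r IH].
  by under eq_bdel do rewrite big_nil; rewrite big_nil bdel0.
under eq_bdel do rewrite big_cons; rewrite big_cons.
by case: ifP => _ //; rewrite bdelD IH.
Qed.

Lemma bdelZ c F w : bdel (fun v => c *: F v) w = c *: bdel F w.
Proof.
have := bdel_linear_comb c F (fun=> 0) w; rewrite bdel0 [X in _ = X]addr0 => <-.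
by apply: eq_bdel => v; rewrite !fctE addr0.
Qed.

Lemma bdelN F w : bdel (fun v => - F v) w = - bdel F w.
Proof. by rewrite -scaleN1r -bdelZ; apply: eq_bdel => v; rewrite scaleN1r. Qed.

Lemma bdel_signed F w :
  bdel (fun v => (-1) ^+ size v *: K (F v)) w = - ((-1) ^+ size w *: K (bdel F w)).
Proof.
elim: w F => [|a w IH] F /=; first by rewrite linear0 scaler0 oppr0.
have -> : bdel (fun v => (-1) ^+ (size v).+1 *: K (F (a :: v))) w
    = - bdel (fun v => (-1) ^+ size v *: K (F (a :: v))) w.
  by rewrite -bdelN; apply: eq_bdel => v; rewrite exprS mulN1r scaleNr.
rewrite IH opprK linearB linearN (linear_sum K) /= !exprS !mulN1r opprK scaleNr opprK.
rewrite scalerBr scalerN scaler_sumr; congr (- _ - _).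
by apply: eq_bigr => p _; rewrite (linearZ_LR K) !scalerA mulrC.
Qed.

Lemma bdel_sqr F w : bdel (bdel F) w = 0.
Proof.
have aux (x y z : M) : - x - (- y - z) = y - x + z.
  by rewrite opprB opprK addrC [z + y]addrC addrAC.
elim: w F => [|a w IH] F //=.
have -> : bdel (fun v => - (\sum_(p < a.+1) 'C(a, p)%:R *: F [:: val p, (a - p)%N & v])
                        - bdel (fun u => F (a :: u)) v) w
    = - \sum_(p < a.+1) 'C(a, p)%:R *: bdel (fun v => F [:: val p, (a - p)%N & v]) w.
  rewrite bdelD bdelN bdel_sum [X in _ + X]bdelN IH oppr0 addr0; congr (- _).
  by apply: eq_bigr => p _; rewrite bdelZ.
rewrite opprK.
transitivity (- (\sum_(p < a.+1) \sum_(t < (a - p).+1)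
      ('C(a, p) * 'C(a - p, t))%:R *: F [:: val p, val t, (a - p - t)%N & w])
   + \sum_(p < a.+1) \sum_(t < p.+1)
      ('C(a, p) * 'C(p, t))%:R *: F [:: val t, (p - t)%N, (a - p)%N & w]).
  transitivity (- (\sum_(p < a.+1)
       (('C(a, p)%:R *: (\sum_(t < (a - p).+1) 'C(a - p, t)%:R
           *: F [:: val p, val t, (a - p - t)%N & w])
       - 'C(a, p)%:R *: (\sum_(t < p.+1) 'C(p, t)%:R
           *: F [:: val t, (p - t)%N, (a - p)%N & w]))
       + 'C(a, p)%:R *: bdel (fun v => F [:: val p, (a - p)%N & v]) w))
     + \sum_(p < a.+1) 'C(a, p)%:R *: bdel (fun v => F [:: val p, (a - p)%N & v]) w).
    congr (- _ + _); apply: eq_bigr => p _.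
    by rewrite -scalerBr -scalerDr; congr (_ *: _); exact: aux.
  rewrite big_split opprD addrNK sumrB opprB addrC; congr (- _ + _).
    by apply: eq_bigr => p _; rewrite scaler_sumr; apply: eq_bigr => t _; rewrite scalerA natrM.
  by apply: eq_bigr => p _; rewrite scaler_sumr; apply: eq_bigr => t _; rewrite scalerA natrM.
pose G p t := ('C(a, p) * 'C(a - p, t))%:R *: F [:: p, t, (a - p - t)%N & w].
have -> : \sum_(p < a.+1) \sum_(t < (a - p).+1)
    ('C(a, p) * 'C(a - p, t))%:R *: F [:: val p, val t, (a - p - t)%N & w]
  = \sum_(p < a.+1) \sum_(t < a.+1 - p) G p t.
  by apply: eq_bigr => p _; rewrite subSn //; rewrite -ltnS; exact: ltn_ord.
rewrite triangle_sum addrC; apply/eqP; rewrite subr_eq0; apply/eqP.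
apply: eq_bigr => p _; apply: eq_bigr => t _; rewrite /G.
have pa := ltn_ord p; have tp := ltn_ord t.
have tp' : (t <= p)%N by rewrite -ltnS.
rewrite trinomial; last by lia.
by rewrite -subnDA subnKC.
Qed.

Hypothesis Ldps : dps L.
Hypothesis K_sqr : forall g, K (K g) = 0.
Hypothesis KL : forall a g, K (L a g) = L a (K g).

Lemma bar_sqr F w : (forall a b, (B <= a + b)%N -> F [:: a, b & w] = 0) ->
  bar (bar F) w = 0.
Proof.
move=> F0; have [L0 LD] := Ldps.
have E1 : \sum_(a < B) L a (bar F (val a :: w))
  = - bdel (fun v => \sum_(a < B) L a (F (val a :: v))) w
    + (-1) ^+ (size w).+1 *: K (\sum_(a < B) L a (F (val a :: w))).
  rewrite bdel_sum (linear_sum K) scaler_sumr -sumrN -big_split /=.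
  under [RHS]eq_bigr => a _ do rewrite bdel_map KL.
  transitivity (\sum_(a < B) \sum_(b < B) L a (L b (F [:: val b, val a & w]))
    - \sum_(a < B) \sum_(p < a.+1) L a ('C(a, p)%:R *: F [:: val p, (a - p)%N & w])
    + \sum_(a < B) (- L a (bdel (fun v => F (val a :: v)) w)
        + (-1) ^+ (size w).+1 *: L a (K (F (val a :: w))))).
    rewrite -sumrB -big_split; apply: eq_bigr => a _ /=.
    rewrite {1}/bar /= linearD linearD /= linearB linearN !(linear_sum (L a)) /=.
    by rewrite (linearZ_LR (L a)) -!addrA.
  rewrite (_ : _ - _ = 0) ?add0r //; apply/eqP; rewrite subr_eq0; apply/eqP.
  (* Letting two letters act in turn agrees with letting their product act, by the [dps] identity.
     Pairs with [p + q >= B] drop out by [F0]. *)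
  pose G p q : M := ('C(p + q, p))%:R *: L (p + q)%N (F [:: p, q & w]).
  transitivity (\sum_(a < B) \sum_(b < B) G a b).
    rewrite exchange_big; apply: eq_bigr => a _; apply: eq_bigr => b _ /=.
    rewrite LD /G [(b + a)%N]addnC; congr (_%:R *: _).
    by rewrite -[RHS]bin_sub ?leq_addr // addKn.
  transitivity (\sum_(a < B) \sum_(b < B - a) G a b).
    apply: eq_bigr => a _; rewrite -!(big_mkord predT (G a)).
    rewrite (big_cat_nat (n := B - a)) ?leq_subr //= [X in _ + X]big_nat_cond.
    rewrite [X in _ + X]big1 ?addr0 // => b /andP[/andP[ab _] _].
    by rewrite /G F0 ?linear0 ?scaler0 //; lia.
  rewrite triangle_sum; apply: eq_bigr => a _; apply: eq_bigr => p _.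
  by rewrite /G subnKC ?(linearZ_LR (L a)) // -ltnS; exact: ltn_ord.
have E2 : bdel (bar F) w = bdel (fun v => \sum_(a < B) L a (F (val a :: v))) w
   - (-1) ^+ size w *: K (bdel F w).
  by rewrite [bdel (bar F) w]bdelD bdelD bdel_sqr addr0 bdel_signed.
have E3 : K (bar F w) = K (\sum_(a < B) L a (F (val a :: w))) + K (bdel F w).
  by rewrite /bar linearD (linearZ_LR K) K_sqr scaler0 addr0 linearD.
rewrite {1}/bar E1 E2 E3 exprS mulN1r scaleNr scalerDr.
set A := bdel _ w; set C := _ *: K (\sum_(_ < _) _); set E := _ *: K (bdel F w).
by rewrite [X in X + _]addrACA addNr add0r -opprD addNr.
Qed.

End Bar.

Section BarHomotopy.
Variables (T : comNzRingType) (M : lmodType T).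
Variables (L : nat -> {linear M -> M}) (K d : {linear M -> M}) (u : T).
Hypothesis Ldps : dps L.
Hypothesis KL : forall a g, K (L a g) = L a (K g).
Hypothesis dK : forall g, d (K g) = K (d g).
Hypothesis dL : forall a g, d (L a.+1 g) = L a.+1 (d g) + u *: L a g.
Implicit Types (F : seq nat -> M) (w : seq nat) (g : M).

Let L0 g : L 0%N g = g. Proof. by case: Ldps => H _; exact: H. Qed.
Let LD a b g : L a (L b g) = 'C(a + b, a)%:R *: L (a + b)%N g.
Proof. by case: Ldps => _; apply. Qed.

Lemma iter_linear a : linear (iter a d).
Proof. by move=> c g h; elim: a => //= a ->; rewrite linearP. Qed.
HB.instance Definition _ a := GRing.isLinear.Build T M M *:%R (iter a d) (iter_linear a).

Lemma iter_K a g : iter a d (K g) = K (iter a d g).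
Proof. by elim: a => //= a ->; rewrite dK. Qed.

Lemma leibniz a c g : iter a d (L c g)
  = \sum_(i < c.+1) ('C(a, i)%:R * u ^+ i) *: L (c - i)%N (iter (a - i) d g).
Proof.
elim: a => [|a IH].
  rewrite big_ord_recl big1 ?addr0 => [|i _]; last by rewrite bin0n mul0r scale0r.
  by rewrite bin0 expr0 mulr1 scale1r subn0.
rewrite iterS IH (linear_sum d).
have E (i : 'I_c.+1) : d (('C(a, i)%:R * u ^+ i) *: L (c - i)%N (iter (a - i) d g))
   = ('C(a, i)%:R * u ^+ i) *: L (c - i)%N (iter (a - i).+1 d g)
   + ((i < c)%:R * 'C(a, i)%:R * u ^+ i.+1) *: L (c - i).-1 (iter (a - i) d g).
  rewrite (linearZ_LR d) /=; case: ltnP => ic.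
    have {1 2}-> : (c - i = (c - i).-1.+1)%N by lia.
    rewrite dL scalerDr scalerA mul1r exprSr mulrA; congr (_ *: L _ _ + _); lia.
  have -> : (c - i = 0)%N by lia.
  by rewrite !L0 !mul0r scale0r addr0.
under eq_bigr do rewrite E.
rewrite big_split /= [X in X + _]big_ord_recl [RHS]big_ord_recl /=.
rewrite !bin0 !subn0 -iterS -addrA; congr (_ + _).
rewrite [X in _ + X]big_ord_recr /= ltnn !mul0r scale0r addr0 -big_split.
apply: eq_bigr => i _ /=; rewrite /bump /= add1n ltn_ord mul1r binS natrD subSS.
have -> : ((c - i).-1 = c - i.+1)%N by lia.
rewrite mulrDl scalerDl; congr (_ + _).
have [ai|ia] := leqP a i; first by rewrite bin_small ?mul0r ?scale0r.
by rewrite -[d (iter _ _ _)]iterS subnSK.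
Qed.

(* Over [T[1/u]], [u ^- N *: proj N] is the projection onto [ker d] along the images of the
   [L c] with [c > 0], on elements killed by [d ^ N.+1]. *)
Definition proj N g := \sum_(a < N.+1) ((-1) ^+ a * u ^+ (N - a)) *: L a (iter a d g).

Fact proj_is_linear N : linear (proj N).
Proof.
move=> c g h; rewrite /proj scaler_sumr -big_split; apply: eq_bigr => a _ /=.
by rewrite !linearP.
Qed.
HB.instance Definition _ N := GRing.isLinear.Build T M M *:%R (proj N) (proj_is_linear N).

Lemma proj_K N g : proj N (K g) = K (proj N g).
Proof.
rewrite /proj (linear_sum K); apply: eq_bigr => a _.
by rewrite (linearZ_LR K) KL iter_K.
Qed.

Lemma proj_ker N g : iter N.+1 d g = 0 -> d (proj N g) = 0.
Proof.
move=> g0; rewrite /proj (linear_sum d).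
rewrite (eq_bigr (fun a : 'I_N.+1 => ((-1) ^+ a * u ^+ (N - a)) *: L a (iter a.+1 d g)
   + (if val a == 0%N then 0 else ((-1) ^+ a * u ^+ (N - a).+1) *: L (val a).-1 (iter a d g)))).
  rewrite big_split /= big_ord_recr /= -iterS g0 linear0 scaler0 addr0.
  rewrite [X in _ + X]big_ord_recl /= add0r -big_split big1 // => a _ /=.
  rewrite /bump /= add1n subnSK // exprS mulN1r mulNr scaleNr.
  by rewrite addrN.
case=> [[|a] aN] _; rewrite (linearZ_LR d) /=; first by rewrite !L0 addr0.
by rewrite dL scalerDr scalerA [u ^+ _.+1]exprSr mulrA.
Qed.

Lemma proj_addn N c g : (forall k, (N < k)%N -> iter k d g = 0) ->
  proj (N + c) g = u ^+ c *: proj N g.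
Proof.
move=> g0; rewrite /proj scaler_sumr.
rewrite -(big_mkord predT (fun a => ((-1) ^+ a * u ^+ (N + c - a)) *: L a (iter a d g))).
rewrite (big_cat_nat (n := N.+1)) //=; last by rewrite ltnS leq_addr.
rewrite [X in _ + X]big_nat_cond [X in _ + X]big1 ?addr0; last first.
  by move=> a /andP[/andP[Na _] _]; rewrite g0 // linear0 scaler0.
rewrite big_mkord; apply: eq_bigr => a _; rewrite scalerA mulrCA -exprD.
by congr ((_ * _ ^+ _) *: _); have := ltn_ord a; lia.
Qed.

(** After expanding by [leibniz], the coefficient of each [L (s + C) (iter s d g)] is a multiple of
    the alternating sum of the ['C(C, i)], which is zero because [C > 0]. *)
Lemma proj_L N c g : (forall k, (N < k + c.+1)%N -> iter k d g = 0) ->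
  proj N (L c.+1 g) = 0.
Proof.
move=> g0; rewrite /proj; set C := c.+1 in g0 *.
pose G i s := ((-1) ^+ i * 'C(C, i)%:R) *: (((-1) ^+ s * u ^+ (N - s) * 'C(s + C, s)%:R)
   *: L (s + C)%N (iter s d g)).
transitivity (\sum_(i < C.+1) \sum_(s < N.+1) G i s); last first.
  rewrite exchange_big big1 // => s _ /=.
  by rewrite -scaler_suml alternating_bin scale0r.
under eq_bigr => a _ do rewrite leibniz (linear_sum (L a)) scaler_sumr.
rewrite exchange_big; apply: eq_bigr => i _ /=.
pose H a := ((-1) ^+ a * u ^+ (N - a)) *:
   L a (('C(a, i)%:R * u ^+ i) *: L (C - i)%N (iter (a - i) d g)).
have iC : (i <= C)%N by rewrite -ltnS.
rewrite -(big_mkord predT H) -(big_mkord predT (G i)).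
have [Ni|iN] := ltnP N i.
  rewrite big_nat_cond big1 => [|a /andP[/andP[_ aN] _]]; last first.
    by rewrite /H bin_small ?mul0r ?scale0r ?linear0 ?scaler0 //; lia.
  rewrite big_nat_cond big1 // => s /andP[/andP[_ sN] _].
  by rewrite /G g0 ?linear0 ?scaler0 //; lia.
rewrite (big_cat_nat (n := i)) //=; last by rewrite leqW.
rewrite big_nat_cond big1 ?add0r => [|a /andP[/andP[_ ai] _]]; last first.
  by rewrite /H bin_small ?mul0r ?scale0r ?linear0 ?scaler0.
rewrite -[X in \sum_(X <= _ < _) _](add0n i) big_addn.
rewrite [RHS](big_cat_nat (n := N.+1 - i)) ?leq_subr //=.
rewrite [X in _ = _ + X]big_nat_cond [X in _ = _ + X]big1 ?addr0; last first.
  by move=> s /andP[/andP[sN _] _]; rewrite /G g0 ?linear0 ?scaler0 //; lia.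
rewrite !big_mkord; apply: eq_bigr => s _; have sN := ltn_ord s.
rewrite /H /G addnK (linearZ_LR (L _)) LD !scalerA /=.
have -> : (s + i + (C - i) = s + C)%N by lia.
congr (_ *: _); rewrite addnC exprD.
have -> : (u ^+ (N - s) = u ^+ (N - (i + s)) * u ^+ i).
  by rewrite -exprD; congr (_ ^+ _); lia.
have : ('C(C, i) * 'C(s + C, s) = 'C(i + s, i) * 'C(s + C, i + s))%N.
  have := @trinomial s i (s + C); rewrite addKn => E.
  rewrite mulnC E; last by lia.
  by rewrite [(i + s)%N]addnC mulnC -[in RHS]bin_sub ?leq_addl // addnK.
move/(congr1 (fun z => z%:R : T)); rewrite !natrM => E.
transitivity ((-1) ^+ i * (-1) ^+ s * (u ^+ (N - (i + s)) * u ^+ i)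
  * ('C(i + s, i)%:R * 'C(s + C, i + s)%:R)); last by rewrite -E; ring.
ring.
Qed.

(** In the Leibniz expansion every term that keeps a factor [L] of positive index is killed by
    [proj_L]; what remains is the term in which [L c] is differentiated [c] times. *)
Lemma proj_iter_L N b c g : (forall k, (N < k + c)%N -> iter k d g = 0) ->
  proj (N - b) (iter b d (L c g))
  = 'C(b, c)%:R *: proj (N - (b - c)) (iter (b - c) d g).
Proof.
move=> g0; rewrite leibniz big_ord_recr /= (linearD (proj (N - b))) /=.
rewrite (linear_sum (proj (N - b))) big1 ?add0r => [|i _]; last first.
  rewrite (linearZ_LR (proj (N - b))) /=; have ic := ltn_ord i.
  have [bi|ib] := ltnP b i; first by rewrite bin_small // mul0r scale0r.
  have -> : (c - i = (c - i).-1.+1)%N by lia.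
  rewrite proj_L ?scaler0 // => k kN; rewrite -iterD g0 //; lia.
rewrite (linearZ_LR (proj (N - b))) /= subnn L0 -scalerA.
have [bc|cb] := ltnP b c; first by rewrite bin_small // !scale0r.
congr (_ *: _).
have h0 k : (N - b < k)%N -> iter k d (iter (b - c) d g) = 0.
  by move=> kN; rewrite -iterD g0 //; lia.
have [bN|Nb] := leqP b N.
  by rewrite -proj_addn //; congr proj; lia.
have z : iter (b - c) d g = 0 by apply: g0; lia.
by rewrite z !linear0 ?scaler0.
Qed.

(** Taylor's formula in the variable l with coefficients in [ker d], cleared of the denominators
    [u ^+ N]. *)
Lemma sum_L_proj N g : (forall k, (N < k)%N -> iter k d g = 0) ->
  \sum_(a < N.+1) L a (proj (N - a) (iter a d g)) = u ^+ N *: g.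
Proof.
move=> g0.
pose G a c := ((-1) ^+ c * u ^+ (N - a - c) * 'C(a + c, a)%:R)
   *: L (a + c)%N (iter (a + c) d g).
transitivity (\sum_(a < N.+1) \sum_(c < N.+1 - a) G a c).
  apply: eq_bigr => a _; rewrite /proj (linear_sum (L a)) subSn; last by rewrite -ltnS.
  apply: eq_bigr => c _; rewrite (linearZ_LR (L a)) LD scalerA -iterD.
  by rewrite /G [(a + c)%N]addnC.
rewrite triangle_sum big_ord_recl [X in _ + X]big1 ?addr0 => [|k _].
  by rewrite big_ord1 /G /= bin0 !subn0 expr0 mul1r mulr1 L0.
rewrite /G (eq_bigr (fun a : 'I_(lift ord0 k).+1 =>
   ((-1) ^+ (lift ord0 k - a) * 'C(lift ord0 k, lift ord0 k - a)%:R)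
     *: (u ^+ (N - lift ord0 k) *: L (lift ord0 k) (iter (lift ord0 k) d g)))).
  rewrite -scaler_suml (reindex_inj rev_ord_inj) /=.
  rewrite (eq_bigr (fun i : 'I_(lift ord0 k).+1 => (-1) ^+ i * 'C(lift ord0 k, i)%:R)).
    by rewrite alternating_bin scale0r.
  by move=> i _; rewrite !subSS subKn // -ltnS; exact: ltn_ord.
move=> a _; have ak : (a <= lift ord0 k)%N by rewrite -ltnS; exact: ltn_ord.
rewrite subnKC // scalerA bin_sub // -subnDA subnKC //; congr (_ *: _); ring.
Qed.

Variables (B N : nat).
Hypothesis NB : (N < B)%N.

(** The contracting homotopy of the bar construction: the Taylor coefficient of [L b] is moved into
    a new first letter [b]. The value zero at [b = 0] keeps words normalized. *)
Definition bar_prim F w : M :=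
  if w is b :: w' then if b == 0%N then 0 else proj (N - b) (iter b d (F w')) else 0.

(** Once [u] is inverted, the module is free over the divided powers of l with [ker d] as
    generators. So the bar construction is exact except for a copy of [ker d] at the empty word,
    which is the term [proj N (F w)]. *)
Lemma bar_homotopy F w : (forall v, 0%N \in v -> F v = 0) ->
    (forall v k, (N < k + sumn v)%N -> iter k d (F v) = 0) ->
  bar L K B (bar_prim F) w + bar_prim (bar L K B F) w
  = u ^+ N *: F w - (if w is [::] then proj N (F w) else 0).
Proof.
move=> F0 Fnil.
have Fnil0 v : (N < sumn v)%N -> F v = 0 by move=> h; exact: (Fnil v 0%N).
have E1 v : \sum_(a < B) L a (bar_prim F (val a :: v)) = u ^+ N *: F v - proj N (F v).
  rewrite -sum_L_proj => [|k kN]; last by apply: Fnil; rewrite ltn_addr.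
  pose G a := L a (if a == 0%N then 0 else proj (N - a) (iter a d (F v))).
  rewrite -(big_mkord predT G) (big_cat_nat (n := N.+1)) //=.
  rewrite [X in _ + X]big_nat_cond [X in _ + X]big1 ?addr0; last first.
    move=> a /andP[/andP[aN _] _]; rewrite /G; case: eqP => _; first exact: linear0.
    by rewrite Fnil ?linear0 // ltn_addr.
  rewrite big_mkord big_ord_recl [X in _ = X - _]big_ord_recl /G /= linear0 add0r.
  by rewrite L0 subn0 addrC addrA addNr add0r.
case: w => [|b w].
  by rewrite /bar E1 /= !linear0 ?scaler0 !addr0.
have [->|b0] := eqVneq b 0%N.
  have z : F (0%N :: w) = 0 by rewrite F0 ?inE.
  rewrite {1}/bar E1 z /= big_ord1 (@eq_bdel _ _ _ (fun=> 0)) // bdel0.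
  by rewrite !linear0 ?addr0.
rewrite [X in _ = _ - X]/= subr0 {1}/bar E1 /= (negbTE b0) /=.
pose J (x : M) := proj (N - b) (iter b d x).
have Jlin : linear J by move=> c g h; rewrite /J !linearP.
pose HJ := GRing.isLinear.Build T M M *:%R J Jlin.
pose JL : {linear M -> M} := HB.pack J HJ.
have -> : bdel (fun v => proj (N - b) (iter b d (F v))) w = J (bdel F w).
  by rewrite -[J _]/(JL _) -bdel_map.
have -> : K (proj (N - b) (iter b d (F w))) = J (K (F w)) by rewrite /J iter_K proj_K.
have -> : proj (N - b) (iter b d (bar L K B F w)) = \sum_(a < B) J (L a (F (val a :: w)))
    + J (bdel F w) + (-1) ^+ size w *: J (K (F w)).
  by rewrite -[LHS]/(JL _) /bar 2!(linearD JL) (linear_sum JL) (linearZ_LR JL).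
(* By [proj_iter_L] the action of the first letter, after [J], becomes the sum that [bdel] produces
   by splitting [b]. The two cancel; the part [p = 0], where [bar_prim] is zero, is written
   separately and cancels the projection in [E1]. *)
have E2 : \sum_(a < B) J (L a (F (val a :: w))) =
   proj N (F (b :: w)) + \sum_(p < b.+1) 'C(b, p)%:R *:
     (if val p == 0%N then 0 else proj (N - p) (iter p d (F ((b - p)%N :: w)))).
  transitivity (\sum_(p < b.+1) 'C(b, p)%:R *: proj (N - p) (iter p d (F ((b - p)%N :: w)))).
    pose G a := 'C(b, a)%:R *: proj (N - (b - a)) (iter (b - a) d (F (a :: w))).
    transitivity (\sum_(a < B) G a).
      apply: eq_bigr => a _; rewrite /J proj_iter_L // => k kN.
      by rewrite Fnil //= addnA; lia.
    transitivity (\sum_(a < b.+1) G a).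
      have [bB|Bb] := leqP b.+1 B.
        rewrite -!(big_mkord predT G) (big_cat_nat (n := b.+1)) //= [X in _ + X]big_nat_cond.
        rewrite [X in _ + X]big1 ?addr0 // => a /andP[/andP[ab _] _].
        by rewrite /G bin_small // scale0r.
      rewrite -!(big_mkord predT G) [RHS](big_cat_nat (n := B)) //=; last by lia.
      rewrite [X in _ = _ + X]big_nat_cond [X in _ = _ + X]big1 ?addr0 //.
      move=> a /andP[/andP[Ba _] _].
      by rewrite /G Fnil0 ?linear0 ?scaler0 //=; lia.
    rewrite (reindex_inj rev_ord_inj) /=; apply: eq_bigr => p _.
    have pb : (p <= b)%N by rewrite -ltnS.
    by rewrite /G subSS subKn // bin_sub.
  rewrite big_ord_recl [X in _ = _ + X]big_ord_recl /= bin0 scale1r !subn0 scaler0 add0r.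
  by [].
rewrite E2 exprS mulN1r scaleNr.
set X := \sum_(p < b.+1) _; set Y := J (bdel F w); set Z := _ *: J (K _).
set A := proj N _; set A' := u ^+ N *: _.
rewrite [X in _ + X]addrAC [X in _ + X]addrC -!addrA.
have -> : Y + (A + (X + Z)) = A + (X + (Y + Z)) by rewrite [LHS]addrCA; congr (_ + _); rewrite addrCA.
rewrite -[RHS]addr0; congr (_ + _); rewrite -(addNr (A + (X + (Y + Z)))).
by rewrite !opprD -!addrA.
Qed.

End BarHomotopy.

(** * Differentials over an arbitrary ring *)

Section ContractionExpansion.
Variables (T : comNzRingType) (m : nat) (N : lmodType T).

Lemma contrE phi (g : {set 'I_m} -> N) J : contr phi g J =
  \sum_a phi a *: (if a \in J then 0 else (-1) ^+ inv_sign a J *: g (a |: J)).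
Proof. by rewrite /contr fct_sumE. Qed.

Lemma emulE sigma (g : {set 'I_m} -> N) J : emul sigma g J =
  \sum_a sigma a *: (if a \in J then (-1) ^+ inv_sign a J *: g (J :\ a) else 0).
Proof. by rewrite /emul fct_sumE. Qed.

End ContractionExpansion.

Section ContractionMap.
Variables (T : comNzRingType) (m : nat) (N N' : lmodType T).

Lemma contr_map (f : {linear N -> N'}) phi (g : {set 'I_m} -> N) J :
  @contr T m N' phi (fun I => f (g I)) J = f (contr phi g J).
Proof.
rewrite contrE [in RHS]contrE (linear_sum f); apply: eq_bigr => a _; rewrite (linearZ_LR f) /=.
by case: ifP => _; rewrite ?linear0 // (linearZ_LR f).
Qed.

Lemma emul_map (f : {linear N -> N'}) phi (g : {set 'I_m} -> N) J :
  @emul T m N' phi (fun I => f (g I)) J = f (emul phi g J).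
Proof.
rewrite emulE [in RHS]emulE (linear_sum f); apply: eq_bigr => a _; rewrite (linearZ_LR f) /=.
by case: ifP => _; rewrite ?linear0 // (linearZ_LR f).
Qed.

Lemma contr_comb (I : Type) (r : seq I) (c : I -> T) (phi : I -> 'I_m -> T)
    (g : {set 'I_m} -> N) :
  \sum_(i <- r) c i *: contr (phi i) g = contr (fun a => \sum_(i <- r) c i * phi i a) g.
Proof.
rewrite /contr; under eq_bigr do rewrite scaler_sumr.
rewrite exchange_big; apply: eq_bigr => a _ /=.
by rewrite scaler_suml; apply: eq_bigr => i _; rewrite scalerA.
Qed.

Lemma contr0 phi (g : {set 'I_m} -> N) : (forall a, phi a = 0) -> contr phi g = 0.
Proof. by move=> p0; rewrite /contr big1 // => a _; rewrite p0 scale0r. Qed.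

End ContractionMap.

Section Complex.
Variables (T : comNzRingType) (m n : nat).
Local Notation D := ('X_{1..n} -> T^o).
Local Notation M := ({set 'I_m} -> D).

(* An element of wedge K (x) D (x) S, where D is a divided power algebra, is given by its
   coefficients [g J b] on the bases of wedge K and D indexed by sets and multi-indices. *)
Definition lift (O : D -> D) (g : M) : M := fun J => O (g J).

Fact lift_is_linear (O : {linear D -> D}) : linear (lift O).
Proof. by move=> c g h; apply/funext => J; rewrite /lift !fctE linearP. Qed.
HB.instance Definition _ (O : {linear D -> D}) :=
  GRing.isLinear.Build T M M *:%R (lift O) (lift_is_linear O).

Lemma contr_lift (O : {linear D -> D}) phi g : contr phi (lift O g) = lift O (contr phi g).
Proof. by apply/funext => J; rewrite /lift contr_map. Qed.

Lemma emul_lift (O : {linear D -> D}) phi g : emul phi (lift O g) = lift O (emul phi g).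
Proof. by apply/funext => J; rewrite /lift emul_map. Qed.

Lemma lift0 (O : {linear D -> D}) : lift O (0 : M) = 0.
Proof. exact: linear0. Qed.

Lemma liftZ (O : {linear D -> D}) c (g : M) : lift O (c *: g) = c *: lift O g.
Proof. exact: linearZ. Qed.

Lemma lift_sum (O : {linear D -> D}) (I : Type) (r : seq I) (P : pred I) (F : I -> M) :
  lift O (\sum_(i <- r | P i) F i) = \sum_(i <- r | P i) lift O (F i).
Proof. exact: linear_sum. Qed.

Lemma contr_zero phi : contr phi (0 : M) = 0.
Proof. exact: linear0. Qed.

Lemma contrZ phi c (g : M) : contr phi (c *: g) = c *: contr phi g.
Proof. exact: linearZ. Qed.

Lemma contr_sum phi (I : Type) (r : seq I) (P : pred I) (F : I -> M) :
  contr phi (\sum_(i <- r | P i) F i) = \sum_(i <- r | P i) contr phi (F i).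
Proof. exact: linear_sum. Qed.

Lemma emul_zero phi : emul phi (0 : M) = 0.
Proof. exact: linear0. Qed.

Lemma emul_sum phi (I : Type) (r : seq I) (P : pred I) (F : I -> M) :
  emul phi (\sum_(i <- r | P i) F i) = \sum_(i <- r | P i) emul phi (F i).
Proof. exact: linear_sum. Qed.

Lemma emulZ phi c (g : M) : emul phi (c *: g) = c *: emul phi g.
Proof. exact: linearZ. Qed.

Lemma emulB phi (g h : M) : emul phi (g - h) = emul phi g - emul phi h.
Proof. exact: linearB. Qed.

Variables (x : 'I_n -> T) (Phi : 'I_n -> 'I_m -> T).

Definition ell a : M -> M := lift (ldiv x (enum 'I_n) a).
HB.instance Definition _ a := GRing.Linear.on (ell a).

Lemma ell0 a : ell a (0 : M) = 0.
Proof. exact: linear0. Qed.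

(** The Buchsbaum-Rim differential wedge^(n + s) K (x) D^s -> wedge^(n + s - 1) K (x) D^(s - 1). It
    squares to zero because contractions anticommute while the [der j] commute. *)
Definition koz (g : M) : M := \sum_j contr (Phi j) (lift (der j) g).

Fact koz_is_linear : linear koz.
Proof.
move=> c g h; rewrite /koz scaler_sumr -big_split; apply: eq_bigr => j _ /=.
by rewrite !linearP.
Qed.
HB.instance Definition _ := GRing.isLinear.Build T M M *:%R koz koz_is_linear.

Hypothesis xPhi : forall a, \sum_j x j * Phi j a = 0.

Lemma dps_ell : dps (fun a => ell a : {linear M -> M}).
Proof.
split=> [g|a b g]; apply/funext => J; rewrite /= /ell /lift; first exact: ldiv0.
by rewrite ldivD.
Qed.

Lemma koz_sqr g : koz (koz g) = 0.
Proof.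
rewrite /koz; under eq_bigr => j _.
  rewrite (linear_sum (lift (der j))) (linear_sum (contr (Phi j))) /=.
  under eq_bigr => k _ do rewrite -contr_lift.
  over.
rewrite /=.
have E j : \sum_k contr (Phi j) (contr (Phi k) (lift (der j) (lift (der k) g))) =
    \sum_(k : 'I_n | (k < j)%N) contr (Phi j) (contr (Phi k) (lift (der j) (lift (der k) g)))
  + \sum_(k : 'I_n | (j < k)%N) contr (Phi j) (contr (Phi k) (lift (der j) (lift (der k) g))).
  rewrite (bigD1 j) //= contr_sqr add0r (bigID (fun k : 'I_n => (k < j)%N)) /=.
  by congr (_ + _); apply: eq_bigl => k; rewrite -val_eqE; case: ltngtP.
under eq_bigr do rewrite E.
rewrite big_split /= [X in _ + X](exchange_big_dep predT) //= -big_split.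
apply: big1 => j _ /=; rewrite -big_split; apply: big1 => k _ /=.
rewrite contrC addrC.
have -> : lift (der j) (lift (der k) g) = lift (der k) (lift (der j) g).
  by apply/funext => J; rewrite /lift derC.
by rewrite addrN.
Qed.

Lemma lder_ell l a g :
  lift (der l) (ell a.+1 g) = ell a.+1 (lift (der l) g) + x l *: ell a g.
Proof.
apply/funext => J; rewrite !fctE /ell /lift der_ldiv ?enum_uniq // mem_enum.
by rewrite mul1r.
Qed.

(** The commutator of [koz] with l^(a) is a contraction by [\sum_j x j * Phi j], which is zero: the
    columns of [Phi] lie in the kernel of [delta1]. *)
Lemma koz_ell a g : koz (ell a g) = ell a (koz g).
Proof.
have [L0 _] := dps_ell; case: a => [|a].
  by rewrite -[ell 0 g]/(((fun a => ell a : {linear M -> M}) 0%N) g) L0 [RHS]L0.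
rewrite /koz; under eq_bigr do rewrite lder_ell linearD /= (linearZ_LR (contr (Phi _))) /=.
rewrite big_split /= contr_comb contr0 // addr0 (linear_sum (ell a.+1)).
by apply: eq_bigr => j _; rewrite /= contr_lift.
Qed.

Lemma lder_koz l g : lift (der l) (koz g) = koz (lift (der l) g).
Proof.
rewrite /koz (linear_sum (lift (der l))); apply: eq_bigr => j _ /=.
rewrite -contr_lift; congr contr; by apply/funext => J; rewrite /lift derC.
Qed.

(** Letters up to [m] suffice: a nonzero component of the complex has s <= m - n, and the sum of the
    word is at most s. *)
Definition barX (F : seq nat -> M) : seq nat -> M :=
  bar (fun a => ell a : {linear M -> M}) koz m.+1 F.

Definition emb (g : M) : seq nat -> M := fun w => if w is [::] then g else 0.

Lemma barX_emb g : barX (emb g) = emb (koz g).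
Proof.
apply/funext => w; rewrite /barX /bar big1 ?add0r => [|a _]; last exact: linear0.
rewrite (_ : bdel _ _ = 0) ?add0r; last first.
  by case: w => [|a w] //=; rewrite bdel0 big1 ?oppr0 ?subr0 ?addr0 // => p _; rewrite scaler0.
by case: w => [|a w] /=; rewrite ?expr0 ?scale1r // linear0 scaler0.
Qed.

Definition ctrs (js : seq 'I_n) (g : M) : M := foldr (fun j => contr (Phi j)) g js.

Fact ctrs_is_linear js : linear (ctrs js).
Proof. by move=> c g h; elim: js => //= j js ->; rewrite linearP. Qed.
HB.instance Definition _ js := GRing.isLinear.Build T M M *:%R (ctrs js) (ctrs_is_linear js).

Definition zeroed (js : seq 'I_n) (g : D) : D :=
  fun b => if all (fun j => b j == 0%N) js then g b else 0.

Fact zeroed_is_linear js : linear (zeroed js).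
Proof.
move=> c g h; apply/funext => b; rewrite /zeroed !fctE; case: ifP => // _.
by rewrite scaler0 addr0.
Qed.
HB.instance Definition _ js := GRing.isLinear.Build T D D *:%R (zeroed js) (zeroed_is_linear js).

Lemma ctrs_anti js phi g :
  ctrs js (contr phi g) = (-1) ^+ size js *: contr phi (ctrs js g).
Proof.
elim: js => [|j js IH] /=; first by rewrite expr0 scale1r.
by rewrite IH (linearZ_LR (contr (Phi j))) /= contrC exprS mulN1r scaleNr scalerN.
Qed.

Lemma ctrs_emul js sigma g :
  (forall j, j \in js -> \sum_a Phi j a * sigma a = 0) ->
  ctrs js (emul sigma g) = (-1) ^+ size js *: emul sigma (ctrs js g).
Proof.
elim: js => [|j js IH] js0 /=; first by rewrite expr0 scale1r.
rewrite IH => [|i ijs]; last by rewrite js0 // inE ijs orbT.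
rewrite (linearZ_LR (contr (Phi j))) /= exprS mulN1r scaleNr -scalerN; congr (_ *: _).
apply/eqP; rewrite -addr_eq0 contr_emul js0 ?scale0r // inE eqxx //.
Qed.

Lemma sum_contr_raise_der g : koz g = 0 -> forall j, \sum_(k | k != j)
  contr (Phi k) (lift (raise j) (lift (der k) g))
  = contr (Phi j) (lift (zeroed [:: j]) g) - contr (Phi j) g.
Proof.
move=> g0 j; have : lift (raise j) (koz g) = 0 by rewrite g0 linear0.
rewrite /koz (linear_sum (lift (raise j))) (bigD1 j) //=.
under eq_bigr do rewrite -contr_lift.
move/eqP; rewrite addrC addr_eq0 => /eqP ->.
rewrite -contr_lift -(linearN (contr (Phi j))) -(linearB (contr (Phi j))) /=.
congr contr; apply/funext => J; apply/funext => b.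
rewrite !fctE /lift raise_der /zeroed /= andbT.
by case: eqP => _; rewrite ?subrr ?oppr0 ?sub0r.
Qed.

Variables (l : 'I_n) (sigma : 'I_n -> 'I_m -> T) (v : T).
Hypothesis PhiSigma : forall j k, j != l -> k != l ->
  \sum_a Phi k a * sigma j a = (k == j)%:R * v.

(** By [koz_step], one round with [j] makes [v *: g] a boundary up to an error supported on
    exponents with [b j = 0]. The recursion applies the same to this error. After all of [js] the
    obstruction is the part of [g] free of these variables, contracted by all [Phi j]. *)
Fixpoint koz_prim (js : seq 'I_n) (g : M) : M :=
  if js is j :: js' then
    v ^+ size js' *: emul (sigma j) (lift (raise j) g)
    + koz_prim js' (emul (sigma j) (contr (Phi j) (lift (zeroed [:: j]) g)))
  else 0.

Lemma koz_step j g : j != l -> lift (der l) g = 0 -> koz g = 0 ->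
  koz (emul (sigma j) (lift (raise j) g))
  = v *: g - emul (sigma j) (contr (Phi j) (lift (zeroed [:: j]) g)).
Proof.
move=> jl gl g0; rewrite {1}/koz (bigD1 j) //=.
have E k h : contr (Phi k) (emul (sigma j) h) =
    (\sum_a Phi k a * sigma j a) *: h - emul (sigma j) (contr (Phi k) h).
  by rewrite -contr_emul addrK.
rewrite -emul_lift E PhiSigma // eqxx mul1r.
have -> : lift (der j) (lift (raise j) g) = g.
  by apply/funext => J; rewrite /lift der_raisej.
have -> : \sum_(k | k != j) contr (Phi k) (lift (der k) (emul (sigma j) (lift (raise j) g)))
  = - emul (sigma j) (\sum_(k | k != j) contr (Phi k) (lift (raise j) (lift (der k) g))).
  rewrite emul_sum -sumrN; apply: eq_bigr => k kj.
  have -> : lift (raise j) (lift (der k) g) = lift (der k) (lift (raise j) g).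
    by apply/funext => J; rewrite /lift der_raise // eq_sym.
  rewrite -emul_lift E; have [kl|kl] := eqVneq k l.
    have -> : lift (der k) (lift (raise j) g) = lift (raise j) (lift (der k) g).
      by apply/funext => J; rewrite /lift der_raise // eq_sym.
    by rewrite kl gl !linear0 addr0.
  by rewrite (PhiSigma jl kl) (negbTE kj) mul0r scale0r sub0r.
by rewrite (sum_contr_raise_der g0) emulB opprB addrA subrK.
Qed.

Lemma koz_primP js g : uniq js -> l \notin js ->
    lift (der l) g = 0 -> koz g = 0 -> ctrs js (lift (zeroed js) g) = 0 ->
  koz (koz_prim js g) = v ^+ size js *: g.
Proof.
elim: js g => [|j js IH] g /=.
  move=> _ _ _ _; rewrite (_ : lift _ g = g) => [->|]; first by rewrite linear0 scaler0.
  by apply/funext.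
case/andP=> jjs ujs; rewrite inE negb_or => /andP[lj ljs] gl g0 gz.
have jl : j != l by rewrite eq_sym.
set g1 := emul _ (contr _ _).
have E := koz_step jl gl g0; rewrite -/g1 in E.
rewrite linearD /= (linearZ_LR koz) /= IH //.
- by rewrite E scalerBr subrK scalerA exprSr.
- rewrite /g1 -emul_lift -contr_lift.
  have -> : lift (der l) (lift (zeroed [:: j]) g) = lift (zeroed [:: j]) (lift (der l) g).
    apply/funext => J; apply/funext => b; rewrite /lift /der /zeroed /= !andbT.
    by rewrite mnmDE mnm1E (negbTE lj) addn0.
  by rewrite gl !linear0.
- have -> : g1 = v *: g - koz (emul (sigma j) (lift (raise j) g)).
    by rewrite E opprB addrCA subrr addr0.
  by rewrite linearB /= (linearZ_LR koz) /= g0 koz_sqr scaler0 subr0.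
- rewrite /g1 -emul_lift -contr_lift.
  have -> : lift (zeroed js) (lift (zeroed [:: j]) g) = lift (zeroed (j :: js)) g.
    apply/funext => J; apply/funext => b; rewrite /lift /zeroed /= andbT.
    by case: (b j == 0%N); case: (all _ js).
  rewrite ctrs_emul => [|i ijs]; last first.
    have ij : i != j by apply: contraNneq jjs => <-.
    rewrite PhiSigma // ?(negbTE ij) ?mul0r //.
    by apply: contraNneq ljs => <-.
  by rewrite ctrs_anti [contr _ _]gz !linear0.
Qed.

(* A cycle of [barX] times a power of [x l] is the boundary of [barX_prim]. *)
Definition barX_prim (N : nat) js (F : seq nat -> M) : seq nat -> M :=
  v ^+ size js *: bar_prim (fun a => ell a : {linear M -> M}) (lift (der l)) (x l) N F
  + emb (koz_prim js (proj (fun a => ell a : {linear M -> M}) (lift (der l)) (x l) N (F [::]))).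

Lemma barX_primP js (F : seq nat -> M) : uniq js -> l \notin js ->
    (forall w, 0%N \in w -> F w = 0) ->
    (forall w k, (m < k + sumn w)%N -> iter k (lift (der l)) (F w) = 0) ->
    barX F = 0 ->
    ctrs js (lift (zeroed js)
      (proj (fun a => ell a : {linear M -> M}) (lift (der l)) (x l) m (F [::]))) = 0 ->
  barX (barX_prim m js F) = (v ^+ size js * x l ^+ m) *: F.
Proof.
move=> ujs ljs F0 Fnil dF.
set p := proj _ _ _ _ => Fz.
have KL a g : koz ((fun a => ell a : {linear M -> M}) a g)
    = (fun a => ell a : {linear M -> M}) a (koz g) by exact: koz_ell.
have dL a g : lift (der l) ((fun a => ell a : {linear M -> M}) a.+1 g)
   = (fun a => ell a : {linear M -> M}) a.+1 (lift (der l) g)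
     + x l *: (fun a => ell a : {linear M -> M}) a g by exact: lder_ell.
have Fn v0 : (m < sumn v0)%N -> F v0 = 0 by exact: (Fnil v0 0%N).
have pker : lift (der l) (p (F [::])) = 0.
  by apply: (proj_ker dps_ell dL); apply: Fnil; rewrite addn0.
(* At the empty word the cycle condition says that [koz (F [::])] is a sum of images of l^(a) with a
   > 0, all of which [proj] kills. *)
have pkoz : koz (p (F [::])) = 0.
  rewrite -(proj_K _ KL (lder_koz l)).
  have : barX F [::] = 0 by rewrite dF.
  rewrite /barX /bar /= addr0 expr0 scale1r => /eqP.
  rewrite addrC addr_eq0 => /eqP ->; rewrite linearN (linear_sum p) big1 ?oppr0 //.
  case=> [[|a] am] _ /=; first by rewrite F0 ?inE // !linear0.
  by apply: (proj_L dps_ell dL) => k mk; apply: Fnil; rewrite /= addn0.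
rewrite /barX_prim -/p; apply/funext => w; rewrite /barX bar_linear_comb.
have := bar_homotopy dps_ell KL (lder_koz l) dL (ltnSn m) w F0 Fnil.
rewrite -/(barX F) dF => E.
have sh0 : bar_prim (fun a => ell a : {linear M -> M}) (lift (der l)) (x l) m 0 w = 0.
  by case: w {E} => [|b w] //=; case: ifP => // _; rewrite !linear0.
rewrite sh0 addr0 in E; rewrite E -/p -/(barX _) barX_emb koz_primP //.
rewrite -[RHS]/((v ^+ size js * x l ^+ m) *: F w) scalerBr -scalerA; case: w {E sh0} => [|b w] /=.
  by rewrite subrK.
by rewrite scaler0 subr0 addr0.
Qed.

End Complex.

(** * Degrees and reduction modulo variables *)

Section KillVariables.
Variables (k : fieldType) (n : nat).
Local Notation S := {mpoly k[n]}.
Implicit Types (f g : S) (l : nat).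

Definition evl l : S -> S :=
  comp_mpoly [tuple (if (i < l)%N then 0 else 'X_i : S) | i < n].
HB.instance Definition _ l := GRing.RMorphism.copy (evl l)
  (comp_mpoly [tuple (if (i < l)%N then 0 else 'X_i : S) | i < n]).

Definition mfree l (m : 'X_{1..n}) := [forall i : 'I_n, (i < l)%N ==> (m i == 0%N)].

Lemma evlXm l m : evl l 'X_[m] = if mfree l m then 'X_[m] else 0.
Proof.
rewrite /evl comp_mpolyX; case: ifP => [/forallP mf|].
  rewrite mpolyXE_id; apply: eq_bigr => i _; rewrite tnth_mktuple.
  by case: ifP => // il; have /implyP/(_ il)/eqP-> := mf i; rewrite !expr0.
move/negbT; rewrite negb_forall => /existsP[i]; rewrite negb_imply => /andP[il mi].
by rewrite (bigD1 i) //= tnth_mktuple il expr0n (negbTE mi) mul0r.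
Qed.

Lemma mcoeff_evl l f m : (evl l f)@_m = if mfree l m then f@_m else 0.
Proof.
rewrite {1}[f]mpolyE rmorph_sum /= raddf_sum /= [in RHS](mpolyE f) raddf_sum /=.
have E c : (evl l (f@_c *: 'X_[c]))@_m = if mfree l m then (f@_c *: 'X_[c])@_m else 0.
  rewrite -mul_mpolyC rmorphM /= {1}/evl comp_mpolyC evlXm !mcoeffCM.
  case: (eqVneq c m) => [->|cm]; first by case: ifP => // _; rewrite mcoeff0 mulr0.
  by case: ifP => _; rewrite ?mcoeff0 !mcoeffX (negbTE cm) mulr0; case: ifP.
under eq_bigr do rewrite E.
by case: ifP => // _; rewrite big1.
Qed.

Lemma evlX l (i : 'I_n) : evl l 'X_i = if (i < l)%N then 0 else 'X_i.
Proof. by rewrite /evl comp_mpolyXU -tnth_nth tnth_mktuple. Qed.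

Lemma mfreeS l l' m : (l <= l')%N -> mfree l' m -> mfree l m.
Proof.
move=> ll /forallP h; apply/forallP => i; apply/implyP => il.
exact: (implyP (h i)) (leq_trans il ll).
Qed.

Lemma evl_evl l l' f : (l <= l')%N -> evl l' (evl l f) = evl l' f.
Proof.
move=> ll; apply/mpolyP => m; rewrite !mcoeff_evl; case: ifP => // h.
by rewrite (mfreeS ll h).
Qed.

Lemma evl_id l l' f : (l <= l')%N -> evl l' f = f -> evl l f = f.
Proof.
move=> ll <-; apply/mpolyP => m; rewrite !mcoeff_evl; case: ifP => // h.
by case: ifP => // h'; rewrite (mfreeS ll h') in h.
Qed.

Lemma evl0 f : evl 0 f = f.
Proof.
apply/mpolyP => m; rewrite mcoeff_evl ifT //.
by apply/forallP.
Qed.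

Lemma mpolyX_neq0 (i : 'I_n) : ('X_i : S) != 0.
Proof. by rewrite -msupp_eq0 msuppX. Qed.

Lemma evl_div (l : 'I_n) f : evl l f = f -> evl l.+1 f = 0 ->
  exists2 h, f = 'X_l * h & evl l h = h.
Proof.
move=> fl f0.
have E : f = 'X_l * (\sum_(m <- msupp f) f@_m *: 'X_[m - U_(l)]).
  rewrite {1}[f]mpolyE mulr_sumr; apply: eq_big_seq => m.
  rewrite mcoeff_msupp => fm; rewrite -scalerAr -mpolyXD addmC submK //.
  rewrite lep1mP; apply: contra_neq fm => ml; move: fl => /mpolyP/(_ m).
  rewrite mcoeff_evl; case: ifP => // mfl _.
  move: f0 => /mpolyP/(_ m); rewrite mcoeff_evl mcoeff0 ifT //.
  apply/forallP => i; apply/implyP; rewrite ltnS leq_eqVlt => /orP[/eqP/val_inj->|il].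
    by rewrite ml.
  exact: (implyP (forallP mfl i)).
exists (\sum_(m <- msupp f) f@_m *: 'X_[m - U_(l)]) => //.
apply: (mulfI (mpolyX_neq0 l)); rewrite -E; move: fl; rewrite {1}E rmorphM /= evlX.
by rewrite ltnn.
Qed.

End KillVariables.

Section Degree.
Variables (k : fieldType) (n : nat).
Local Notation S := {mpoly k[n]}.
Implicit Types (f g : S) (d e : int).

(** Degrees are integers, so that twists need no side conditions and a negative degree forces
    [f = 0]. *)
Definition hd d f := forall c, f@_c != 0 -> (mdeg c)%:Z = d.

Lemma in_sym_degE d f : in_sym_deg d f <-> hd d f.
Proof.
split=> [|h]; last first.
  case: d h => e h /=.
    by apply/dhomogP => c; rewrite mcoeff_msupp => /h[].
  by apply/eqP; apply/mpolyP => c; rewrite mcoeff0; apply/eqP/negPn/negP => /h.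
case: d => e /=; last by move/eqP => -> c; rewrite mcoeff0 eqxx.
by move/dhomogP => h c; rewrite -mcoeff_msupp => /h <-.
Qed.

Lemma hd0 d : hd d 0.
Proof. by move=> c; rewrite mcoeff0 eqxx. Qed.

Lemma hd1 : hd 0 1.
Proof. by move=> c; rewrite mcoeff1; case: (eqVneq c 0%MM) => [->|]; rewrite ?mdeg0 ?eqxx. Qed.

Lemma hdD d f g : hd d f -> hd d g -> hd d (f + g).
Proof.
move=> fd gd c; rewrite mcoeffD; have [f0|/fd //] := eqVneq f@_c 0.
by rewrite f0 add0r => /gd.
Qed.

Lemma hd_sum d (I : Type) (r : seq I) (P : pred I) (F : I -> S) :
  (forall i, P i -> hd d (F i)) -> hd d (\sum_(i <- r | P i) F i).
Proof. by move=> h; elim/big_ind: _ => //; [exact: hd0|exact: hdD]. Qed.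

Lemma hdM d e f g : hd d f -> hd e g -> hd (d + e) (f * g).
Proof.
move=> fd ge c; rewrite -mcoeff_msupp => /msuppM_le/allpairsP[[a b] /= [fa gb ->]].
move: fa gb; rewrite !mcoeff_msupp => /fd <- /ge <-.
by rewrite mdegD PoszD.
Qed.

Lemma hdX i : hd 1 ('X_i : S).
Proof.
by move=> c; rewrite mcoeffX; case: (eqVneq _ c) => [<-|]; rewrite ?mdeg1 ?eqxx.
Qed.

Lemma hdXn d f a : hd d f -> hd (a%:Z * d) (f ^+ a).
Proof.
move=> fd; elim: a => [|a IH]; first by rewrite mul0r; exact: hd1.
by rewrite exprS intS mulrDl mul1r; exact: hdM.
Qed.

Lemma hd_sign d f b : hd d f -> hd d ((-1) ^+ b * f).
Proof.
by move=> fd c; rewrite -signr_odd mulr_sign; case: ifP => _; rewrite ?mcoeffN ?oppr_eq0; exact: fd.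
Qed.

Lemma hd_nat d f b : hd d f -> hd d (b%:R * f).
Proof.
move=> fd; rewrite mulr_natl; elim: b => [|b IH]; first by rewrite mulr0n; exact: hd0.
by rewrite mulrS; apply: hdD.
Qed.

Lemma hd_evl d l f : hd d f -> hd d (evl l f).
Proof. by move=> fd c; rewrite mcoeff_evl; case: ifP => _; [exact: fd|rewrite eqxx]. Qed.

End Degree.

(** * Exterior degree, divided power degree and polynomial degree *)

Section Tridegree.
Variables (k : fieldType) (m n : nat).
Local Notation S := {mpoly k[n]}.
Local Notation D := ('X_{1..n} -> S^o).
Local Notation M := ({set 'I_m} -> D).
Implicit Types (p s d e : int).

Definition hD s d (g : D) := forall b (c : 'X_{1..n}), (g b : S)@_c != 0 ->
  (mdeg b)%:Z = s /\ (mdeg c)%:Z = d.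

Definition hM p s d (g : M) := forall J b (c : 'X_{1..n}), (g J b : S)@_c != 0 ->
  [/\ #|J|%:Z = p, (mdeg b)%:Z = s & (mdeg c)%:Z = d].

Lemma hD0 s d : hD s d 0.
Proof. by move=> b c; rewrite mcoeff0 eqxx. Qed.

Lemma hDD s d f g : hD s d f -> hD s d g -> hD s d (f + g).
Proof.
move=> fh gh b c; rewrite fctE mcoeffD.
by have [f0|/fh //] := eqVneq (f b : S)@_c 0; rewrite f0 add0r => /gh.
Qed.

Lemma hD_sum s d (I : Type) (r : seq I) (P : pred I) (F : I -> D) :
  (forall i, P i -> hD s d (F i)) -> hD s d (\sum_(i <- r | P i) F i).
Proof. by move=> h; elim/big_ind: _ => //; [exact: hD0|exact: hDD]. Qed.

Lemma hDZ s d e a g : hd e a -> hD s d g -> hD s (e + d) (a *: g).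
Proof.
move=> ah gh b c nz.
have bs : (mdeg b)%:Z = s.
  apply/eqP; apply: contraNT nz => bs.
  suff -> : (a *: g) b = 0 by rewrite mcoeff0.
  rewrite fctE (_ : g b = 0) ?scaler0 //; apply/mpolyP => c'; rewrite mcoeff0.
  by apply/eqP; apply: contraNT bs => /gh[-> _].
split=> //; apply: (hdM ah (g := g b)) nz => c' /gh[]; by [].
Qed.

Lemma hM0 p s d : hM p s d 0.
Proof. by move=> J b c; rewrite mcoeff0 eqxx. Qed.

Lemma hMD p s d f g : hM p s d f -> hM p s d g -> hM p s d (f + g).
Proof.
move=> fh gh J b c; rewrite fctE mcoeffD.
by have [f0|/fh //] := eqVneq (f J b : S)@_c 0; rewrite f0 add0r => /gh.
Qed.

Lemma hM_sum p s d (I : Type) (r : seq I) (P : pred I) (F : I -> M) :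
  (forall i, P i -> hM p s d (F i)) -> hM p s d (\sum_(i <- r | P i) F i).
Proof. by move=> h; elim/big_ind: _ => //; [exact: hM0|exact: hMD]. Qed.

Lemma hM_conv p s d p' s' d' g :
  p = p' -> s = s' -> d = d' -> hM p s d g -> hM p' s' d' g.
Proof. by move=> -> -> ->. Qed.

Lemma hM_hD p s d g (J : {set _}) : hM p s d g -> hD s d (g J).
Proof. by move=> gh b c /gh[]. Qed.

Lemma hM_card p s d g (J : {set _}) : hM p s d g -> #|J|%:Z != p -> g J = 0.
Proof.
move=> gh Jp; apply/funext => b; apply/mpolyP => c; rewrite mcoeff0; apply/eqP.
by apply: contraNT Jp => /gh[-> _ _].
Qed.

Lemma hM_lift (O : {linear D -> D}) p s d s' d' g :
  (forall h, hD s d h -> hD s' d' (O h)) -> hM p s d g -> hM p s' d' (lift O g).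
Proof.
move=> Oh gh J b c nz; have [Jp|Jp] := eqVneq #|J|%:Z p; last first.
  by move: nz; rewrite /lift (hM_card gh Jp) linear0 mcoeff0 eqxx.
by have [] := Oh _ (hM_hD gh) b c nz.
Qed.

Lemma hMZ p s d e a g : hd e a -> hM p s d g -> hM p s (e + d) (a *: g).
Proof.
move=> ah gh J b c nz; have [Jp|Jp] := eqVneq #|J|%:Z p; last first.
  by move: nz; rewrite fctE (hM_card gh Jp) scaler0 mcoeff0 eqxx.
by have [] := hDZ ah (hM_hD gh) nz.
Qed.

Lemma hMZ0 p s d a g : hd 0 a -> hM p s d g -> hM p s d (a *: g).
Proof. by move=> a0 gh; rewrite -[d]add0r; apply: hMZ. Qed.

Lemma hd_const (z : k) : hd 0 (z%:MP : S).
Proof.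
by move=> c; rewrite mcoeffC; case: (eqVneq c 0%MM) => [->|]; rewrite ?mdeg0 ?mulr0 ?eqxx.
Qed.

Lemma hd_signr a : hd 0 ((-1) ^+ a : S).
Proof. by rewrite -[_ ^+ _]mulr1; apply: hd_sign; exact: hd1. Qed.

Lemma hM_eq0 p s d g : hM p s d g -> [|| s < 0, d < 0 | (m%:Z < p)] -> g = 0.
Proof.
move=> gh neg; apply/funext => J; apply/funext => b; apply/mpolyP => c.
rewrite mcoeff0; apply/eqP/negPn/negP => /gh[Jp bs cd].
have Jm : (#|J| <= m)%N by rewrite -[X in (_ <= X)%N](card_ord m) max_card.
case/or3P: neg => neg; lia.
Qed.

Lemma hM_neg p s d g : hM p s d g -> p < 0 -> g = 0.
Proof.
move=> gh p0; apply/funext => J; apply: (hM_card gh); move: p0.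
by case: p gh.
Qed.

Lemma hM_contr1 p s d a g : hM p s d g -> hM (p - 1) s d (contr1 a g).
Proof.
move=> gh J b c; rewrite /contr1; case: ifP => [|/negbT aJ].
  by rewrite mcoeff0 eqxx.
move=> nz; have [|Jp bs cd] := gh (a |: J) b c.
  apply: contraNneq nz => z; rewrite fctE -signr_odd scaler_sign.
  by case: odd; rewrite ?mcoeffN ?z ?oppr0.
by split=> //; rewrite -Jp cardsU1 aJ PoszD addrAC subrr add0r.
Qed.

Lemma hM_emul1 p s d a g : hM p s d g -> hM (p + 1) s d (emul1 a g).
Proof.
move=> gh J b c; rewrite /emul1; case: ifP => [aJ|_]; last first.
  by rewrite mcoeff0 eqxx.
move=> nz; have [|Jp bs cd] := gh (J :\ a) b c.
  apply: contraNneq nz => z; rewrite fctE -signr_odd scaler_sign.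
  by case: odd; rewrite ?mcoeffN ?z ?oppr0.
by split=> //; rewrite -Jp (cardsD1 a J) aJ addrC.
Qed.

Lemma hM_contr p s d e phi g : (forall a, hd e (phi a)) -> hM p s d g ->
  hM (p - 1) s (e + d) (contr phi g).
Proof. by move=> ph gh; apply: hM_sum => a _; apply: hMZ => //; exact: hM_contr1. Qed.

Lemma hM_emul p s d e phi g : (forall a, hd e (phi a)) -> hM p s d g ->
  hM (p + 1) s (e + d) (emul phi g).
Proof. by move=> ph gh; apply: hM_sum => a _; apply: hMZ => //; exact: hM_emul1. Qed.

Lemma hM_der p s d j g : hM p s d g -> hM p (s - 1) d (lift (der j) g).
Proof.
apply: hM_lift => h hh b c /hh[]; rewrite mdegD mdeg1 => <- ->; split=> //; lia.
Qed.

Lemma hM_iter_der p s d j a g : hM p s d g -> hM p (s - a%:Z) d (iter a (lift (der j)) g).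
Proof.
move=> gh; elim: a => [|a IH]; first by rewrite subr0.
have -> : s - a.+1%:Z = s - a%:Z - 1 by lia.
by rewrite iterS; exact: hM_der.
Qed.

Lemma hM_raise p s d j g : hM p s d g -> hM p (s + 1) d (lift (raise j) g).
Proof.
apply: hM_lift => h hh b c; rewrite /= /raise; case: ifP => [bj|_]; last first.
  by rewrite mcoeff0 eqxx.
case/hh=> <- ->; split=> //.
rewrite -{1}(@submK _ U_(j)%MM b); last by rewrite lep1mP -lt0n.
by rewrite mdegD mdeg1; lia.
Qed.

Lemma hM_zeroed p s d js g : hM p s d g -> hM p s d (lift (zeroed js) g).
Proof.
apply: hM_lift => h hh b c; rewrite /= /zeroed; case: ifP => _; first by move/hh.
by rewrite mcoeff0 eqxx.
Qed.

Lemma hD_mulE s d j a h : hD s d h -> hD (s + a%:Z) d (mulE j a h).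
Proof.
move=> hh b c; rewrite /mulE; have [ba|ab] := ltnP (b j) a.
  by rewrite bin_small // mul0r mcoeff0 eqxx.
move=> nz; have [|bs cd] := hh (b - U_(j) *+ a)%MM c.
  by apply: contraNneq nz => z; rewrite mulr_natl mcoeffMn z mul0rn.
split=> //; rewrite -bs -{1}(@submK _ (U_(j) *+ a)%MM b).
  by rewrite mdegD mdegMn mdeg1; lia.
apply/mnm_lepP => i; rewrite mulmnE mnm1E; case: (eqVneq j i) => [<-|] //; lia.
Qed.

Variables (x : 'I_n -> S).
Hypothesis xh : forall j, hd 1 (x j).

Lemma hD_ldiv s d js a h : hD s d h -> hD (s + a%:Z) (d + a%:Z) (ldiv x js a h).
Proof.
elim: js a => [|j js IH] a hh /=.
  by case: eqP => [->|_]; rewrite ?addr0 //; exact: hD0.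
apply: hD_sum => b _; have ba : (b <= a)%N by rewrite -ltnS.
have -> : s + a%:Z = s + (a - b)%N%:Z + b%:Z by lia.
have -> : d + a%:Z = b%:Z * 1 + (d + (a - b)%N%:Z) by lia.
by apply: hDZ; [exact: hdXn|apply: hD_mulE; exact: IH].
Qed.

Lemma hM_ell p s d a g : hM p s d g -> hM p (s + a%:Z) (d + a%:Z) (ell x a g).
Proof. by apply: hM_lift => h; exact: hD_ldiv. Qed.

Lemma hM_koz Phi p s d g : (forall j a, hd 1 (Phi j a)) -> hM p s d g ->
  hM (p - 1) (s - 1) (d + 1) (koz Phi g).
Proof.
move=> Ph gh; apply: hM_sum => j _; rewrite [d + 1]addrC.
by apply: hM_contr => //; exact: hM_der.
Qed.

Lemma hM_proj u l N p s d g : hd 1 u -> hM p s d g ->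
  hM p s (d + N%:Z)
   (proj (fun a => ell x a : {linear M -> M}) (lift (der l)) u N g).
Proof.
move=> uh gh; apply: hM_sum => a _; have aN : (a <= N)%N by rewrite -ltnS.
have -> : s = s - a%:Z + a%:Z by lia.
have -> : d + N%:Z = (0 + (N - a)%N%:Z * 1) + (d + a%:Z) by lia.
apply: hMZ; first by apply: hdM; [exact: hd_signr|exact: hdXn].
by apply: hM_ell; exact: hM_iter_der.
Qed.

End Tridegree.

(** * Operators on the exterior factor and maximal minors *)

Section LiftCompatible.
Variables (T : comNzRingType) (m n : nat).
Local Notation D := ('X_{1..n} -> T^o).
Local Notation M := ({set 'I_m} -> D).

Definition basisM I : M := fun J b => ((J == I) && (b == 0%MM))%:R.

(** Operators acting on the exterior factor only. They are determined by their values on the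
    [basisM I], so an identity between them is an identity of matrix entries, to which the
    substitution [evl] can be applied. *)
Definition commutes_lift (O : M -> M) :=
  forall (f : {linear D -> D}) g, O (lift f g) = lift f (O g).

Definition evalD (h : D) (g : D) : D := g 0%MM *: h.
Fact evalD_is_linear h : linear (evalD h).
Proof.
move=> c f g; apply/funext => b; rewrite /evalD !fctE /GRing.scale /=; ring.
Qed.
HB.instance Definition _ h := GRing.isLinear.Build T D D *:%R (evalD h) (evalD_is_linear h).

Lemma basis_expansion g : g = \sum_I lift (evalD (g I)) (basisM I).
Proof.
apply/funext => J; rewrite fct_sumE (bigD1 J) //= big1 ?addr0 => [|I IJ].
  by rewrite /lift /evalD /basisM !eqxx scale1r.
by rewrite /lift /evalD /basisM eq_sym (negbTE IJ) scale0r.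
Qed.

Lemma eq_on_basis (O P : {linear M -> M}) : commutes_lift O -> commutes_lift P ->
  (forall I, O (basisM I) = P (basisM I)) -> O =1 P.
Proof.
move=> Ol Pl OP g.
have E (Q : {linear M -> M}) : Q g = \sum_I Q (lift (evalD (g I)) (basisM I)).
  by rewrite {1}[g]basis_expansion; exact: linear_sum.
by rewrite !E; apply: eq_bigr => I _; rewrite Ol Pl OP.
Qed.

Lemma ctrs_commutes Phi js : commutes_lift (@ctrs T m n Phi js).
Proof. by move=> f g; elim: js => //= j js ->; rewrite contr_lift. Qed.

Definition Delta (dl : {set 'I_m} -> {set 'I_m} -> T) (g : M) : M :=
  fun J => \sum_I dl J I *: g I.

Fact Delta_is_linear dl : linear (Delta dl).
Proof.
move=> c f g; apply/funext => J.
rewrite -[RHS]/(c *: Delta dl f J + Delta dl g J) /Delta scaler_sumr -big_split.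
apply: eq_bigr => I _ /=; rewrite -[(c *: f + g) I]/(c *: f I + g I).
by rewrite scalerDr !scalerA mulrC.
Qed.
HB.instance Definition _ dl := GRing.isLinear.Build T M M *:%R (Delta dl) (Delta_is_linear dl).

Lemma Delta_commutes dl : commutes_lift (Delta dl).
Proof.
move=> f g; apply/funext => J; rewrite /lift /Delta (linear_sum f).
by apply: eq_bigr => I _; rewrite (linearZ_LR f).
Qed.

Lemma DeltaZ c dl g : Delta (fun J I => c * dl J I) g = c *: Delta dl g.
Proof.
apply/funext => J; rewrite -[RHS]/(c *: Delta dl g J) /Delta scaler_sumr.
by apply: eq_bigr => I _; rewrite scalerA.
Qed.

Lemma Delta_basis dl I J b : Delta dl (basisM I) J b = (b == 0%MM)%:R * dl J I.
Proof.
rewrite /Delta fct_sumE (bigD1 I) //= big1 ?addr0 => [|I' II'].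
  by rewrite /basisM !fctE eqxx /= mulrC.
by rewrite /basisM !fctE (negbTE II') /= scaler0.
Qed.

Variable Phi : 'I_n -> 'I_m -> T.

Lemma ctrs_dup js j g : j \in js -> ctrs Phi js (contr (Phi j) g) = 0.
Proof.
elim: js => //= i js IH; rewrite inE => /orP[/eqP<-|/IH->]; last exact: linear0.
by rewrite ctrs_anti (linearZ_LR (contr _)) /= contr_sqr scaler0.
Qed.

Lemma contr_ctrs_dup js j g : j \in js -> contr (Phi j) (ctrs Phi js g) = 0.
Proof.
move=> jjs; have := ctrs_dup g jjs; rewrite ctrs_anti -signr_odd scaler_sign.
by case: ifP => // _ /eqP; rewrite oppr_eq0 => /eqP.
Qed.

Lemma ctrs_rem js l : l \in js -> exists b : nat, forall g : M,
  ctrs Phi js g = (-1) ^+ b *: contr (Phi l) (ctrs Phi (rem l js) g).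
Proof.
elim: js => //= i js IH; rewrite inE eq_sym; case: eqP => [-> _|_ /= /IH[b Hb]].
  by exists 0%N => g; rewrite expr0 scale1r.
exists b.+1 => g; rewrite Hb (linearZ_LR (contr _)) /= contrC.
by rewrite exprS mulN1r scaleNr scalerN.
Qed.

Variable x : 'I_n -> T.
Hypothesis xPhi : forall a, \sum_j x j * Phi j a = 0.

Lemma sum_x_contr (g : M) : \sum_j x j *: contr (Phi j) g = 0.
Proof. by rewrite contr_comb contr0. Qed.

(** Replace [x o *: contr (Phi o)] by minus the sum of the other [x j *: contr (Phi j)]: each [j]
    other than [l] already occurs among the remaining contractions and gives zero. *)
Lemma ctrs_swap js o l : uniq js -> (forall j, (j \in js) = (j != o)) -> l != o ->
  exists b : nat, forall g : M,
    x o *: ctrs Phi (o :: rem l js) g = (-1) ^+ b *: (x l *: ctrs Phi js g).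
Proof.
move=> ujs jsE lo; have ljs : l \in js by rewrite jsE.
have [b Hb] := ctrs_rem ljs; exists b.+1 => g /=.
have /eqP := sum_x_contr (ctrs Phi (rem l js) g).
rewrite (bigD1 o) //= (bigD1 l) //= big1 ?addr0 => [|j /andP[jo jl]]; last first.
  by rewrite contr_ctrs_dup ?scaler0 // mem_rem_uniq // inE jl jsE.
rewrite addr_eq0 => /eqP->; rewrite Hb !scalerA exprS mulN1r !mulNr mulrAC.
by rewrite -expr2 sqrr_sign mul1r scaleNr.
Qed.

End LiftCompatible.

(** * Compatibility with ring endomorphisms *)

Section Naturality.
Variables (T : comNzRingType) (f : {rmorphism T -> T}) (m n : nat).
Local Notation D := ('X_{1..n} -> T^o).
Local Notation M := ({set 'I_m} -> D).
Variables (x : 'I_n -> T) (Phi : 'I_n -> 'I_m -> T).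

Definition mapM (g : M) : M := fun J b => f (g J b).

Fact mapM_is_zmod_morphism : zmod_morphism mapM.
Proof.
by move=> g h; apply/funext => J; apply/funext => b; rewrite /mapM !fctE rmorphB.
Qed.
HB.instance Definition _ := GRing.isZmodMorphism.Build M M mapM mapM_is_zmod_morphism.

Lemma mapMZ c (g : M) : mapM (c *: g) = f c *: mapM g.
Proof.
by apply/funext => J; apply/funext => b; rewrite /mapM !fctE /GRing.scale /= rmorphM.
Qed.

Lemma mapM_contr phi (g : M) : mapM (contr phi g) = contr (f \o phi) (mapM g).
Proof.
rewrite /contr raddf_sum; apply: eq_bigr => a _ /=; rewrite mapMZ; congr (_ *: _).
apply/funext => J; apply/funext => b; rewrite /mapM /contr1; case: ifP => _.
  by rewrite rmorph0.
by rewrite !fctE /GRing.scale /= rmorphM rmorph_sign.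
Qed.

Lemma mapM_raise j (g : M) : mapM (lift (raise j) g) = lift (raise j) (mapM g).
Proof.
apply/funext => J; apply/funext => b; rewrite /mapM /lift /raise.
by case: ifP => // _; rewrite rmorph0.
Qed.

Lemma mapM_ctrs js (g : M) : mapM (ctrs Phi js g) = ctrs (fun j => f \o Phi j) js (mapM g).
Proof. by elim: js => //= j js IH; rewrite mapM_contr IH. Qed.

Lemma mapM_Delta dl (g : M) :
  mapM (Delta dl g) = Delta (fun J I => f (dl J I)) (mapM g).
Proof.
apply/funext => J; apply/funext => b; rewrite /mapM /Delta !fct_sumE rmorph_sum.
by apply: eq_bigr => I _; rewrite !fctE /GRing.scale /= rmorphM.
Qed.

Lemma mapM_basis (I : {set 'I_m}) : mapM (@basisM T m n I) = @basisM T m n I.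
Proof. by apply/funext => J; apply/funext => b; rewrite /mapM /basisM rmorph_nat. Qed.

Lemma ldiv_natural js a (h : D) b :
  f (ldiv x js a h b) = ldiv (f \o x) js a (fun c => f (h c)) b.
Proof.
elim: js a b => [|j js IH] a b /=; first by case: ifP => // _; rewrite rmorph0.
rewrite !fct_sumE rmorph_sum; apply: eq_bigr => c _.
by rewrite !fctE /GRing.scale /= rmorphM rmorphXn /mulE rmorphM rmorph_nat IH.
Qed.

Lemma mapM_ell a (g : M) : mapM (ell x a g) = ell (f \o x) a (mapM g).
Proof.
by apply/funext => J; apply/funext => b; rewrite /mapM /ell /lift ldiv_natural.
Qed.

Lemma mapM_koz (g : M) : mapM (koz Phi g) = koz (fun j => f \o Phi j) (mapM g).
Proof. by rewrite /koz raddf_sum; apply: eq_bigr => j _ /=; rewrite mapM_contr. Qed.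

Lemma mapM_bdel (F : seq nat -> M) w : mapM (bdel F w) = bdel (fun v => mapM (F v)) w.
Proof.
elim: w F => [|a w IH] F /=; first by rewrite raddf0.
rewrite raddfB raddfN raddf_sum /= IH; congr (- _ - _); apply: eq_bigr => p _.
by rewrite mapMZ rmorph_nat.
Qed.

Lemma mapM_barX (F : seq nat -> M) w : mapM (barX x Phi F w)
  = barX (f \o x) (fun j => f \o Phi j) (fun v => mapM (F v)) w.
Proof.
rewrite /barX /bar !raddfD raddf_sum /= mapM_bdel mapMZ rmorph_sign mapM_koz.
by congr (_ + _ + _); apply: eq_bigr => a _; rewrite mapM_ell.
Qed.

End Naturality.
Arguments mapM {T} f {m n} g J b.

Section ExistsDelta.
Variables (k : fieldType) (m n : nat).
Local Notation S := {mpoly k[n]}.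
Variable Phi : 'I_n -> 'I_m -> S.

(* The maximal minors of [Phi] omitting row [l] are, up to sign, ['X_l] times those of the
   induced map to the kernel of [delta1]. *)
Definition minors_divided (dl : {set 'I_m} -> {set 'I_m} -> S) := forall l : 'I_n,
  exists js (b : nat), [/\ uniq js, forall j, (j \in js) = (j != l), size js = n.-1 &
    forall g : {set 'I_m} -> 'X_{1..n} -> S^o,
      ctrs Phi js g = (-1) ^+ b *: ('X_l *: Delta dl g)].

(* Where ['X_l] is invertible, the columns of [Phi] generate the kernel of [delta1]. *)
Definition generically_onto := forall l : 'I_n, exists (N : nat) (sigma : 'I_n -> 'I_m -> S),
  (forall j a, hd N%:Z (sigma j a)) /\ forall i j, j != l -> \sum_a Phi i a * sigma j a
    = 'X_l ^+ N * ((i == j)%:R * 'X_l - (i == l)%:R * 'X_j).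

Hypothesis XPhi : forall a, \sum_j 'X_j * Phi j a = 0.
Hypothesis n_gt1 : (1 < n)%N.

(** By [ctrs_swap], x_0 times a minor omitting row 1 is, up to sign, x_1 times the minor omitting
    row 0. Setting x_0 = 0 shows that the latter is divisible by x_0, and the quotients define [dl].
    For another row [l], the same exchange gives the claim after cancelling x_0. *)
Lemma exists_Delta : exists dl, minors_divided dl.
Proof.
pose o : 'I_n := Ordinal (ltnW n_gt1); pose l1 : 'I_n := Ordinal n_gt1.
pose jo := rem o (enum 'I_n).
have ujo : uniq jo by rewrite rem_uniq // enum_uniq.
have joE j : (j \in jo) = (j != o) by rewrite mem_rem_uniq ?enum_uniq // inE mem_enum andbT.
have sjo : size jo = n.-1 by rewrite size_rem ?mem_enum // size_enum_ord.
pose A J I : S := ctrs Phi jo (@basisM S m n I) J 0%MM.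
have [dl dlE] : {dl : {set 'I_m} * {set 'I_m} -> S &
    forall JI, A JI.1 JI.2 = 'X_o * dl JI}.
  apply: (@boolp.choice _ _ (fun JI h => A JI.1 JI.2 = 'X_o * h)) => -[J I] /=.
  have [b Hb] := ctrs_swap XPhi ujo joE (isT : l1 != o).
  have : evl 1 (A J I) = 0.
    have := congr1 (fun g : {set 'I_m} -> 'X_{1..n} -> S^o => evl 1 (g J 0%MM)) (Hb (@basisM S m n I)).
    rewrite !fctE /GRing.scale /= !rmorphM /= !evlX /= mul0r rmorph_sign => /esym/eqP.
    by rewrite mulf_eq0 signr_eq0 /= mulf_eq0 (negbTE (mpolyX_neq0 _ _)) => /eqP.
  by case/(@evl_div _ _ o); rewrite ?evl0 // => h -> _; exists h.
pose dl' J I := dl (J, I); exists dl'.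
have E g : ctrs Phi jo g = 'X_o *: Delta dl' g.
  rewrite -DeltaZ; apply: eq_on_basis (ctrs_commutes _ _) (Delta_commutes _) _ g => I.
  apply/funext => J; apply/funext => b /=; rewrite Delta_basis mulrC.
  rewrite -[X in _ = X * _](dlE (J, I)) /A /=.
  pose dirac : 'X_{1..n} -> S^o := fun b => (b == 0%MM)%:R.
  have {1}-> : @basisM S m n I = lift (evalD dirac) (@basisM S m n I).
    apply/funext => J'; apply/funext => b'; rewrite /lift /evalD /basisM /dirac.
    by rewrite !fctE /GRing.scale /= eqxx andbT -natrM mulnb.
  by rewrite ctrs_commutes.
move=> l; have [->|lo] := eqVneq l o.
  by exists jo, 0%N; split=> // g; rewrite E expr0 scale1r.
have ljo : l \in jo by rewrite joE.
have [b Hb] := ctrs_swap XPhi ujo joE lo.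
exists (o :: rem l jo), b; split.
- by rewrite /= rem_uniq // andbT; apply/negP => /mem_rem; rewrite joE eqxx.
- move=> j; rewrite inE mem_rem_uniq // inE joE; case: (eqVneq j o) => [->|jo'] /=.
    by rewrite eq_sym.
  by rewrite andbT.
- by rewrite /= size_rem // sjo prednK //; lia.
move=> g; apply/funext => J; apply/funext => c; apply: (mulfI (mpolyX_neq0 _ o)).
have := congr1 (fun g : {set 'I_m} -> 'X_{1..n} -> S^o => g J c) (Hb g).
rewrite E !fctE /GRing.scale /= => ->; ring.
Qed.

End ExistsDelta.

(** * The three maps at the start of the complex *)

Section LowDegrees.
Variables (T : comNzRingType) (m n : nat).
Local Notation D := ('X_{1..n} -> T^o).
Local Notation M := ({set 'I_m} -> D).
Local Notation U := (seq nat -> M).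
Variables (x : 'I_n -> T) (Phi : 'I_n -> 'I_m -> T) (dl : {set 'I_m} -> {set 'I_m} -> T).
Hypothesis xPhi : forall a, \sum_j x j * Phi j a = 0.

(** In position 1, V is stored in the divided degree 1 part of [D], with the i-th basis vector at
    the exponent [U_(i)]. So [der j] reads the j-th coordinate of a vector, and [raise j] applied to
    a constant puts it there. *)
Definition del1 (g : M) : M := \sum_j x j *: lift (der j) g.
Definition del2 (g : M) : M := \sum_j contr (Phi j) (lift (raise j) g).

Lemma DeltaZr c (g : M) : Delta dl (c *: g) = c *: Delta dl g.
Proof. exact: linearZ. Qed.

Lemma Delta_sum (I : Type) (r : seq I) (P : pred I) (F : I -> M) :
  Delta dl (\sum_(i <- r | P i) F i) = \sum_(i <- r | P i) Delta dl (F i).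
Proof. exact: linear_sum. Qed.

Lemma ctrs0 js : ctrs Phi js (0 : M) = 0.
Proof. exact: linear0. Qed.

Lemma contr_commutes phi : @commutes_lift T m n (contr phi).
Proof. by move=> f g; rewrite contr_lift. Qed.

Lemma contr_Delta_basis phi : (forall I, contr phi (Delta dl (@basisM T m n I)) = 0) ->
  forall g : M, contr phi (Delta dl g) = 0.
Proof.
move=> H g; rewrite [g]basis_expansion Delta_sum contr_sum big1 // => I _.
by rewrite (Delta_commutes dl) (contr_commutes phi) H lift0.
Qed.

Lemma Delta_contr_basis phi : (forall I, Delta dl (contr phi (@basisM T m n I)) = 0) ->
  forall g : M, Delta dl (contr phi g) = 0.
Proof.
move=> H g; rewrite [g]basis_expansion contr_sum Delta_sum big1 // => I _.
by rewrite (contr_commutes phi) (Delta_commutes dl) H lift0.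
Qed.

Lemma del2_Delta : (forall j (g : M), contr (Phi j) (Delta dl g) = 0) ->
  forall g : M, del2 (Delta dl g) = 0.
Proof.
by move=> H g; rewrite /del2 big1 // => j _; rewrite contr_lift H lift0.
Qed.

Lemma Delta_koz : (forall j (g : M), Delta dl (contr (Phi j) g) = 0) ->
  forall g : M, Delta dl (koz Phi g) = 0.
Proof. by move=> H g; rewrite /koz Delta_sum big1. Qed.

Lemma barX_nil (F : U) : (forall a, F [:: a] = 0) -> barX x Phi F [::] = koz Phi (F [::]).
Proof.
move=> F0; rewrite /barX /bar /= addr0 expr0 scale1r big1 ?add0r // => a _.
by rewrite F0 ell0.
Qed.

Lemma emb0 : emb (0 : M) = 0 :> U.
Proof. by apply/funext => -[]. Qed.

Lemma ctrs_proj0 js c (g : M) l u N : (forall h : M, ctrs Phi js h = c *: Delta dl h) ->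
    Delta dl g = 0 ->
  ctrs Phi js (lift (zeroed js)
    (proj (fun a => ell x a : {linear M -> M}) (lift (der l)) u N g)) = 0.
Proof.
move=> DE D0; set p := proj _ _ _ _.
have LC a h : ctrs Phi js ((fun a => ell x a : {linear M -> M}) a h)
    = (fun a => ell x a : {linear M -> M}) a (ctrs Phi js h).
  exact: ctrs_commutes.
have CD h : lift (der l) (ctrs Phi js h) = ctrs Phi js (lift (der l) h).
  by rewrite ctrs_commutes.
have cE : ctrs Phi js (p g) = p (ctrs Phi js g) by exact/esym/(proj_K _ LC CD).
rewrite ctrs_commutes cE DE D0 scaler0 /p.
rewrite (_ : proj _ _ _ _ 0 = 0); [exact: lift0|exact: linear0].
Qed.

Variables (sigma : 'I_n -> 'I_m -> T) (l : 'I_n).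

Lemma ctrs_emuls v js (z : M) :
  (forall i j, i != l -> j != l -> \sum_a Phi i a * sigma j a = (i == j)%:R * v) ->
  uniq js -> l \notin js -> (forall j, contr (Phi j) z = 0) ->
  exists b : nat, ctrs Phi js (foldr (fun j => emul (sigma j)) z js)
    = (-1) ^+ b *: (v ^+ size js *: z).
Proof.
move=> PS + + z0; elim: js => [|j js IH] /=; first by exists 0%N; rewrite !scale1r.
case/andP=> jjs /IH{}IH; rewrite inE negb_or eq_sym => /andP[jl /[dup] ljs /IH[b E]].
exists (b + size js)%N; rewrite ctrs_emul => [|i ijs]; last first.
  rewrite PS // ?(memPn ljs) //.
  by rewrite (negbTE (memPn jjs _ ijs)) mul0r.
rewrite contrZ E.
have -> : contr (Phi j) (emul (sigma j) ((-1) ^+ b *: (v ^+ size js *: z)))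
   = (-1) ^+ b *: (v ^+ (size js).+1 *: z).
  rewrite !emulZ !contrZ.
  have := contr_emul (Phi j) (sigma j) z; rewrite z0 emul_zero addr0 => ->.
  by rewrite PS // eqxx mul1r !scalerA -mulrA -exprSr.
by rewrite scalerA -exprD addnC.
Qed.

Lemma der_del2 (z : M) j : (forall j, lift (der j) z = 0) ->
  lift (der j) (del2 z) = contr (Phi j) z.
Proof.
move=> zd; rewrite /del2 lift_sum (bigD1 j) //= big1 ?addr0.
  rewrite -contr_lift (_ : lift (der j) _ = z) //.
  by apply/funext => J; rewrite /lift der_raisej.
move=> i ij; rewrite -contr_lift.
rewrite (_ : lift (der j) _ = lift (raise i) (lift (der j) z)).
  by rewrite zd lift0 contr_zero.
by apply/funext => J; rewrite /lift der_raise.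
Qed.

Lemma del2_contr0 (z : M) : (forall j, lift (der j) z = 0) -> del2 z = 0 ->
  forall j, contr (Phi j) z = 0.
Proof. by move=> zd dz j; rewrite -der_del2 // dz lift0. Qed.

Lemma del1_del2 (z : M) : (forall j, lift (der j) z = 0) -> del1 (del2 z) = 0.
Proof.
move=> zd; rewrite /del1; under eq_bigr => j _ do rewrite der_del2 //.
exact: sum_x_contr.
Qed.

Lemma del1_linear_comb c (f g : M) : del1 (c *: f + g) = c *: del1 f + del1 g.
Proof.
rewrite /del1 scaler_sumr -big_split; apply: eq_bigr => j _ /=.
have -> : lift (der j) (c *: f + g) = c *: lift (der j) f + lift (der j) g.
  exact: linearP.
by rewrite scalerDr !scalerA mulrC.
Qed.

Lemma del2_linear_comb c (f g : M) : del2 (c *: f + g) = c *: del2 f + del2 g.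
Proof.
rewrite /del2 scaler_sumr -big_split; apply: eq_bigr => j _ /=.
have -> : lift (raise j) (c *: f + g) = c *: lift (raise j) f + lift (raise j) g.
  exact: linearP.
exact: linearP.
Qed.

Lemma Delta_linear_comb c (f g : M) : Delta dl (c *: f + g) = c *: Delta dl f + Delta dl g.
Proof. exact: linearP. Qed.

Lemma emb_linear_comb c (f g : M) : emb (c *: f + g) = c *: emb f + emb g :> U.
Proof. by apply/funext => -[|a w] //; rewrite -[RHS]/(c *: (0 : M) + 0) scaler0 addr0. Qed.

Lemma barX_linear_comb c (F G : U) : barX x Phi (c *: F + G) = c *: barX x Phi F + barX x Phi G.
Proof. by apply/funext => w; exact: bar_linear_comb. Qed.

(* Up to a power of [x l], a primitive of the cycle [f], by Euler's formula. *)
Definition del2_prim (f : M) : M := \sum_(j | j != l) emul (sigma j) (lift (der j) f).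

Lemma del2_primP c (f : M) :
  (forall i j, j != l -> \sum_a Phi i a * sigma j a
    = c * ((i == j)%:R * x l - (i == l)%:R * x j)) ->
  (forall i j, contr (Phi i) (lift (raise i) (lift (der j) f)) = 0) ->
  \sum_j lift (raise j) (lift (der j) f) = f -> del1 f = 0 ->
  del2 (del2_prim f) = (c * x l) *: f.
Proof.
move=> PS p0 euler df; rewrite /del2 /del2_prim.
under eq_bigr => i _.
  rewrite lift_sum contr_sum.
  under eq_bigr => j jl.
    rewrite -emul_lift -[contr _ _]addr0 -(emul_zero n (sigma j)) -(p0 i j).
    rewrite contr_emul PS //; over.
  over.
rewrite exchange_big /=.
under eq_bigr => j jl.
  have -> : \sum_(i < n) (c * ((i == j)%:R * x l - (i == l)%:R * x j))
       *: lift (raise i) (lift (der j) f)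
     = c *: (x l *: lift (raise j) (lift (der j) f) - lift (raise l) (x j *: lift (der j) f)).
    rewrite (bigD1 j) //= (bigD1 l) 1?eq_sym //= big1 => [|i /andP[ij il]]; last first.
      by rewrite (negbTE ij) (negbTE il) !mul0r subrr mulr0 scale0r.
    rewrite !eqxx [l == j]eq_sym (negbTE jl) !mul0r !mul1r subr0 sub0r addr0 liftZ.
    by rewrite scalerBr !scalerA mulrN scaleNr.
  over.
rewrite -scaler_sumr sumrB -scaler_sumr -lift_sum -scalerA; congr (_ *: _).
move: euler df; rewrite /del1 (bigD1 l) //= => /(canRL (addKr _)) ->.
rewrite (bigD1 l) //= => /(canRL (addKr _)) ->.
rewrite addr0 -scaleNr liftZ scaleNr opprK scalerDr scalerN addrAC.
by rewrite addNr add0r.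
Qed.

End LowDegrees.

(** * The complex *)

Lemma bdel_eq0 (T : comNzRingType) (V : lmodType T) (F : seq nat -> V) w :
  (forall v, 0%N \in v -> F v = 0) -> 0%N \in w -> bdel F w = 0.
Proof.
elim: w F => //= a w IH F F0; rewrite inE => /orP[/eqP<-|w0].
  rewrite big_ord1 /= F0 ?inE // scaler0 oppr0 sub0r (_ : (fun v => _) = fun=> 0).
    by rewrite bdel0 oppr0.
  by apply/funext => v; rewrite F0 ?inE.
rewrite IH // => [|v v0]; last by rewrite F0 // inE v0 orbT.
rewrite subr0 big1 ?oppr0 // => p _; rewrite F0 ?scaler0 // !inE w0.
by rewrite !orbT.
Qed.

Section KoszulResolution.
Variables (k : fieldType) (m n : nat).
Local Notation S := {mpoly k[n]}.
Local Notation D := ('X_{1..n} -> S^o).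
Local Notation M := ({set 'I_m} -> D).
Local Notation U := (seq nat -> M).
Variables (Phi : 'I_n -> 'I_m -> S) (dl : {set 'I_m} -> {set 'I_m} -> S).
Hypothesis PhiH : forall j a, hd 1 (Phi j a).
Hypothesis XPhi : forall a, \sum_j 'X_j * Phi j a = 0.

Definition xs l (j : 'I_n) : S := evl l 'X_j.
Definition Phis l (j : 'I_n) (a : 'I_m) : S := evl l (Phi j a).
Definition dls l J I : S := evl l (dl J I).

(* The complex: position 0 is S(2), position 1 is V (x) S(1), position 2 is K (x) S and
   position 3 + rho is the sum over s + size w = rho of
   wedge^(n + s) K (x) [w] (x) D^(s - sumn w)(V dual) (x) S(- (n - 2) - s - sumn w);
   in stage [l] the variables of index < [l] are set to 0. *)
Definition dX l (r : nat) (F : U) : U :=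
  match r with
  | 0 => emb (del1 (xs l) (F [::]))
  | 1 => emb (del2 (Phis l) (F [::]))
  | 2 => emb (Delta (dls l) (F [::]))
  | _ => barX (xs l) (Phis l) F
  end%N.

(** The first clause normalizes the bar construction. In the second, s = rho - size w. The shift n -
    2 is the degree of [Delta], whose entries are minors of size n - 1 divided by a variable. *)
Definition grb (rho e : int) (F : U) := forall w : seq nat,
  (0%N \in w -> F w = 0) /\
  hM (n%:Z + (rho - (size w)%:Z)) (rho - (size w)%:Z - (sumn w)%:Z)
     (e - (n%:Z - 2) - (rho - (size w)%:Z) - (sumn w)%:Z) (F w).

Definition gr (r : nat) (e : int) (F : U) : Prop :=
  match r with
  | 0 => F = emb (F [::]) /\ hM 0 0 (e + 2) (F [::])
  | 1 => F = emb (F [::]) /\ hM 0 1 (e + 1) (F [::])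
  | 2 => F = emb (F [::]) /\ hM 1 0 e (F [::])
  | rho.+3 => grb rho e F
  end%N.

Definition evM l : M -> M := mapM (evl l).
Definition evU l (F : U) : U := fun w => evM l (F w).

Lemma xsE l j : xs l j = if (j < l)%N then 0 else 'X_j.
Proof. exact: evlX. Qed.

Lemma xs_hd l j : hd 1 (xs l j).
Proof. by rewrite xsE; case: ifP => _; [exact: hd0|exact: hdX]. Qed.

Lemma Phis_hd l j a : hd 1 (Phis l j a).
Proof. exact: hd_evl. Qed.

Lemma xsPhis l a : \sum_j xs l j * Phis l j a = 0.
Proof.
transitivity (evl l (\sum_j 'X_j * Phi j a)); last by rewrite XPhi rmorph0.
rewrite rmorph_sum.
by apply: eq_bigr => j _; rewrite /= rmorphM.
Qed.

Lemma evM_emb l g : evU l (emb g) = emb (evM l g).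
Proof. by apply/funext => -[|a w] //=; rewrite /evU /= /evM raddf0. Qed.

Lemma evU_dX l l' r F : (l <= l')%N -> evU l' (dX l r F) = dX l' r (evU l' F).
Proof.
move=> ll.
have xE : evl l' \o xs l = xs l' by apply/funext => j; rewrite /= evl_evl.
have PE j : evl l' \o Phis l j = Phis l' j by apply/funext => a; rewrite /= evl_evl.
have PE' : (fun j => evl l' \o Phis l j) = Phis l' by apply/funext => j; exact: PE.
case: r => [|[|[|r]]] /=.
- rewrite evM_emb; congr emb; rewrite /evM /del1 raddf_sum; apply: eq_bigr => j _ /=.
  by rewrite mapMZ -xE.
- rewrite evM_emb; congr emb; rewrite /evM /del2 raddf_sum; apply: eq_bigr => j _ /=.
  by rewrite mapM_contr PE mapM_raise.
- rewrite evM_emb; congr emb; rewrite /evM mapM_Delta; congr Delta.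
  by apply/funext => J; apply/funext => I; rewrite /= /dls evl_evl.
- by apply/funext => w; rewrite /evU /evM mapM_barX xE PE'.
Qed.

Lemma hM_evM l p s d g : hM p s d g -> hM p s d (evM l g).
Proof.
move=> gh J b c; rewrite /evM /mapM mcoeff_evl; case: ifP => _; first exact: gh.
by rewrite eqxx.
Qed.

Lemma gr_evU l r e F : gr r e F -> gr r e (evU l F).
Proof.
have E : F = emb (F [::]) -> evU l F = emb (evU l F [::]).
  by move=> ->; rewrite evM_emb.
case: r => [|[|[|r]]] /=; try by [case=> /E E' h; split=> //; exact: hM_evM].
move=> h w; have [h0 h1] := h w; split; last exact: hM_evM.
by move=> /h0; rewrite /evU => ->; rewrite /evM raddf0.
Qed.

Lemma embD g h : emb (g + h) = emb g + emb h :> U.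
Proof. by apply/funext => -[|a w] //=; rewrite fctE addr0. Qed.

Lemma embN g : emb (- g) = - emb g :> U.
Proof. by apply/funext => -[|a w] //=; rewrite fctE oppr0. Qed.

Lemma gr_sub r e F G : gr r e F -> gr r e G -> gr r e (F - G).
Proof.
have hN p s d (g : M) : hM p s d g -> hM p s d (- g).
  by move=> gh; rewrite -scaleN1r; apply: hMZ0 => //; exact: (@hd_signr k n 1).
have E : F = emb (F [::]) -> G = emb (G [::]) -> F - G = emb ((F - G) [::]).
  by move=> {1}-> {1}->; rewrite -embN -embD.
case: r => [|[|[|r]]] /=;
  try by [case=> FE Fh [GE Gh]; split; [exact: E|apply: hMD => //; exact: hN]].
move=> Fh Gh w; have [F0 F1] := Fh w; have [G0 G1] := Gh w; split=> [w0|].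
  by rewrite fctE F0 // fctE G0 // subrr.
by apply: hMD => //; exact: hN.
Qed.

Lemma hM_divX (l : 'I_n) p s d (g : M) : hM p s d ('X_l *: g) -> hM p s (d - 1) g.
Proof.
move=> gh J b c nz; have [] := gh J b (U_(l) + c)%MM.
  by rewrite !fctE /GRing.scale /= mulrC mcoeffMX.
by move=> -> -> <-; split=> //; rewrite mdegD mdeg1 PoszD addrAC subrr add0r.
Qed.

Lemma scaleX_inj (l : 'I_n) (g h : M) : 'X_l *: g = 'X_l *: h -> g = h.
Proof.
move=> E; apply/funext => J; apply/funext => b; apply: (mulfI (mpolyX_neq0 k l)).
exact: (congr1 (fun g : M => g J b) E).
Qed.

Lemma gr_divX (l : 'I_n) r e F : gr r e ('X_l *: F) -> gr r (e - 1) F.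
Proof.
have E : 'X_l *: F = emb (('X_l *: F) [::]) -> F = emb (F [::]).
  move=> H; apply/funext => -[|a w] //=; apply: (@scaleX_inj l).
  by rewrite -[LHS]/(('X_l *: F) (a :: w)) H scaler0.
case: r => [|[|[|r]]] /=.
- by case=> /E E' /hM_divX h; split=> //; rewrite (_ : e - 1 + 2 = e + 2 - 1) //; ring.
- by case=> /E E' /hM_divX h; split=> //; rewrite (_ : e - 1 + 1 = e + 1 - 1) //; ring.
- by case=> /E E' /hM_divX h.
move=> h w; have [h0 /hM_divX h1] := h w; split=> [/h0 H|].
  by apply: (@scaleX_inj l); rewrite scaler0 -H.
rewrite (_ : e - 1 - (n%:Z - 2) - (r%:Z - (size w)%:Z) - (sumn w)%:Z =
   e - (n%:Z - 2) - (r%:Z - (size w)%:Z) - (sumn w)%:Z - 1) //; ring.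
Qed.

Lemma evU_divX (l : 'I_n) (F : U) : evU l F = F -> evU l.+1 F = 0 ->
  exists2 G : U, F = 'X_l *: G & evU l G = G.
Proof.
move=> Fl F0.
have H (i : seq nat * {set 'I_m} * 'X_{1..n}) : exists h : S,
    (F i.1.1 i.1.2 i.2 : S) = 'X_l * h /\ evl l h = h.
  have [|| h ? ?] := @evl_div k n l (F i.1.1 i.1.2 i.2); last by exists h.
    exact: (congr1 (fun F : U => F i.1.1 i.1.2 i.2) Fl).
  exact: (congr1 (fun F : U => F i.1.1 i.1.2 i.2) F0).
have [G GE] := boolp.choice H; exists (fun w J b => G (w, J, b)).
  apply/funext => w; apply/funext => J; apply/funext => b.
  by rewrite !fctE (GE (w, J, b)).1.
apply/funext => w; apply/funext => J; apply/funext => b.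
exact: (GE (w, J, b)).2.
Qed.

Lemma hM_bdel p s d (F : U) w :
  (forall v, size v = (size w).+1 -> sumn v = sumn w -> hM p s d (F v)) ->
  hM p s d (bdel F w).
Proof.
have hN (g : M) : hM p s d g -> hM p s d (- g).
  by move=> gh; rewrite -scaleN1r; apply: hMZ0 => //; exact: (@hd_signr k n 1).
elim: w F => [|a w IH] F Fh /=; first exact: hM0.
apply: hMD; apply: hN; last by apply: IH => v /= sv tv; apply: Fh => /=; rewrite ?sv ?tv.
apply: hM_sum => i _; apply: hMZ0.
  by rewrite -[_%:R]mulr1; apply: hd_nat; exact: hd1.
by apply: Fh => //=; rewrite addnA subnKC // -ltnS.
Qed.

Lemma grb_barX l rho e F : grb rho e F -> grb (rho - 1) e (barX (xs l) (Phis l) F).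
Proof.
move=> Fh w; split=> [w0|].
  have F0 v : 0%N \in v -> F v = 0 by case: (Fh v).
  rewrite /barX /bar big1 ?add0r => [|a _]; last by rewrite F0 ?linear0 // inE w0 orbT.
  by rewrite bdel_eq0 // F0 // linear0 scaler0 addr0.
apply: hMD; first apply: hMD.
- apply: hM_sum => a _; have [_ /=] := Fh (val a :: w).
  move/(hM_ell (a := val a) (@xs_hd l)).
  rewrite (_ : rho - 1 - (size w)%:Z = rho - (size w).+1%:Z); last by lia.
  rewrite (_ : rho - (size w).+1%:Z - (sumn w)%:Z =
    rho - (size w).+1%:Z - (a + sumn w)%N%:Z + a%:Z); last by lia.
  rewrite (_ : e - (n%:Z - 2) - (rho - (size w).+1%:Z) - (sumn w)%:Z =
    e - (n%:Z - 2) - (rho - (size w).+1%:Z) - (a + sumn w)%N%:Z + a%:Z) //; lia.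
- apply: hM_bdel => v sv tv; have [_] := Fh v; rewrite sv tv.
  by rewrite (_ : rho - 1 - (size w)%:Z = rho - (size w).+1%:Z) //; lia.
apply: hMZ0; first exact: hd_signr.
have [_ /(hM_koz (@Phis_hd l))] := Fh w.
rewrite (_ : n%:Z + (rho - (size w)%:Z) - 1 = n%:Z + (rho - 1 - (size w)%:Z)); last by ring.
rewrite (_ : rho - (size w)%:Z - (sumn w)%:Z - 1 =
  rho - 1 - (size w)%:Z - (sumn w)%:Z); last by ring.
by rewrite (_ : e - (n%:Z - 2) - (rho - (size w)%:Z) - (sumn w)%:Z + 1 =
  e - (n%:Z - 2) - (rho - 1 - (size w)%:Z) - (sumn w)%:Z); last by ring.
Qed.

Lemma grb_eq0 rho e F w : grb rho e F ->
  (rho < (size w)%:Z + (sumn w)%:Z) || (m%:Z < n%:Z + (rho - (size w)%:Z)) -> F w = 0.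
Proof.
move=> Fh h; have [_ /hM_eq0] := Fh w; apply; case/orP: h => h; apply/or3P.
  by constructor 1; rewrite -addrA -opprD subr_lt0.
by constructor 3.
Qed.

Lemma iter_der_eq0 rho e F w j a : grb rho e F -> (m < a + sumn w)%N ->
  iter a (lift (der j)) (F w) = 0.
Proof.
move=> Fh am; have [mn|mn] := boolP (m%:Z < n%:Z + (rho - (size w)%:Z)).
  by rewrite (grb_eq0 Fh) ?mn ?orbT // linear0.
have [_ /(hM_iter_der (j := j) (a := a))/hM_eq0] := Fh w; apply.
by apply/or3P; constructor 1; lia.
Qed.

End KoszulResolution.

(** * The differential modulo the first variables: degrees and square zero *)

Section StageDifferential.
Variables (k : fieldType) (m n : nat).
Local Notation S := {mpoly k[n]}.
Local Notation D := ('X_{1..n} -> S^o).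
Local Notation M := ({set 'I_m} -> D).
Local Notation U := (seq nat -> M).
Variables (Phi : 'I_n -> 'I_m -> S) (dl : {set 'I_m} -> {set 'I_m} -> S).
Hypothesis PhiH : forall j a, hd 1 (Phi j a).

Let x l : 'I_n -> S := @xs k n l.
Let Ph l := Phis Phi l.
Let De l := dls dl l.

Lemma hM_ctrs l p s d js (g : M) : hM p s d g ->
  hM (p - (size js)%:Z) s (d + (size js)%:Z) (ctrs (Ph l) js g).
Proof.
move=> gh; elim: js => [|j js IH] /=; first by rewrite subr0 addr0.
rewrite (_ : p - (size js).+1%:Z = p - (size js)%:Z - 1); last by lia.
rewrite (_ : d + (size js).+1%:Z = 1 + (d + (size js)%:Z)); last by lia.
by apply: hM_contr IH => a; exact: Phis_hd.
Qed.

Lemma lift_der_eq0 j p (d : int) (g : M) : hM p 0 d g -> lift (der j) g = 0.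
Proof. by move/(hM_der (j := j))/hM_eq0; apply. Qed.

Lemma hM_koz_prim (l : 'I_n) N sigma js p s d (g : M) :
  (forall j a, hd N%:Z (sigma j a)) -> hM p s d g ->
  hM (p + 1) (s + 1) (d + ((size js)%:Z * (N%:Z + 1) - 1))
    (koz_prim (Ph l) sigma ('X_l ^+ N.+1) js g).
Proof.
move=> sh; elim: js g d => [|j js IH] g d gh /=; first exact: hM0.
apply: hMD.
  rewrite (_ : d + _ = (size js)%:Z * (N.+1%:Z * 1) + (N%:Z + d)); last by lia.
  apply: hMZ; first by apply: hdXn; apply: hdXn; exact: hdX.
  by apply: hM_emul => //; exact: hM_raise.
rewrite (_ : d + _ = N%:Z + (1 + d) + ((size js)%:Z * (N%:Z + 1) - 1)); last by lia.
apply: IH; rewrite -[p](subrK 1); apply: hM_emul => //.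
by apply: hM_contr => [a|]; [exact: Phis_hd|exact: hM_zeroed].
Qed.

Lemma grb_bar_prim (l : 'I_n) rho e (F : U) : grb rho e F ->
  grb (rho + 1) (e + m%:Z)
    (bar_prim (fun a => ell (x l) a : {linear M -> M}) (lift (der l)) (x l l) m F).
Proof.
move=> Fh [|b w]; split=> //=; first exact: hM0.
  rewrite inE; case: (eqVneq b 0%N) => [_|] //= _ w0.
  by have [-> // _] := Fh w; rewrite !linear0.
case: eqP => b0; first exact: hM0.
have [_ /(hM_iter_der (j := l) (a := b)) H] := Fh w.
have [bm|mb] := leqP b m; last first.
  by rewrite (iter_der_eq0 _ Fh) ?linear0; [exact: hM0|lia].
have := hM_proj (l := l) (N := (m - b)%N) (@xs_hd _ _ l) (@xs_hd _ _ l l) H.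
by apply: hM_conv => /=; lia.
Qed.

Lemma xll (l : 'I_n) : x l l = 'X_l.
Proof. by rewrite /x xsE ltnn. Qed.

Lemma zeroed_eq0 (l : 'I_n) js p (s d : int) (g : M) : 0 < s ->
  (forall j, (j \in js) = (j != l)) -> hM p s d g -> lift (der l) g = 0 ->
  lift (zeroed js) g = 0.
Proof.
move=> s0 jsE gh gl; apply/funext => J; apply/funext => b; rewrite /lift /zeroed.
case: allP => // bjs; have [bl|bl] := posnP (b l).
  apply/mpolyP => c; rewrite mcoeff0; apply/eqP/negPn/negP => /gh[_ bs _].
  move: s0; rewrite -bs mdegE big1 // => j _; have [->|jl] := eqVneq j l => //.
  by apply/eqP/bjs; rewrite jsE.
have := congr1 (fun h : M => h J (b - U_(l))%MM) gl.
by rewrite /lift /der submK // lep1mP -lt0n.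
Qed.

Hypothesis XPhi : forall a, \sum_j 'X_j * Phi j a = 0.
Hypothesis n_gt1 : (1 < n)%N.
Hypothesis DeltaP : minors_divided Phi dl.

Lemma ex_other (j : 'I_n) : exists i : 'I_n, j != i.
Proof.
exists (if j == 0%N :> nat then Ordinal n_gt1 else Ordinal (ltnW n_gt1)).
by case: (eqVneq (j : nat) 0%N) => j0; rewrite -val_eqE /= ?j0.
Qed.

Lemma scale_signX_eq0 (i : 'I_n) b (g : M) : (-1) ^+ b *: ('X_i *: g) = 0 -> g = 0.
Proof.
move=> E; apply: (@scaleX_inj _ _ _ i); rewrite scaler0.
have /(congr1 (fun h => (-1) ^+ b *: h)) := E.
by rewrite scaler0 scalerA -expr2 sqrr_sign scale1r.
Qed.

(** Omit a row [i != j]: up to sign and the factor ['X_i], [Delta] is the contraction by all the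
    other rows, [Phi j] among them, and contracting twice by [Phi j] gives zero. *)
Lemma contr_Delta0 j (g : M) : contr (Phi j) (Delta dl g) = 0.
Proof.
have [i ji] := ex_other j; have [js [b [_ jsE _ E]]] := DeltaP i.
have jjs : j \in js by rewrite jsE.
have := contr_ctrs_dup Phi g jjs; rewrite E !(linearZ_LR (contr (Phi j))).
exact: scale_signX_eq0.
Qed.

Lemma Delta_contr0 j (g : M) : Delta dl (contr (Phi j) g) = 0.
Proof.
have [i ji] := ex_other j; have [js [b [_ jsE _ E]]] := DeltaP i.
have jjs : j \in js by rewrite jsE.
have := ctrs_dup Phi g jjs; rewrite E; exact: scale_signX_eq0.
Qed.

Lemma contr_Delta l j (g : M) : contr (Ph l j) (Delta (De l) g) = 0.
Proof.
apply: contr_Delta_basis => I.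
have := congr1 (mapM (evl l)) (contr_Delta0 j (@basisM S m n I)).
by rewrite raddf0 mapM_contr mapM_Delta mapM_basis.
Qed.

Lemma Delta_contr l j (g : M) : Delta (De l) (contr (Ph l j) g) = 0.
Proof.
apply: Delta_contr_basis => I.
have := congr1 (mapM (evl l)) (Delta_contr0 j (@basisM S m n I)).
by rewrite raddf0 mapM_Delta mapM_contr mapM_basis.
Qed.

Lemma stage_DeltaP (l : 'I_n) : exists js (b : nat),
  [/\ uniq js, forall j, (j \in js) = (j != l), size js = n.-1 &
    forall g : M, ctrs (Ph l) js g = (-1) ^+ b *: ('X_l *: Delta (De l) g)].
Proof.
have [js [b [ujs jsE sjs E]]] := DeltaP l; exists js, b; split=> // g.
rewrite -!DeltaZ; apply: eq_on_basis (ctrs_commutes _ _) (Delta_commutes _) _ g => I.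
rewrite /= !DeltaZ; have := congr1 (mapM (evl l)) (E (@basisM S m n I)).
by rewrite mapM_ctrs !mapMZ mapM_Delta mapM_basis rmorph_sign /= evlX ltnn.
Qed.

Lemma hM_Delta (l : 'I_n) p s d (g : M) : hM p s d g ->
  hM (p - (n%:Z - 1)) s (d + (n%:Z - 2)) (Delta (De l) g).
Proof.
have [js [b [_ _ sjs E]]] := stage_DeltaP l.
move/(hM_ctrs (l := l) (js := js)); rewrite E => /(hMZ0 (@hd_signr _ _ b)).
rewrite scalerA -expr2 sqrr_sign scale1r => /hM_divX.
rewrite sjs (_ : n.-1%:Z = n%:Z - 1); last by lia.
by rewrite (_ : d + (n%:Z - 1) - 1 = d + (n%:Z - 2)) //; ring.
Qed.

Lemma gr_dX (l : 'I_n) r e (F : U) : (0 < r)%N -> gr r.+1 e F -> gr r e (dX Phi dl l r F).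
Proof.
case: r => [|[|[|r]]] //= _; last first.
- move=> Fh; rewrite (_ : r%:Z = r.+1%:Z - 1); last by lia.
  exact: grb_barX.
- move=> Fh; split=> //; have [_ /(hM_Delta (l := l))] := Fh [::].
  by apply: hM_conv => /=; lia.
case=> _ Fh; split=> //; have H j := hM_contr (@Phis_hd k m n Phi PhiH l j) (hM_raise (j := j) Fh).
by apply: hM_sum => j _; apply: hM_conv (H j) => //; lia.
Qed.

Lemma dX_dX l r e (F : U) : gr r.+2 e F ->
  dX Phi dl l r (dX Phi dl l r.+1 F) = 0.
Proof.
case: r => [|[|[|r]]] //= Fh.
- have [_ Fh0] := Fh; rewrite del1_del2 ?emb0 // => [|j]; first exact: xsPhis.
  exact: lift_der_eq0 Fh0.
- by rewrite del2_Delta ?emb0 // => j g; exact: contr_Delta.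
- rewrite barX_nil => [|a]; first by rewrite Delta_koz ?emb0 // => j g; exact: Delta_contr.
  have [->|a0] := posnP a; first by have [F0 _] := Fh [:: 0%N]; rewrite F0 ?inE.
  by rewrite (grb_eq0 Fh) //=; lia.
apply/funext => w; apply: bar_sqr.
- exact: dps_ell.
- exact: koz_sqr.
- by apply: koz_ell; exact: xsPhis.
move=> a b ab; apply: (grb_eq0 Fh) => /=; lia.
Qed.

Hypothesis torsP : generically_onto Phi.

Lemma stage_torsP (l : 'I_n) : exists (N : nat) (sigma : 'I_n -> 'I_m -> S),
  (forall j a, hd N%:Z (sigma j a)) /\ forall i j, j != l -> \sum_a Ph l i a * sigma j a
    = 'X_l ^+ N * ((i == j)%:R * 'X_l - (i == l)%:R * x l j).
Proof.
have [N [sigma [sh sE]]] := torsP l; exists N, (fun j a => evl l (sigma j a)); split.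
  by move=> j a; apply: hd_evl.
move=> i j jl; have := congr1 (evl l) (sE i j jl).
rewrite rmorph_sum !rmorphM rmorphB !rmorphM !rmorph_nat rmorphXn /= evlX ltnn => <-.
by apply: eq_bigr => a _; rewrite rmorphM.
Qed.

End StageDifferential.

(** * Torsion of the homology *)

Section Torsion.
Variables (k : fieldType) (m n : nat).
Local Notation S := {mpoly k[n]}.
Local Notation D := ('X_{1..n} -> S^o).
Local Notation M := ({set 'I_m} -> D).
Local Notation U := (seq nat -> M).
Variables (Phi : 'I_n -> 'I_m -> S) (dl : {set 'I_m} -> {set 'I_m} -> S).
Hypothesis PhiH : forall j a, hd 1 (Phi j a).
Hypothesis XPhi : forall a, \sum_j 'X_j * Phi j a = 0.
Hypothesis n_gt1 : (1 < n)%N.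
Hypothesis DeltaP : minors_divided Phi dl.

Let x l : 'I_n -> S := @xs k n l.
Let Ph l := Phis Phi l.
Let De l := dls dl l.

Hypothesis torsP : generically_onto Phi.

Let stP := stage_torsP torsP.
Let sDP := stage_DeltaP DeltaP.

Lemma torsion_high (l : 'I_n) (rho : nat) e F : grb rho e F ->
  (rho = 0%N -> Delta (De l) (F [::]) = 0) ->
  ((0 < rho)%N -> barX (x l) (Ph l) F = 0) ->
  exists N G, grb (rho%:Z + 1) (e + N%:Z) G /\ barX (x l) (Ph l) G = 'X_l ^+ N *: F.
Proof.
move=> Fh D0 B0; have [N0 [sigma [sh sE]]] := stP l.
have [js [b [ujs jsE sjs DE]]] := sDP l.
set p := proj (fun a => ell (x l) a : {linear M -> M}) (lift (der l)) (x l l) m.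
have dF : barX (x l) (Ph l) F = 0.
  have [rho0|/B0 //] := posnP rho; apply/funext => w.
  have := grb_barX PhiH l Fh => /grb_eq0 -> //; move: rho0; lia.
have F0 w : 0%N \in w -> F w = 0 by case: (Fh w).
have Fnil (w : seq nat) a : (m < a + sumn w)%N -> iter a (lift (der l)) (F w) = 0.
  exact: (iter_der_eq0 _ Fh).
have pFh : hM (n%:Z + rho%:Z) rho%:Z (e - (n%:Z - 2) - rho%:Z + m%:Z) (p (F [::])).
  have [_ /(hM_proj (l := l) (N := m) (@xs_hd _ _ l) (@xs_hd _ _ l l))] := Fh [::].
  by apply: hM_conv => /=; lia.
(* For [rho > 0] the divided degree is positive while [der l] kills the projection, so some other
   exponent is nonzero and [zeroed js] gives 0. For [rho = 0] the obstruction is a multiple of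
   [Delta (F [::])]. *)
have pF0 : ctrs (Ph l) js (lift (zeroed js) (p (F [::]))) = 0.
  have [rho0|rho0] := posnP rho; last first.
    rewrite (zeroed_eq0 (l := l) _ jsE pFh) ?ctrs0 //.
    have dL a (g : M) : lift (der l) ((fun a => ell (x l) a : {linear M -> M}) a.+1 g)
      = (fun a => ell (x l) a : {linear M -> M}) a.+1 (lift (der l) g)
        + x l l *: (fun a => ell (x l) a : {linear M -> M}) a g by exact: lder_ell.
    apply: (proj_ker (dps_ell m (x l)) dL).
    by apply: Fnil; rewrite addn0.
  apply: (@ctrs_proj0 S m n (x l) (Ph l) (De l) js ((-1) ^+ b * 'X_l)); last exact: D0.
  by move=> h; rewrite -scalerA DE.
have lljs : l \notin js by rewrite jsE eqxx.
have PS j i : j != l -> i != l -> \sum_a Ph l i a * sigma j a = (i == j)%:R * 'X_l ^+ N0.+1.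
  move=> jl il; rewrite sE // (negbTE il) mul0r subr0 mulrCA -exprSr; ring.
have dG := barX_primP (@xsPhis _ _ _ _ XPhi l) PS ujs lljs F0 Fnil dF pF0.
set G := barX_prim _ _ _ _ _ _ _ _ in dG.
(* Each row of [js] costs the factor ['X_l ^+ N0.+1], and the projection onto [ker (der l)] costs
   ['X_l ^+ m]. *)
exists (N0.+1 * size js + m)%N, G; split; last by rewrite dG xll exprD exprM.
have vh : hd ((size js)%:Z * N0.+1%:Z) (('X_l : S) ^+ N0.+1 ^+ size js).
  by have := hdXn (a := size js) (hdXn (a := N0.+1) (@hdX k n l)); rewrite mulr1.
move=> w; have [S0 Sh] := grb_bar_prim l Fh w; split=> [w0|].
  rewrite -[LHS]/(_ *: bar_prim _ _ _ _ _ w + emb _ w) [X in _ *: X + _](S0 w0).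
  by rewrite scaler0 add0r; case: w w0 {S0 Sh}.
apply: hMD; first by apply: hM_conv (hMZ vh Sh) => //; lia.
case: w {S0 Sh} => [|a w]; last exact: hM0.
have := hM_koz_prim PhiH (l := l) (js := js) sh pFh; apply: hM_conv => /=; lia.
Qed.

(** Multiply [z] by the lifts [sigma j] of the directions other than [l]. Since every [Phi j] kills
    [z], contracting by these directions returns [z] times a power of ['X_l]. *)
Lemma torsion_two (l : 'I_n) e (z : M) : hM 1 0 e z -> del2 (Ph l) z = 0 ->
  exists N g, hM n%:Z 0 (e + N%:Z - (n%:Z - 2)) g /\ Delta (De l) g = 'X_l ^+ N *: z.
Proof.
move=> zh dz; have [N0 [sigma [sh sE]]] := stP l.
have [js [b [ujs jsE sjs DE]]] := sDP l.
have z0 := del2_contr0 (fun j => lift_der_eq0 j zh) dz.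
have PS i j : i != l -> j != l ->
    \sum_a Ph l i a * sigma j a = (i == j)%:R * 'X_l ^+ N0.+1.
  move=> il jl; rewrite sE // (negbTE il) mul0r subr0 mulrCA -exprSr; ring.
have lljs : l \notin js by rewrite jsE eqxx.
have [c] := ctrs_emuls PS ujs lljs z0; set E := foldr _ _ _; rewrite DE => EE.
(* The extra ['X_l] is the factor by which the minors exceed [Delta]; the sign collects those of
   [DE] and [ctrs_emuls]. *)
exists (N0.+1 * n.-1)%N, ((-1) ^+ (b + c) *: ('X_l *: E)).
split.
  have Eh : hM (1 + (size js)%:Z) 0 (e + (size js)%:Z * N0%:Z) E.
    rewrite /E; elim: (js) => [|j js' IH] /=; first by apply: hM_conv zh; lia.
    by apply: hM_conv (hM_emul (sh j) IH) => //; rewrite intS; ring.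
  apply: hMZ0; first exact: hd_signr.
  by apply: hM_conv (hMZ (@hdX _ _ l) Eh) => //; rewrite sjs; lia.
rewrite !DeltaZr exprM exprD [(-1) ^+ b * _]mulrC -scalerA EE.
by rewrite scalerA -expr2 sqrr_sign scale1r sjs.
Qed.

Lemma sum_raise_der p d (f : M) : hM p 1 d f -> \sum_j lift (raise j) (lift (der j) f) = f.
Proof.
move=> fh; apply/funext => J; apply/funext => b; rewrite !fct_sumE.
have [f0|f0] := eqVneq (f J b : S) 0.
  by rewrite [RHS]f0 big1 // => j _; rewrite /lift raise_der f0 if_same.
have b1 : mdeg b = 1%N.
  have : mlead (f J b : S) \in msupp (f J b : S) by rewrite mlead_supp.
  by rewrite mcoeff_msupp => /fh[_ + _] => -[].
have /mdeg1P[i /eqP ->] : mdeg b == 1%N by rewrite b1.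
rewrite (bigD1 i) //= big1 ?addr0 => [|j ji]; rewrite /lift raise_der mnm1E ?eqxx //.
by rewrite [i == j]eq_sym (negbTE ji).
Qed.

Lemma torsion_one (l : 'I_n) e (f : M) : hM 0 1 (e + 1) f -> del1 (x l) f = 0 ->
  exists N g, hM 1 0 (e + N%:Z) g /\ del2 (Ph l) g = 'X_l ^+ N *: f.
Proof.
move=> fh df; have [N0 [sigma [sh sE]]] := stP l.
exists N0.+1, (del2_prim sigma l f); split.
  apply: hM_sum => j jl; have := hM_emul (sh j) (hM_der (j := j) fh).
  by apply: hM_conv => //; lia.
rewrite exprSr -[X in _ * X](xll k l); apply: (del2_primP (x := x l)) => //.
- by move=> i j jl; rewrite sE // /x xll.
- move=> i j; apply: hM_neg (_ : 0 - 1 < 0) => //.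
  by apply: hM_contr (hM_raise (hM_der fh)) => a; exact: Phis_hd.
- exact: sum_raise_der fh.
Qed.

Lemma torsion (l : 'I_n) r e (F : U) : (0 < r)%N -> gr r e F -> dX Phi dl l r.-1 F = 0 ->
  exists N G, gr r.+1 (e + N%:Z) G /\ dX Phi dl l r G = 'X_l ^+ N *: F.
Proof.
have emb0P (g : M) : emb g = 0 -> g = 0 by move/(congr1 (fun F : U => F [::])).
case: r => [|[|[|rho]]] //= _.
- case=> FE Fh /emb0P /(torsion_one Fh)[N [g [gh E]]]; exists N, (emb g).
  by rewrite /= E FE; split=> //; apply/funext => -[|a w] //=; rewrite fctE scaler0.
- case=> FE Fh /emb0P /(torsion_two Fh)[N [g [gh E]]]; exists N, (emb g); split.
    move=> w; split; first by case: w.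
    case: w => [|a w]; last exact: hM0.
    by apply: hM_conv gh => /=; lia.
  by rewrite /= E FE; apply/funext => -[|a w] //=; rewrite fctE scaler0.
move=> Fh F0; have [||N [G [Gh GE]]] := @torsion_high l rho e F Fh.
- by move=> rho0; rewrite rho0 in F0; exact: emb0P.
- by case: rho F0 Fh.
exists N, G; split=> //; rewrite (_ : rho.+1%:Z = rho%:Z + 1) //; lia.
Qed.

End Torsion.

(** * Division by a variable *)

Section Exactness.
Variables (k : fieldType) (m n : nat).
Local Notation S := {mpoly k[n]}.
Local Notation D := ('X_{1..n} -> S^o).
Local Notation M := ({set 'I_m} -> D).
Local Notation U := (seq nat -> M).
Variables (Phi : 'I_n -> 'I_m -> S) (dl : {set 'I_m} -> {set 'I_m} -> S).
Hypothesis PhiH : forall j a, hd 1 (Phi j a).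
Hypothesis XPhi : forall a, \sum_j 'X_j * Phi j a = 0.
Hypothesis n_gt2 : (2 < n)%N.
Let n_gt1 : (1 < n)%N := ltnW n_gt2.
Hypothesis DeltaP : minors_divided Phi dl.

Hypothesis torsP : generically_onto Phi.

Let d := dX Phi dl.

Lemma dX_linear_comb l r c (F G : U) : d l r (c *: F + G) = c *: d l r F + d l r G.
Proof.
rewrite /d; case: r => [|[|[|r]]] /=; last exact: barX_linear_comb.
- by rewrite -emb_linear_comb -del1_linear_comb.
- by rewrite -emb_linear_comb -del2_linear_comb.
- by rewrite -emb_linear_comb -Delta_linear_comb.
Qed.

Lemma dX0 l r : d l r 0 = 0.
Proof. by have := dX_linear_comb l r (-1) 0 0; rewrite scaler0 addr0 scaleN1r addNr. Qed.

Lemma dXZ l r c (F : U) : d l r (c *: F) = c *: d l r F.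
Proof. by have := dX_linear_comb l r c F 0; rewrite dX0 !addr0. Qed.

Lemma dXB l r (F G : U) : d l r (F - G) = d l r F - d l r G.
Proof. by rewrite addrC -scaleN1r dX_linear_comb scaleN1r addrC. Qed.

Lemma dE l l' r F : (l <= l')%N -> evU l' (d l r F) = d l' r (evU l' F).
Proof. exact: evU_dX. Qed.

Lemma dd l r e F : gr r.+2 e F -> d l r (d l r.+1 F) = 0.
Proof. exact: (dX_dX XPhi n_gt1 DeltaP). Qed.

Lemma evUE l (F : U) w J b : evU l F w J b = evl l (F w J b). Proof. by []. Qed.

Lemma evU_linear_comb l c (F G : U) : evU l (c *: F + G) = evl l c *: evU l F + evU l G.
Proof.
apply/funext => w; apply/funext => J; apply/funext => b.
by rewrite evUE -[RHS]/(evl l c * evU l F w J b + evU l G w J b) rmorphD rmorphM.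
Qed.

Lemma evU0 l : evU l (0 : U) = 0.
Proof.
apply/funext => w; apply/funext => J; apply/funext => b.
by rewrite evUE rmorph0.
Qed.

Lemma evUZ l c (F : U) : evU l (c *: F) = evl l c *: evU l F.
Proof. by have := evU_linear_comb l c F 0; rewrite evU0 !addr0. Qed.

Lemma evUB l (F G : U) : evU l (F - G) = evU l F - evU l G.
Proof. by rewrite addrC -scaleN1r evU_linear_comb rmorphN1 scaleN1r addrC. Qed.

Lemma evU_id l l' (F : U) : (l <= l')%N -> evU l' F = F -> evU l F = F.
Proof.
move=> ll E; apply/funext => w; apply/funext => J; apply/funext => b.
by rewrite evUE; apply: evl_id ll _; rewrite -evUE E.
Qed.

Lemma evU_idem l (F : U) : evU l (evU l F) = evU l F.
Proof.
apply/funext => w; apply/funext => J; apply/funext => b.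
by rewrite !evUE evl_evl.
Qed.

Lemma evlXn_l (l : 'I_n) N : evl l ('X_l ^+ N : S) = 'X_l ^+ N.
Proof. by rewrite rmorphXn /= evlX ltnn. Qed.

Lemma evlX_S (l : 'I_n) : evl l.+1 ('X_l : S) = 0.
Proof. by rewrite evlX leqnn. Qed.

Lemma scaleX_injU (l : 'I_n) (F G : U) : 'X_l *: F = 'X_l *: G -> F = G.
Proof.
move=> E; apply/funext => w; apply: (@scaleX_inj _ _ _ l).
exact: (congr1 (fun F : U => F w) E).
Qed.

(** The quotient by the variables of index below [l] is modelled inside S by the polynomials free of
    them, which is the condition [evU l F = F]. *)
Definition exact_from l r (e : int) := forall e' F, e <= e' -> gr r e' F -> evU l F = F ->
  d l r.-1 F = 0 -> exists G, [/\ gr r.+1 e' G, evU l G = G & d l r G = F].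

(** A primitive [h] over stage [l.+1] is also an element of stage [l]. There [G - d h] vanishes
    modulo ['X_l], hence is divisible by it. *)
Lemma divide (l : 'I_n) r e (G : U) h : gr r e G -> evU l G = G ->
    gr r.+1 e h -> evU l.+1 h = h -> (0 < r)%N -> d l.+1 r h = evU l.+1 G ->
  exists G', [/\ gr r (e - 1) G', evU l G' = G' & G = d l r h + 'X_l *: G'].
Proof.
move=> Gh El hh Eh r0 dh.
have Elh : evU l h = h by exact: evU_id Eh.
have [||G' GE G'l] := @evU_divX _ _ _ l (G - d l r h).
- by rewrite evUB El (dE _ _ (leqnn l)) Elh.
- by rewrite evUB (dE _ _ (leqnSn l)) Eh dh subrr.
exists G'; split=> //; last by rewrite -GE addrC subrK.
by apply: (@gr_divX _ _ _ l); rewrite -GE; apply: gr_sub => //; apply: gr_dX.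
Qed.

Lemma exact_step (l : 'I_n) r e : (0 < r)%N ->
  exact_from l.+1 r.+1 (e + 1) -> exact_from l r e.
Proof.
move=> r0 V e' F ee Fh Fl dF.
have [N [G0 [G0h dG0]]] := @torsion k m n Phi dl PhiH XPhi n_gt1 DeltaP torsP l r e' F r0 Fh dF.
have : exists G, [/\ gr r.+1 (e' + N%:Z) G, evU l G = G & d l r G = 'X_l ^+ N *: F].
  exists (evU l G0); split; [exact: gr_evU|exact: evU_idem|].
  by rewrite -(dE _ _ (leqnn l)) [d _ _ _]dG0 evUZ evlXn_l Fl.
case=> {G0 G0h dG0}; elim: N => [|N IH] G [Gh Gl dG].
  by exists G; rewrite addr0 in Gh; rewrite dG expr0 scale1r.
have [||||g [gh gl dg]] := V (e' + N.+1%:Z) (evU l.+1 G); first by lia.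
- exact: gr_evU.
- exact: evU_idem.
- by rewrite -(dE _ _ (leqnSn l)) dG evUZ rmorphXn /= evlX_S expr0n scale0r.
have [//|G' [G'h G'l GE]] := divide Gh Gl gh gl _ dg.
apply: (IH G'); split=> //.
  by rewrite (_ : e' + N%:Z = e' + N.+1%:Z - 1) //; lia.
apply: (@scaleX_injU l); rewrite -dXZ scalerA -exprS -dG.
have -> : 'X_l *: G' = G - d l r.+1 g by rewrite GE addrC addKr.
by rewrite dXB (dd _ gh) subr0.
Qed.

Lemma exact_iter r e i : (0 < r)%N -> (i <= n)%N ->
  exact_from n (r + i) (e + i%:Z) -> exact_from (n - i) r e.
Proof.
elim: i r e => [|i IH] r e r0 ni; first by rewrite !addr0 subn0 addn0.
move=> V; have ln : (n - i.+1 < n)%N by lia.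
apply: (@exact_step (Ordinal ln)) => //=.
rewrite (_ : (n - i.+1).+1 = (n - i)%N); last by lia.
apply: IH => //; first exact: ltnW.
rewrite addSnnS (_ : e + 1 + i%:Z = e + i.+1%:Z) //; lia.
Qed.

(* At stage [n] all coefficients are constants. *)
Lemma evM_eq0 p s e (g : M) : evM n g = g -> hM p s e g -> e != 0 -> g = 0.
Proof.
move=> gn gh e0; apply/funext => J; apply/funext => b; apply/mpolyP => c.
rewrite mcoeff0; apply/eqP/negPn/negP => nz; have [_ _ ce] := gh J b c nz.
have : (evM n g J b)@_c != 0 by rewrite gn.
rewrite /evM /mapM mcoeff_evl; case: ifP => [/forallP cn|]; last by rewrite eqxx.
move=> _; move: e0; rewrite -ce mdegE big1 // => i _.
by apply/eqP/(implyP (cn i)).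
Qed.

Lemma size_leq_sumn (w : seq nat) : 0%N \notin w -> (size w <= sumn w)%N.
Proof.
elim: w => //= a w IH; rewrite inE negb_or => /andP[a0 /IH]; lia.
Qed.

Lemma grb_const_eq0 rho e (F : U) w : grb rho e F -> evU n F = F ->
  (0%N \notin w -> (size w <= sumn w)%N -> (size w)%:Z + (sumn w)%:Z <= rho ->
   n%:Z + (rho - (size w)%:Z) <= m%:Z ->
   e != n%:Z - 2 + (rho - (size w)%:Z) + (sumn w)%:Z) -> F w = 0.
Proof.
move=> Fh Fn H; have [w0|w0] := boolP (0%N \in w); first by have [/(_ w0)] := Fh w.
have [sm|sm] := boolP ((rho < (size w)%:Z + (sumn w)%:Z)
                    || (m%:Z < n%:Z + (rho - (size w)%:Z))).
  exact: grb_eq0 Fh sm.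
move: sm; rewrite negb_or -!Order.TotalTheory.leNgt => /andP[h1 h2].
have [_ Fw] := Fh w; apply: evM_eq0 Fw _; first exact: (congr1 (fun F : U => F w) Fn).
have := H w0 (size_leq_sumn w0) h1 h2; apply: contraNneq => E; rewrite -subr_eq0 -E; apply/eqP; ring.
Qed.

(** At stage [n] only constants are left, so an element is zero in every degree that is not the
    degree of a generator. *)
Lemma exact_const rho e : (forall (w : seq nat) e', e <= e' ->
    (size w <= sumn w)%N -> (size w)%:Z + (sumn w)%:Z <= rho%:Z ->
   n%:Z + (rho%:Z - (size w)%:Z) <= m%:Z ->
   e' != n%:Z - 2 + (rho%:Z - (size w)%:Z) + (sumn w)%:Z) -> exact_from n rho.+3 e.
Proof.
move=> H e' F ee Fh Fn _; exists 0; split; last 2 first.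
- exact: evU0.
- rewrite dX0; apply/esym/funext => w; apply: (grb_const_eq0 Fh Fn) => _; exact: H.
by move=> w; split=> //; exact: hM0.
Qed.

(** In position n + 1, that is rho = n - 2, the empty word has degree 2n - 4. A nonempty word has
    size w <= sumn w and size w + sumn w <= n - 2, so its degree 2n - 4 - size w + sumn w is at most
    3n - 8. For n > 3 both are below 3n - 7 = (2n - 7) + n. *)
Theorem exact_one : (3 < n)%N -> exact_from 0 1 (2 * n%:Z - 7).
Proof.
move=> n3; have := @exact_iter 1 _ n isT (leqnn n); rewrite subnn; apply.
rewrite (_ : 1 + n = (n - 2).+3)%N; last by lia.
apply: exact_const => w e' ee sw h _.
case: w sw h => [|a w] /=; first by move=> *; apply/eqP; lia.
by move: (size w) (sumn w) => s t; lia.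
Qed.

(** For n = 3 no nonempty word fits in position 4, and the empty word has degree 2 < 0 + n. *)
Theorem exact_one_three : n = 3%N -> exact_from 0 1 0.
Proof.
move=> n3; have := @exact_iter 1 _ n isT (leqnn n); rewrite subnn; apply.
rewrite (_ : 1 + n = (n - 2).+3)%N; last by lia.
apply: exact_const => w e' ee sw h _.
case: w sw h => [|a w] /=; first by move=> *; apply/eqP; lia.
by move: (size w) (sumn w) => s t; lia.
Qed.

End Exactness.

(** * The case dim K = 2n - 3 *)

Section Diagonal.
Variables (k : fieldType) (m n : nat).
Local Notation S := {mpoly k[n]}.
Local Notation D := ('X_{1..n} -> S^o).
Local Notation M := ({set 'I_m} -> D).
Local Notation U := (seq nat -> M).
Variables (Phi : 'I_n -> 'I_m -> S) (dl : {set 'I_m} -> {set 'I_m} -> S).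
Hypothesis PhiH : forall j a, hd 1 (Phi j a).
Hypothesis XPhi : forall a, \sum_j 'X_j * Phi j a = 0.
Hypothesis n_gt2 : (2 < n)%N.
Let n_gt1 : (1 < n)%N := ltnW n_gt2.
Hypothesis DeltaP : minors_divided Phi dl.

Hypothesis torsP : generically_onto Phi.

Hypothesis n_gt3 : (3 < n)%N.
Hypothesis mE : m = (2 * n - 3)%N.
Let d := dX Phi dl.
Let ex l r e := @exact_from k m n Phi dl l r e.

Lemma exact_diag1 l : (l <= n)%N -> ex l l.+1 (2 * n%:Z - 7 + l%:Z).
Proof.
move=> ln; have := @exact_iter k m n Phi dl PhiH XPhi n_gt2 DeltaP torsP l.+1
  (2 * n%:Z - 7 + l%:Z) (n - l)%N isT (leq_subr _ _).
rewrite subKn //; apply.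
rewrite (_ : l.+1 + (n - l) = (n - 2).+3)%N; last by lia.
apply: exact_const => // w e' ee sw hs _.
case: w sw hs => [|a w] /=; first by move=> *; apply/eqP; lia.
by move: (size w) (sumn w) => s t; lia.
Qed.

(** This descends to position n + 2, where rho = n - 1. There n + s <= 2n - 3 forces at least two
    letters, which brings the degrees down to at most 3n - 8. *)
Lemma exact_diag2 l : (l <= n)%N -> ex l l.+2 (2 * n%:Z - 7 + l%:Z).
Proof.
move=> ln; have := @exact_iter k m n Phi dl PhiH XPhi n_gt2 DeltaP torsP l.+2
  (2 * n%:Z - 7 + l%:Z) (n - l)%N isT (leq_subr _ _).
rewrite subKn //; apply.
rewrite (_ : l.+2 + (n - l) = (n - 1).+3)%N; last by lia.
apply: exact_const => // w e' ee; rewrite mE.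
by move: (size w) (sumn w) => s t; lia.
Qed.

(** The degree 2n - 8 + l is the last one below the range of [exact_diag1]. *)
Definition cyc l (c : U) :=
  [/\ gr l.+1 (2 * n%:Z - 8 + l%:Z) c, evU l c = c & d l l c = 0].

Definition bnd l (c : U) := exists G,
  [/\ gr l.+2 (2 * n%:Z - 8 + l%:Z) G, evU l G = G & d l l.+1 G = c].

(* Stage [l.+1] is the quotient of stage [l] by ['X_l]; [linked] is the inverse of the connecting
   map from [H_(l+2)] of the quotient to [H_(l+1)] of stage [l]. *)
Definition linked (l : 'I_n) (c c' : U) := exists b, [/\ gr l.+2 (2 * n%:Z - 7 + l%:Z) b,
  evU l b = b, d l l.+1 b = 'X_l *: c & evU l.+1 b = c'].

Let dZ l r c (F : U) : d l r (c *: F) = c *: d l r F. Proof. exact: dXZ. Qed.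
Let dB l r (F G : U) : d l r (F - G) = d l r F - d l r G. Proof. exact: dXB. Qed.
Let dcomb l r c (F G : U) : d l r (c *: F + G) = c *: d l r F + d l r G.
Proof. exact: dX_linear_comb. Qed.
Let dE l l' r F : (l <= l')%N -> evU l' (d l r F) = d l' r (evU l' F).
Proof. exact: dE. Qed.
Let dd l r e F : gr r.+2 e F -> d l r (d l r.+1 F) = 0.
Proof. exact: dd. Qed.

Lemma gr_scale r e a c (F : U) : hd a c -> gr r e F -> gr r (e + a) (c *: F).
Proof.
move=> ca; have hX p s i (g : M) : hM p s i g -> hM p s (i + a) (c *: g).
  by move=> gh; rewrite addrC; exact: hMZ.
have E : F = emb (F [::]) -> c *: F = emb ((c *: F) [::]).
  by move=> {1}->; apply/funext => -[|b w] //; exact: scaler0.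
case: r => [|[|[|r]]] /=; last first.
- move=> Fh w; have [F0 F1] := Fh w; split=> [/F0 E'|].
    by rewrite -[LHS]/(c *: F w) E' scaler0.
  by apply: hM_conv (hX _ _ _ _ F1) => //; ring.
- by case=> /E FE /hX Fh; split.
- by case=> /E FE /hX Fh; split=> //; apply: hM_conv Fh => //; ring.
- by case=> /E FE /hX Fh; split=> //; apply: hM_conv Fh => //; ring.
Qed.

Lemma gr_scale0 r e c (F : U) : hd 0 c -> gr r e F -> gr r e (c *: F).
Proof. by move=> c0 /(gr_scale c0); rewrite addr0. Qed.

Lemma gr_comb r e c (F G : U) : hd 0 c -> gr r e F -> gr r e G -> gr r e (c *: F + G).
Proof.
move=> c0 /(gr_scale0 c0) Fh /(gr_scale0 (@hd_signr k n 1)) Gh.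
by rewrite -[G]opprK -[- G]scaleN1r -[-1]expr1; exact: gr_sub.
Qed.

Lemma grX (l : 'I_n) r e (F : U) : gr r e F -> gr r (e + 1) ('X_l *: F).
Proof. exact/gr_scale/hdX. Qed.

Lemma linked_comb (l : 'I_n) a c1 c2 c1' c2' : linked l c1 c1' -> linked l c2 c2' ->
  linked l (a%:MP *: c1 + c2) (a%:MP *: c1' + c2').
Proof.
case=> b [bh bl db bE] [b' [bh' bl' db' bE']].
have aE i : evl i (a%:MP : S) = a%:MP by exact: comp_mpolyC.
exists (a%:MP *: b + b'); split.
- have a0 : hd 0 (a%:MP : S) by exact: (@hd_const k n a).
  exact: gr_comb.
- by rewrite evU_linear_comb bl bl' aE.
- by rewrite dcomb db db' scalerDr !scalerA [_ * a%:MP]mulrC.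
- by rewrite evU_linear_comb bE bE' aE.
Qed.

Lemma linked_cyc (l : 'I_n) c c' : linked l c c' -> cyc l.+1 c'.
Proof.
case=> b [bh bl db bE]; split.
- rewrite -bE; apply: gr_evU; rewrite (_ : 2 * n%:Z - 8 + l.+1%:Z = 2 * n%:Z - 7 + l%:Z) //.
  by lia.
- by rewrite -bE evU_idem.
- by rewrite -bE -(dE _ _ (leqnSn l)) db evUZ evlX_S scale0r.
Qed.

(** Multiplication by ['X_l] moves [c] into the degree where [exact_diag1] provides a primitive. *)
Lemma linked_right (l : 'I_n) c : cyc l c -> exists c', linked l c c'.
Proof.
case=> ch cl dc; have [||||b [bh bl db]] :=
  @exact_diag1 l (ltnW (ltn_ord l)) (2 * n%:Z - 7 + l%:Z) ('X_l *: c).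
- exact: Order.POrderTheory.lexx.
- by have := grX l ch; rewrite (_ : 2 * n%:Z - 8 + l%:Z + 1 = 2 * n%:Z - 7 + l%:Z) //; ring.
- by rewrite evUZ cl evlX ltnn.
- by rewrite -[LHS]/(d l l _) dZ dc scaler0.
by exists (evU l.+1 b), b; split.
Qed.

Lemma linked_left (l : 'I_n) c' : cyc l.+1 c' -> exists2 c, cyc l c & linked l c c'.
Proof.
case=> ch cl dc.
have ch' : gr l.+2 (2 * n%:Z - 7 + l%:Z) c'.
  by rewrite (_ : 2 * n%:Z - 7 + l%:Z = 2 * n%:Z - 8 + l.+1%:Z) //; lia.
have cl' : evU l c' = c' by exact: evU_id cl.
have [||c cE lc] := @evU_divX _ _ _ l (d l l.+1 c').
- by rewrite (dE _ _ (leqnn l)) cl'.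
- by rewrite (dE _ _ (leqnSn l)) cl.
exists c; last by exists c'; split.
split=> //.
- rewrite (_ : 2 * n%:Z - 8 + l%:Z = 2 * n%:Z - 7 + l%:Z - 1); last by ring.
  by apply: (@gr_divX _ _ _ l); rewrite -cE; apply: gr_dX.
by apply: (@scaleX_injU _ _ _ l); rewrite -dZ -cE (dd _ ch') scaler0.
Qed.

(** If [c = d G], then [b - 'X_l *: G] is a cycle, hence a boundary by [exact_diag2], and it reduces
    to [c']. Conversely, a primitive of [c'] lets [divide] write [b] as a boundary plus ['X_l *: G],
    and then [d G = c]. *)
Lemma linked_bnd (l : 'I_n) c c' : linked l c c' -> cyc l c -> bnd l c <-> bnd l.+1 c'.
Proof.
case=> b [bh bl db bE] [ch cl dc]; have ln := ltnW (ltn_ord l).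
have eS : 2 * n%:Z - 8 + l.+1%:Z = 2 * n%:Z - 7 + l%:Z by lia.
split=> [[G [Gh Gl dG]]|[h [hh hl dh]]].
  have [||||h [hh hl dh]] := @exact_diag2 l ln (2 * n%:Z - 7 + l%:Z) (b - 'X_l *: G).
  - exact: Order.POrderTheory.lexx.
  - apply: gr_sub => //; have := grX l Gh.
    by rewrite (_ : 2 * n%:Z - 8 + l%:Z + 1 = 2 * n%:Z - 7 + l%:Z) //; ring.
  - by rewrite evUB evUZ bl Gl evlX ltnn.
  - by rewrite -[LHS]/(d l l.+1 _) dB dZ db dG subrr.
  exists (evU l.+1 h); split; [by rewrite eS; exact: gr_evU|exact: evU_idem|].
  by rewrite -(dE _ _ (leqnSn l)) [d _ _ _]dh evUB evUZ evlX_S scale0r subr0.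
rewrite eS in hh; have [||G [Gh Gl GE]] := divide PhiH n_gt2 DeltaP bh bl hh hl.
- by [].
- by rewrite bE; exact: dh.
exists G; split=> //.
  by rewrite (_ : 2 * n%:Z - 8 + l%:Z = 2 * n%:Z - 7 + l%:Z - 1) //; ring.
have XG : 'X_l *: G = b - d l l.+2 h.
  by apply/eqP; rewrite eq_sym subr_eq addrC; apply/eqP; exact: GE.
by apply: (@scaleX_injU _ _ _ l); rewrite -dZ XG dB (dd _ hh) subr0 db.
Qed.

End Diagonal.

(** * The homology of the constants in degree 3n - 8 *)

Section ZeroPoint.
Variables (T : comNzRingType) (m n : nat).
Local Notation D := ('X_{1..n} -> T^o).
Local Notation M := ({set 'I_m} -> D).
Variables (x : 'I_n -> T) (Phi : 'I_n -> 'I_m -> T).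
Hypotheses (x0 : forall j, x j = 0) (Phi0 : forall j a, Phi j a = 0).

Lemma barX_point (F : seq nat -> M) w : barX x Phi F w = F (0%N :: w) + bdel F w.
Proof.
rewrite /barX /bar /koz [X in _ *: X]big1 => [|j _]; last by rewrite contr0.
rewrite scaler0 addr0 big_ord_recl big1 ?addr0 => [|a _].
  by congr (_ + _); apply/funext => J; rewrite /= /ell /lift ldiv_x0.
by apply/funext => J; rewrite /= /ell /lift ldiv_x0.
Qed.

End ZeroPoint.

Section TopClass.
Variables (k : fieldType) (m n : nat).
Local Notation S := {mpoly k[n]}.
Local Notation D := ('X_{1..n} -> S^o).
Local Notation M := ({set 'I_m} -> D).
Local Notation U := (seq nat -> M).
Variables (Phi : 'I_n -> 'I_m -> S) (dl : {set 'I_m} -> {set 'I_m} -> S).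
Hypothesis PhiH : forall j a, hd 1 (Phi j a).
Hypothesis XPhi : forall a, \sum_j 'X_j * Phi j a = 0.
Hypothesis n_gt2 : (2 < n)%N.
Let n_gt1 : (1 < n)%N := ltnW n_gt2.
Hypothesis DeltaP : minors_divided Phi dl.

Hypothesis torsP : generically_onto Phi.

Hypothesis n_gt3 : (3 < n)%N.
Hypothesis mE : m = (2 * n - 3)%N.
Let d := dX Phi dl.
Local Notation cyc := (@cyc k m n Phi dl).
Local Notation bnd := (@bnd k m n Phi dl).
Local Notation linked := (@linked k m n Phi dl).
Let q := (n - 3)%N.

(** The coordinate on the only generator of position n + 1 and degree 3n - 8: the word [n - 3] over
    the top exterior power of K, in divided degree 0. *)
Definition tau (c : U) : k := (c [:: (n - 3)%N] setT 0%MM : S)@_0.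

Definition pt (v : seq nat) (t : k) : U := fun w J b =>
  if [&& w == v, J == setT & b == 0%MM] then t%:MP else 0.

Definition binom_nz := [exists p : 'I_(n - 3), (0 < p)%N && ('C(n - 3, p)%:R != 0 :> k)].

Lemma tau_pt t : tau (pt [:: (n - 3)%N] t) = t.
Proof. by rewrite /tau /pt !eqxx mcoeffC eqxx mulr1. Qed.

Lemma tau_comb a (F G : U) : tau (a%:MP *: F + G) = a * tau F + tau G.
Proof. by rewrite /tau mcoeffD mcoeffCM. Qed.

Lemma gr_high r (rho : nat) (i e : int) (F : U) : r = rho.+3 -> rho%:Z = i ->
  gr r e F = grb i e F.
Proof. by move=> -> <-. Qed.

Lemma pt_grb v t : 0%N \notin v -> sumn v = q ->
  grb ((size v)%:Z + q%:Z) (2 * n%:Z - 8 + n%:Z) (pt v t).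
Proof.
move=> v0 vq w; have [->|wv] := eqVneq w v; last first.
  rewrite (_ : pt v t w = 0); first by split=> [//|]; exact: hM0.
  by apply/funext => J; apply/funext => b; rewrite /pt (negbTE wv).
split=> [|J b c]; first by rewrite (negbTE v0).
rewrite /pt eqxx /=.
case: ifP => [/andP[/eqP-> /eqP->]|_]; last by rewrite mcoeff0 eqxx.
rewrite mcoeffC; case: (eqVneq c 0%MM) => [-> _|]; last by rewrite mulr0 eqxx.
by rewrite cardsT card_ord !mdeg0 vq mE /q; split; lia.
Qed.

Lemma pt_evU v t : evU n (pt v t) = pt v t.
Proof.
apply/funext => w; apply/funext => J; apply/funext => b; rewrite evUE /pt.
by case: ifP => _; [exact: comp_mpolyC|rewrite rmorph0].
Qed.

Lemma pt0 v : pt v 0 = 0.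
Proof.
by apply/funext => w; apply/funext => J; apply/funext => b; rewrite /pt mpolyC0 if_same.
Qed.

Lemma hM_point (g : M) J b : hM m%:Z 0 0 g ->
  g J b = if (J == setT) && (b == 0%MM) then ((g setT 0%MM : S)@_0)%:MP else 0.
Proof.
have z (c : 'X_{1..n}) : (mdeg c)%:Z = 0 -> c = 0%MM.
  by case=> /eqP; rewrite mdeg_eq0 => /eqP.
move=> gh; case: ifP => [/andP[/eqP-> /eqP->]|/negP Jb]; apply/mpolyP => c.
  rewrite mcoeffC; have [->|c0] := eqVneq c 0%MM; first by rewrite mulr1.
  by rewrite mulr0; apply/eqP; apply: contraNT c0 => /gh[_ _ /z->].
rewrite mcoeff0; apply/eqP/negPn/negP => /gh[Jm /z b0 _]; apply: Jb.
rewrite b0 eqxx andbT eqEcard subsetT cardsT card_ord.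
by case: Jm => Jm; rewrite Jm /=.
Qed.

Let xs0 (j : 'I_n) : xs k n j = 0.
Proof. by rewrite xsE ltn_ord. Qed.

Let Phis0 j a : Phis Phi n j a = 0.
Proof.
apply/mpolyP => c; rewrite mcoeff0 mcoeff_evl; case: ifP => // /forallP cn.
apply/eqP/negPn/negP => /PhiH; rewrite mdegE big1 // => i _.
by apply/eqP/(implyP (cn i)).
Qed.

Lemma point_eq (F : U) : grb (q%:Z + 1) (2 * n%:Z - 8 + n%:Z) F -> evU n F = F ->
  F = pt [:: q] (tau F).
Proof.
move=> Fh Fn; apply/funext => w; have [->|wq] := eqVneq w [:: q].
  apply/funext => J; apply/funext => b; rewrite (@hM_point (F [:: q])) /pt ?eqxx //.
  by have [_] := Fh [:: q]; apply: hM_conv; rewrite /= ?mE /q; lia.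
rewrite (grb_const_eq0 n_gt2 Fh Fn) => [|w0 sw h1 h2].
  by apply/funext => J; apply/funext => b; rewrite /pt (negbTE wq).
apply: contraNneq wq; move: w0 sw h1 h2; case: w => [|a [|b w]] /=.
- by rewrite mE /q; lia.
- by rewrite addn0 => *; apply/eqP; congr [:: _]; lia.
by rewrite mE /q; move: (size w) (sumn w) => s t; lia.
Qed.

Lemma point_eq0 (F : U) : grb q%:Z (2 * n%:Z - 8 + n%:Z) F -> evU n F = F -> F = 0.
Proof.
move=> Fh Fn; apply/funext => w; apply: (grb_const_eq0 n_gt2 Fh Fn) => w0.
rewrite mE /q; case: w w0 => [|a w] _ /=; first by move=> *; apply/eqP; lia.
by move: (size w) (sumn w) => s t *; apply/eqP; lia.
Qed.

Lemma dX_point r (F : U) : (3 <= r)%N -> d n r F = barX (xs k n) (Phis Phi n) F.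
Proof. by rewrite /d; case: r => [|[|[|r]]]. Qed.

Let dE l l' r F : (l <= l')%N -> evU l' (d l r F) = d l' r (evU l' F).
Proof. exact: dE. Qed.

Lemma pt_cyc t : cyc n (pt [:: q] t).
Proof.
have q0 : 0%N \notin [:: q] by rewrite inE /q; lia.
have G := pt_grb t q0 (addn0 q).
split; [|exact: pt_evU|].
  by rewrite (@gr_high _ q.+1 (1 + q%:Z)) //=; rewrite /q; lia.
rewrite -/d dX_point //; apply: point_eq0.
  by have := grb_barX PhiH n G; rewrite (_ : (size [:: q])%:Z + q%:Z - 1 = q%:Z) //=; lia.
by rewrite -(dX_point _ (ltnW n_gt3)) (dE _ _ (leqnn n)) pt_evU.
Qed.

(** With all variables zero only the multiplication of letters is left, and the words [p, q - p]
    with 0 < p < q map to C(q, p) times [q]. *)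
Lemma bnd_n c : cyc n c -> bnd n c <-> tau c = 0 \/ binom_nz.
Proof.
case=> ch cn dc; have nE : n = q.+3 by rewrite /q; lia.
have ch' : grb (q%:Z + 1) (2 * n%:Z - 8 + n%:Z) c.
  by rewrite -(@gr_high n.+1 q.+1 _ _ _ (congr1 Datatypes.S nE)) //; lia.
split=> [[G [Gh Gn dG]]|].
  have [nz|nz] := boolP binom_nz; [by right|left].
  have Gh' : grb (q%:Z + 2) (2 * n%:Z - 8 + n%:Z) G.
    by rewrite -(@gr_high n.+2 q.+2 _ _ _ (congr1 (addn 2) nE)) //; lia.
  have G0 v : 0%N \in v -> G v = 0 by have [] := Gh' v.
  have -> : tau c = (bdel G [:: (n - 3)%N] setT 0%MM : S)@_0.
    rewrite -dG -/d (dX_point _ (leqW (ltnW n_gt3))) /tau (barX_point xs0 Phis0).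
    by rewrite [G [:: _, _ & _]]G0 ?inE // add0r.
  rewrite /= subr0 -[(- _) _ _]/(- ((\sum_(p < (n - 3).+1) _ *: G _) setT 0%MM)).
  rewrite !fct_sumE mcoeffN raddf_sum big1 ?oppr0 // => p _ /=.
  have [p0|p0] := posnP p; first by rewrite G0 ?inE ?p0 // scaler0 mcoeff0.
  have [pq|pq] := ltnP p (n - 3); last first.
    by rewrite G0 ?inE ?scaler0 ?mcoeff0 // (_ : (n - 3 - p)%N = 0%N) ?orbT //; lia.
  move: nz; rewrite negb_exists => /forallP/(_ (Ordinal pq)); rewrite p0 negbK /= => /eqP C0.
  rewrite -[X in X@__]/('C(n - 3, p)%:R * (G [:: val p; (n - 3 - p)%N] setT 0%MM : S)).
  by rewrite -[_%:R]mpolyC_nat C0 mpolyC0 mul0r mcoeff0.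
case=> [t0|/existsP[p /andP[p0 nz]]].
  exists 0; split; [|exact: evU0|by rewrite dX0 (point_eq ch' cn) t0 pt0].
  rewrite (@gr_high n.+2 q.+2 _ _ _ (congr1 (addn 2) nE) erefl).
  by move=> w; split=> [//|]; exact: hM0.
pose v := [:: val p; (q - p)%N]; have pq := ltn_ord p.
have v0 : 0%N \notin v by rewrite !inE negb_or ![0%N == _]eq_sym -!lt0n p0 subn_gt0.
have vq : sumn v = q by rewrite /= addn0 subnKC // ltnW.
pose G := pt v (- tau c / 'C(n - 3, p)%:R).
have Gh := pt_grb (- tau c / 'C(n - 3, p)%:R) v0 vq.
exists G; split; [|exact: pt_evU|].
  by rewrite (@gr_high n.+2 q.+2 _ _ _ (congr1 (addn 2) nE) erefl); exact: Gh.
rewrite -/d; set B := d _ _ _.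
have BE : B = barX (xs k n) (Phis Phi n) G by exact: dX_point (leqW (ltnW n_gt3)).
have -> : B = pt [:: q] (tau B).
  apply: point_eq; last by rewrite /B (dE _ _ (leqnn n)) pt_evU.
  have := grb_barX PhiH n Gh; rewrite -BE.
  by rewrite (_ : (size v)%:Z + q%:Z - 1 = q%:Z + 1) //=; lia.
rewrite [RHS](point_eq ch' cn); congr pt.
have -> : tau B = (bdel G [:: (n - 3)%N] setT 0%MM : S)@_0.
  rewrite BE /tau (barX_point xs0 Phis0).
  have -> : G [:: 0%N; (n - 3)%N] = 0; last by rewrite add0r.
  apply/funext => J; apply/funext => b; rewrite /G /pt ifF //.
  by apply/negP => /and3P[/eqP[p0' _ _]]; move: p0; rewrite -p0'.
rewrite /= subr0 -[(- _) _ _]/(- ((\sum_(p < (n - 3).+1) _ *: G _) setT 0%MM)).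
rewrite !fct_sumE mcoeffN raddf_sum (bigD1 (widen_ord (leqnSn _) p)) //= big1 => [|i ip].
  rewrite addr0 -[X in X@__]/('C(n - 3, p)%:R * (G v setT 0%MM : S)).
  rewrite /G /pt !eqxx -[_%:R]mpolyC_nat -mpolyCM mcoeffC eqxx mulr1 mulrC.
  by rewrite divfK // opprK.
rewrite -[X in X@__]/('C(n - 3, i)%:R * (G [:: val i; (n - 3 - i)%N] setT 0%MM : S)).
rewrite /G /pt ifF ?mulr0 ?mcoeff0 //; apply/negP => /and3P[/eqP[iE _] _ _].
by move: ip; rewrite -val_eqE /= iE eqxx.
Qed.

(** [P] composes [linked] through all stages and ends with [tau]. It is a relation because each step
    chooses a primitive; the last clause controls the ambiguity. *)
Lemma top_relation : exists P : U -> k -> Prop,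
 [/\ forall c, cyc 0 c -> exists t, P c t,
     forall t, exists2 c, cyc 0 c & P c t,
     forall a c c' t t', P c t -> P c' t' -> P (a%:MP *: c + c') (a * t + t') &
     forall c t, cyc 0 c -> P c t -> bnd 0 c <-> t = 0 \/ binom_nz].
Proof.
have LC (l : 'I_n) c c' : linked l c c' -> cyc l.+1 c' by apply: linked_cyc.
have LL (l : 'I_n) c' : cyc l.+1 c' -> exists2 c, cyc l c & linked l c c'.
  by apply: linked_left.
suff H i : (i <= n)%N -> exists P : U -> k -> Prop,
 [/\ forall c, cyc (n - i) c -> exists t, P c t,
     forall t, exists2 c, cyc (n - i) c & P c t,
     forall a c c' t t', P c t -> P c' t' -> P (a%:MP *: c + c') (a * t + t') &
     forall c t, cyc (n - i) c -> P c t -> bnd (n - i) c <-> t = 0 \/ binom_nz].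
  by have := H n (leqnn n); rewrite subnn.
elim: i => [|i IH] ni.
  rewrite subn0; exists (fun c t => tau c = t); split.
  - by move=> c _; exists (tau c).
  - by move=> t; exists (pt [:: q] t); [exact: pt_cyc|exact: tau_pt].
  - by move=> a c c' t t' <- <-; exact: tau_comb.
  - by move=> c t cc <-; exact: bnd_n.
have ln : (n - i.+1 < n)%N by lia.
have [P [Pt Ps Pl Pb]] := IH (ltnW ni).
pose l := Ordinal ln; have lS : (n - i = l.+1)%N by rewrite /=; lia.
rewrite lS in Pt Ps Pb; rewrite -[(n - i.+1)%N]/(val l).
exists (fun c t => exists2 c', linked l c c' & P c' t); split.
- move=> c /(linked_right PhiH XPhi n_gt2 DeltaP torsP n_gt3 mE)[c' cc'].
  have [t Pc] := Pt c' (LC _ _ _ cc').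
  by exists t, c'.
- move=> t; have [c' cc' Pc] := Ps t.
  have [c cc lc] := LL _ _ cc'.
  by exists c => //; exists c'.
- move=> a c1 c2 t1 t2 [c1' l1 P1] [c2' l2 P2].
  by exists (a%:MP *: c1' + c2'); [exact: linked_comb|exact: Pl].
move=> c t cc [c' lc Pc].
have -> : bnd l c <-> bnd l.+1 c' by apply: linked_bnd.
exact: Pb (LC _ _ _ lc) Pc.
Qed.

End TopClass.

(** * The Koszul module *)

Section Homogeneous.
Variables (k : fieldType) (n : nat).
Local Notation S := {mpoly k[n]}.

Definition hpart (e : int) (f : S) : S :=
  \sum_(c <- msupp f) if (mdeg c)%:Z == e then f@_c *: 'X_[c] else 0.

Lemma mcoeff_hpart e f c : (hpart e f)@_c = if (mdeg c)%:Z == e then f@_c else 0.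
Proof.
have E i : (if (mdeg i)%:Z == e then f@_i *: 'X_[i] else 0 : S)@_c
    = if (mdeg c)%:Z == e then (f@_i *: 'X_[i] : S)@_c else 0.
  have [->|ic] := eqVneq i c; first by case: ifP => // _; rewrite mcoeff0.
  have z : (f@_i *: 'X_[i] : S)@_c = 0 by rewrite mcoeffZ mcoeffX (negbTE ic) mulr0.
  by rewrite z if_same; case: ifP => // _; rewrite mcoeff0.
rewrite /hpart raddf_sum /=; under eq_bigr do rewrite E.
case: ifP => _; last by rewrite big1.
by rewrite [in RHS](mpolyE f) raddf_sum.
Qed.

Lemma hd_hpart e f : hd e (hpart e f).
Proof. by move=> c; rewrite mcoeff_hpart; case: (_ =P e) => // _; rewrite eqxx. Qed.

Lemma mdegM_neq e (f g : S) : (forall c, f@_c != 0 -> (mdeg c)%:Z != e) -> hd 1 g ->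
  forall c, (f * g)@_c != 0 -> (mdeg c)%:Z != e + 1.
Proof.
move=> fe g1 c; rewrite -mcoeff_msupp => /msuppM_le/allpairsP[[a b] /= [fa gb ->]].
move: fa gb; rewrite !mcoeff_msupp => /fe ae /g1; rewrite mdegD; move/eqP: ae; lia.
Qed.

(** Boundaries are defined with arbitrary coefficients in S; comparing parts of degree e + 1 makes
    the coefficients homogeneous. *)
Lemma homogeneous_comb m (Phi : 'I_n -> 'I_m -> S) (z : 'I_n -> S) kappa e :
  (forall i a, hd 1 (Phi i a)) -> (forall i, hd (e + 1) (z i)) ->
  (forall i, z i = \sum_a kappa a * Phi i a) ->
  forall i, z i = \sum_a hpart e (kappa a) * Phi i a.
Proof.
move=> P1 ze zE i; apply/mpolyP => c; apply/eqP; rewrite -subr_eq0 -mcoeffB.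
have D : z i - \sum_a hpart e (kappa a) * Phi i a
    = \sum_a (kappa a - hpart e (kappa a)) * Phi i a.
  by rewrite {1}zE -sumrB; apply: eq_bigr => a _; rewrite mulrBl.
apply: contraT => nz.
have /eqP : (mdeg c)%:Z = e + 1.
  have : hd (e + 1) (z i - \sum_a hpart e (kappa a) * Phi i a).
    rewrite -[- _]mulN1r -[-1]expr1; apply: hdD => //; apply: hd_sign.
    by apply: hd_sum => a _; apply: hdM => //; exact: hd_hpart.
  by apply.
apply: contraTT => _; move: nz; rewrite D raddf_sum /= => nz.
have [a nza] : exists a, ((kappa a - hpart e (kappa a)) * Phi i a)@_c != 0.
  apply/existsP; apply: contraNT nz => /existsPn H.
  by rewrite big1 // => a _; apply/eqP; have := H a; rewrite negbK.
apply: mdegM_neq nza => // c'; have [E|//] := eqVneq (mdeg c')%:Z e.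
by rewrite mcoeffB mcoeff_hpart E eqxx subrr eqxx.
Qed.

End Homogeneous.

(** * Vectors over S as elements of position 1 *)

Section Encoding.
Variables (k : fieldType) (m n : nat).
Local Notation S := {mpoly k[n]}.
Local Notation D := ('X_{1..n} -> S^o).
Local Notation M := ({set 'I_m} -> D).
Local Notation U := (seq nat -> M).
Variables (Phi : 'I_n -> 'I_m -> S) (dl : {set 'I_m} -> {set 'I_m} -> S).
Hypothesis PhiH : forall j a, hd 1 (Phi j a).

Lemma evU_stage0 (F : U) : evU 0 F = F.
Proof.
apply/funext => w; apply/funext => J; apply/funext => b; exact: evl0.
Qed.

Definition enc (z : 'cV[S]_n) : U := emb (fun J b =>
  if J == set0 then \sum_i (b == U_(i)%MM)%:R * z i 0 else 0).

Definition dec (F : U) : 'cV[S]_n := \col_i (F [::] set0 U_(i)%MM : S).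

Lemma enc_val z i : enc z [::] set0 U_(i)%MM = z i 0.
Proof.
rewrite /enc /= eqxx (bigD1 i) //= eqxx mul1r big1 ?addr0 // => j ji.
by rewrite eq_mnm1 eq_sym (negbTE ji) mul0r.
Qed.

Lemma encK z : dec (enc z) = z.
Proof. by apply/colP => i; rewrite mxE enc_val. Qed.

Lemma enc_comb c y z : enc (c *: y + z) = c *: enc y + enc z.
Proof.
rewrite /enc -emb_linear_comb; congr emb; apply/funext => J; apply/funext => b.
rewrite !fctE; case: ifP => _; last by rewrite scaler0 addr0.
rewrite -[RHS]/(c * _ + _) mulr_sumr -big_split; apply: eq_bigr => i _ /=.
by rewrite !mxE mulrDr mulrCA.
Qed.

Lemma gr_enc e (z : 'cV[S]_n) : (forall i, hd (e + 1) (z i 0)) -> gr 1 e (enc z).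
Proof.
move=> zh; split=> // J b c; rewrite /enc /=; have [->|_] := eqVneq J set0; last by rewrite mcoeff0 eqxx.
rewrite raddf_sum /= => nz.
have [i nzi] : exists i, ((b == U_(i)%MM)%:R * z i 0)@_c != 0.
  apply/existsP; apply: contraNT nz => /existsPn H.
  by rewrite big1 // => a _; apply/eqP; have := H a; rewrite negbK.
rewrite cards0; move: nzi; have [->|_] := eqVneq b U_(i)%MM; last by rewrite mul0r mcoeff0 eqxx.
by rewrite mul1r mdeg1 => /zh.
Qed.

Lemma gr1_eq e (F G : U) : gr 1 e F -> gr 1 e G -> dec F = dec G -> F = G.
Proof.
case=> FE Fh [GE Gh] /colP E; rewrite FE GE; congr emb.
have H J b : F [::] J b = G [::] J b.
  have [J0|J0] := eqVneq J set0; last first.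
    have cJ : #|J|%:Z != 0 by apply/eqP => -[] /eqP; rewrite cards_eq0 (negbTE J0).
    by rewrite (hM_card Fh cJ) (hM_card Gh cJ).
  have [/mdeg1P[i /eqP->]|b1] := boolP (mdeg b == 1%N).
    by have := E i; rewrite !mxE J0.
  apply/mpolyP => c; have Z (g : M) : hM 0 1 (e + 1) g -> (g J b : S)@_c = 0.
    by move=> gh; apply/eqP; apply: contraNT b1 => /gh[_ [->] _].
  by rewrite !Z.
by apply/funext => J; apply/funext => b.
Qed.

Lemma hd_dec e F i : gr 1 e F -> hd (e + 1) (dec F i 0).
Proof. by case=> _ Fh c; rewrite mxE => /Fh[]. Qed.

Lemma decK e F : gr 1 e F -> enc (dec F) = F.
Proof.
move=> Fh; apply: gr1_eq (Fh) _; last by rewrite encK.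
by apply: gr_enc => i; exact: hd_dec Fh.
Qed.

Lemma dX0_enc e (z : 'cV[S]_n) : (forall i, hd (e + 1) (z i 0)) ->
  dX Phi dl 0 0 (enc z) = 0 <-> delta1 z = 0.
Proof.
move=> /gr_enc[_ zh].
have E : del1 (@xs k n 0) (enc z [::]) set0 0%MM = delta1 z.
  rewrite /del1 !fct_sumE; apply: eq_bigr => j _.
  by rewrite -[LHS]/(xs k 0 j * enc z [::] set0 (0 + U_(j))%MM) add0m enc_val xsE.
have dh : hM 0 0 (e + 1 + 1) (del1 (@xs k n 0) (enc z [::])).
  apply: hM_sum => j _; rewrite addrC; apply: hMZ; first exact: xs_hd.
  exact: (hM_der (j := j) zh).
rewrite /dX; split=> [/(congr1 (fun F : U => F [::] set0 0%MM))|z0].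
  by rewrite /= E.
rewrite (_ : del1 _ _ = 0) ?emb0 //; apply/funext => J; apply/funext => b.
have [J0|J0] := eqVneq J set0; last first.
  by rewrite (hM_card dh) //; apply/eqP => -[] /eqP; rewrite cards_eq0 (negbTE J0).
have [b0|b0] := eqVneq (mdeg b) 0%N.
  by move/eqP: b0; rewrite mdeg_eq0 J0 => /eqP ->; rewrite E.
apply/mpolyP => c; rewrite mcoeff0; apply/eqP; apply: contraNT b0 => /dh[_ + _].
by case=> ->.
Qed.

Lemma dX1_val (G : U) i :
  dX Phi dl 0 1 G [::] set0 U_(i)%MM = \sum_a Phi i a * G [::] [set a] 0%MM.
Proof.
rewrite /= /del2 !fct_sumE (bigD1 i) //= big1 ?addr0 => [|j ji].
  rewrite contrE fct_sumE; apply: eq_bigr => a _.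
  rewrite -[LHS]/(Phis Phi 0 i a * _) /Phis evl0 inE setU0; congr (_ * _).
  rewrite (_ : inv_sign a set0 = 0%N).
    rewrite scale1r /lift /raise mnm1E eqxx /=; congr (G _ _ _).
    by apply/mnmP => j; rewrite mnmBE subnn mnm0E.
  by apply/eqP; rewrite cards_eq0; apply/eqP/setP => b; rewrite !inE.
rewrite contrE fct_sumE big1 // => a _; rewrite inE /lift.
rewrite -[LHS]/(Phis Phi 0 j a * ((-1) ^+ _ * raise j _ _)).
by rewrite /raise mnm1E eq_sym (negbTE ji) !mulr0.
Qed.

Lemma bnd_enc e (z : 'cV[S]_n) : (forall i, hd (e + 1) (z i 0)) ->
  (exists2 G, gr 2 e G & dX Phi dl 0 1 G = enc z) <->
  (exists2 kappa, forall a, hd e (kappa a) & forall i, z i 0 = \sum_a kappa a * Phi i a).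
Proof.
move=> zh; split=> [[G [GE Gh] dG]|[kappa kh zE]].
  exists (fun a => G [::] [set a] 0%MM : S); first by move=> a c /Gh[].
  move=> i; rewrite -(enc_val z) -dG dX1_val.
  by apply: eq_bigr => a _; rewrite mulrC.
pose g : M := fun J b => if b == 0%MM then \sum_a (J == [set a])%:R * kappa a else 0.
have g1 a : g [set a] 0%MM = kappa a.
  rewrite /g eqxx (bigD1 a) //= eqxx mul1r big1 ?addr0 // => b ba.
  by rewrite (inj_eq set1_inj) eq_sym (negbTE ba) mul0r.
have gh : hM 1 0 e g.
  move=> J b c; rewrite /g; have [->|_] := eqVneq b 0%MM; last by rewrite mcoeff0 eqxx.
  rewrite raddf_sum /= => nz.
  have [a nza] : exists a, ((J == [set a])%:R * kappa a)@_c != 0.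
    apply/existsP; apply: contraNT nz => /existsPn H.
    by rewrite big1 // => a _; apply/eqP; have := H a; rewrite negbK.
  move: nza; have [->|_] := eqVneq J [set a]; last by rewrite mul0r mcoeff0 eqxx.
  by rewrite mul1r cards1 mdeg0 => /kh.
exists (emb g) => //; apply: (@gr1_eq e).
- split=> //; have H j := hM_contr (@Phis_hd k m n Phi PhiH 0 j) (hM_raise (j := j) gh).
  by apply: hM_sum => j _; apply: hM_conv (H j) => //; rewrite addrC.
- exact: gr_enc.
apply/colP => i; rewrite !mxE dX1_val enc_val zE.
by apply: eq_bigr => a _; rewrite /= g1 mulrC.
Qed.

End Encoding.

(** * Vanishing of binomial coefficients in characteristic p *)

Section PrimePowers.
Variables (k : fieldType) (p : nat).
Hypothesis pk : p \in [pchar k].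

Lemma coef_1DXn_exp (d r j : nat) : (0 < d)%N ->
  ((1 + 'X^d : {poly k}) ^+ r)`_(d * j) = 'C(r, j)%:R.
Proof.
move=> d0; rewrite exprDn coef_sum.
under eq_bigr => i _ do
  rewrite expr1n mul1r -exprM coefMn coefXn eqn_pmul2l //.
have [jr|rj] := leqP j r; last first.
  rewrite bin_small // big1 // => i _.
  by rewrite (_ : (j == i) = false) ?mul0rn //; apply/eqP; have := ltn_ord i; lia.
rewrite (bigD1 (Ordinal (jr : (j < r.+1)%N))) //= eqxx big1 ?addr0 // => i ij.
by rewrite (_ : (j == i) = false) ?mul0rn //; apply: contraNF ij => /eqP ji; apply/eqP/val_inj.
Qed.

(** Compare p-adic valuations in i C(p^e, i) = p^e C(p^e - 1, i - 1): since i < p^e, its valuation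
    is less than e. *)
Lemma bin_prime_power_eq0 e i : (0 < i < p ^ e)%N -> 'C(p ^ e, i)%:R = 0 :> k.
Proof.
case/andP=> i0 ie; have pp := pcharf_prime pk.
apply/eqP; rewrite -(dvdn_pcharf pk) -[X in (X %| _)%N]expn1 pfactor_dvdn ?bin_gt0 ?(ltnW ie) //.
have := mul_bin_diag (p ^ e) i.-1; rewrite prednK // => E.
have : (logn p (p ^ e * 'C((p ^ e).-1, i.-1)) = logn p (i * 'C(p ^ e, i)))%N by rewrite E.
have h : (i.-1 <= (p ^ e).-1)%N by rewrite -!subn1 leq_sub2r // ltnW.
have C0 : (0 < 'C((p ^ e).-1, i.-1))%N by rewrite bin_gt0.
have C1 : (0 < 'C(p ^ e, i))%N by rewrite bin_gt0 ltnW.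
have pe0 : (0 < p ^ e)%N by rewrite expn_gt0 prime_gt0.
rewrite (lognM _ pe0 C0) (lognM _ i0 C1).
rewrite pfactorK //; have : (logn p i < e)%N.
  rewrite ltnNge -pfactor_dvdn //; apply/negP => /dvdn_leq; rewrite i0 => /(_ isT).
  by rewrite leqNgt ie.
lia.
Qed.

(** Write q = r p^t with r prime to p. By Frobenius (1 + X)^q = (1 + X^(p^t))^r, whose coefficient
    at X^(p^t) is r, nonzero in k; and r > 1 gives p^t < q. *)
Lemma bin_not_prime_power q : (0 < q)%N -> (forall e, q != p ^ e)%N ->
  exists2 i, (0 < i < q)%N & 'C(q, i)%:R != 0 :> k.
Proof.
move=> q0 qe; have pp := pcharf_prime pk.
have [r pr qE] := pfactor_coprime pp q0; set t := logn p q in qE.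
have pt0 : (0 < p ^ t)%N by rewrite expn_gt0 prime_gt0.
have r1 : (1 < r)%N.
  case: r pr qE => [|[|r]] //.
    by rewrite mul0n => _ q00; rewrite q00 in q0.
  by rewrite mul1n => _ /eqP; rewrite (negbTE (qe t)).
exists (p ^ t)%N; first by rewrite pt0 qE ltn_Pmull.
have cp : p \in [pchar {poly k}] by rewrite pchar_poly.
have E := @coef_1DXn_exp 1 q (p ^ t)%N isT; rewrite mul1n in E; rewrite -E.
have -> : (1 + 'X^1 : {poly k}) ^+ q = (1 + 'X^(p ^ t)) ^+ r.
  rewrite {1}qE mulnC exprM (exprDn_pchar 1 'X^1 (_ : [pchar {poly k}].-nat (p ^ t)%N)).
    by rewrite expr1n.
  by rewrite pnatX (pnatE _ pp) cp.
rewrite -{2}[(p ^ t)%N]muln1 coef_1DXn_exp // bin1 -(dvdn_pcharf pk).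
by rewrite -prime_coprime.
Qed.

Lemma binom_nzP n : (3 < n)%N -> ~~ binom_nz k n <-> exists e, n = (3 + p ^ e)%N.
Proof.
move=> n3; split=> [nz|[e nE]].
  apply: contrapT => ne; have [|e|i iq nzi] := @bin_not_prime_power (n - 3).
  - by rewrite subn_gt0.
  - by apply/eqP => E; apply: ne; exists e; rewrite -E subnKC // ltnW.
  case/negP: nz; have [i0 ilt] := andP iq; apply/existsP; exists (Ordinal ilt).
  by rewrite i0.
have qE : (n - 3 = p ^ e)%N by rewrite nE addnC addnK.
apply/existsPn => i; rewrite negb_and negbK; have [//|i0] := posnP i.
by move: (ltn_ord i) i0; move: (nat_of_ord i) => j; rewrite qE => ji j0;
   rewrite bin_prime_power_eq0 ?j0 //= eqxx.
Qed.

End PrimePowers.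

(** * Boundaries and components of the Koszul module *)

Section KoszulModule.
Variables (k : fieldType) (n : nat).
Local Notation S := {mpoly k[n]}.

Definition lin (A : 'M[k]_n) (i : 'I_n) : S := \sum_j A i j *: 'X_j.

Lemma hd_lin A i : hd 1 (lin A i).
Proof.
apply: hd_sum => j _; rewrite -mul_mpolyC -[1]add0r.
by apply: hdM; [exact: hd_const|exact: hdX].
Qed.

Lemma lin_sum (I : Type) (r : seq I) (c : I -> k) (A : I -> 'M[k]_n) i :
  lin (\sum_(a <- r) c a *: A a) i = \sum_(a <- r) (c a)%:MP * lin (A a) i.
Proof.
rewrite /lin; under eq_bigr => j _ do rewrite summxE scaler_suml.
rewrite exchange_big; apply: eq_bigr => a _ /=; rewrite mulr_sumr.
by apply: eq_bigr => j _; rewrite mxE mul_mpolyC scalerA.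
Qed.

Lemma delta2E (A : 'M[k]_n) (f : S) i : delta2 (ptens A f) i 0 = f * lin A i.
Proof.
rewrite /delta2 /ptens mxE mulr_sumr; apply: eq_bigr => j _.
by rewrite !mxE -mulrA mul_mpolyC.
Qed.

Lemma delta1_lin (A : 'M[k]_n) : A \in ext2 k n -> \sum_i 'X_i * lin A i = 0.
Proof.
case/mem_ext2 => At A0.
have E B : \sum_i 'X_i * lin B i = delta1 (delta2 (ptens B 1)).
  by rewrite /delta1; apply: eq_bigr => i _; rewrite delta2E mul1r.
have W i j : \sum_i0 'X_i0 * lin (wedge (delta_mx i 0) (delta_mx j 0)) i0 = 0.
  rewrite E delta2_ptens_wedge raddfB /= !delta1_ptens !mulr1 mulrC subrr //.
rewrite [A](alt_decomp At A0) pair_big_dep /=.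
under eq_bigr => i _ do rewrite -big_filter lin_sum mulr_sumr.
rewrite exchange_big big1 //= => -[i j] _ /=.
under eq_bigr => i0 _ do rewrite mulrCA.
by rewrite -mulr_sumr W mulr0.
Qed.

Variables (K : {vspace 'M[k]_n}).
Hypothesis K_ext2 : (K <= ext2 k n)%VS.

Definition KPhi (i : 'I_n) (a : 'I_(\dim K)) : S := lin (tnth (vbasis K) a) i.

Lemma KPhi_hd i a : hd 1 (KPhi i a).
Proof. exact: hd_lin. Qed.

Lemma XKPhi a : \sum_i 'X_i * KPhi i a = 0.
Proof. by apply: delta1_lin; apply: (subvP K_ext2); apply: vbasis_mem; exact: mem_tnth. Qed.

Lemma boundaryP (z : Defs.cycle k n) : z \in boundary K <->
  exists kappa, forall i, val z i 0 = \sum_a kappa a * KPhi i a.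
Proof.
split=> [/asboolP[T [s sK ->] zE]|[kappa zE]].
  exists (fun a => \sum_(t <- s) (coord (vbasis K) a t.1)%:MP * t.2) => i.
  rewrite zE raddf_sum /= summxE.
  under [RHS]eq_bigr => a _ do rewrite mulr_suml.
  rewrite exchange_big; apply: eq_big_seq => t ts /=.
  rewrite delta2E {1}(coord_vbasis (sK t ts)) lin_sum mulr_sumr; apply: eq_bigr => a _.
  by rewrite /KPhi (tnth_nth 0) mulrA [t.2 * _]mulrC.
apply/asboolP; exists (\sum_a ptens (tnth (vbasis K) a) (kappa a)).
  exists [seq (tnth (vbasis K) a, kappa a) | a <- enum 'I_(\dim K)].
    by move=> _ /mapP[a _ ->]; apply: vbasis_mem; exact: mem_tnth.
  by rewrite big_map big_enum.
apply/colP => i; rewrite zE raddf_sum summxE.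
by apply: eq_bigr => a _; rewrite delta2E.
Qed.

Local Notation W := (koszul_comp K).

Lemma koszul_comp_class j (w : W j) : exists2 z : Defs.cycle k n,
  forall i, hd (j + 1) (val z i 0) & val w = @koszul_class k n K z.
Proof.
have /asboolP[z zd ->] := valP w; exists z => // i; exact/in_sym_degE.
Qed.

Lemma class_koszul_comp j (z : Defs.cycle k n) : (forall i, hd (j + 1) (val z i 0)) ->
  exists w : W j, val w = @koszul_class k n K z.
Proof.
move=> zh; have zj : @koszul_class k n K z \in @koszul_deg k n K j.
  by apply/asboolP; exists z => // i; apply/in_sym_degE.
by exists (KoszulComp zj).
Qed.

Lemma koszul_comp_eq0 j : (forall w : W j, w = 0) <->
  forall z : Defs.cycle k n, (forall i, hd (j + 1) (val z i 0)) -> z \in boundary K.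
Proof.
split=> [W0 z /class_koszul_comp[w wE]|H w].
  by rewrite -koszul_class_eq0 -wE (W0 w).
have [z /H zB wE] := koszul_comp_class w.
by apply: val_inj; rewrite /= wE; apply/eqP; rewrite koszul_class_eq0.
Qed.

Lemma delta1_cycle (z : Defs.cycle k n) : delta1 (val z) = 0.
Proof. exact/eqP/(valP z). Qed.

(** For n = 3 the bound 2n - 7 is -1, so negative degrees matter. In degree -1 a cycle has constant
    entries z_i with sum_i z_i x_i = 0, hence z = 0. *)
Lemma koszul_comp_neg j : j <= -1 -> forall w : W j, w = 0.
Proof.
move=> j1; apply/koszul_comp_eq0 => z zh.
suff -> : z = 0 by exact: rpred0.
have zc i : val z i 0 = ((val z i 0)@_0)%:MP.
  apply/mpolyP => c; rewrite mcoeffC; have [->|c0] := eqVneq c 0%MM; first by rewrite mulr1.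
  rewrite mulr0; apply/eqP; apply: contraNT c0 => /zh cd.
  by rewrite -mdeg_eq0; apply/eqP; lia.
apply: val_inj; apply/colP => i; rewrite [RHS]mxE /= zc.
have := congr1 (fun f : S => f@_(U_(i))%MM) (delta1_cycle z).
rewrite mcoeff0 /delta1 raddf_sum /=.
under eq_bigr => a _ do rewrite zc mulrC mul_mpolyC mcoeffZ mcoeffX eq_mnm1.
rewrite (bigD1 i) //= eqxx mulr1 big1 ?addr0 => [->|a /negbTE ->]; last by rewrite mulr0.
by rewrite mpolyC0.
Qed.

End KoszulModule.

(** * The vanishing range and the component of degree 2n - 8 *)

Section Vanishing.
Variables (k : fieldType) (n : nat) (K : {vspace 'M[k]_n}).
Hypotheses (n_ge3 : (2 < n)%N) (K_ext2 : (K <= ext2 k n)%VS).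
Local Notation S := {mpoly k[n]}.
Local Notation W := (koszul_comp K).
Local Notation m := (\dim K).
Local Notation Phi := (@KPhi k n K).

Hypothesis vanishing : exists N : int, forall j : int, N <= j -> forall w : W j, w = 0.

(** The Koszul cycle x_l^N (x_l e_j - x_j e_l) has degree N in W, so for N in the vanishing range it
    is a boundary; its coefficients form [sigma j]. *)
Lemma vanishing_generically_onto : generically_onto Phi.
Proof.
move=> l; have [N0 N0P] := vanishing; pose N := `|N0|%N; exists N.
have N0N : N0 <= N%:Z by rewrite /N; lia.
suff H j : exists kappa : 'I_m -> S, (forall a, hd N%:Z (kappa a)) /\
    forall i, j != l -> \sum_a Phi i a * kappa a
      = 'X_l ^+ N * ((i == j)%:R * 'X_l - (i == l)%:R * 'X_j).
  have [sigma sE] := @boolp.choice _ _ (fun j (kappa : 'I_m -> S) =>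
    (forall a, hd N%:Z (kappa a)) /\ forall i, j != l -> \sum_a Phi i a * kappa a
      = 'X_l ^+ N * ((i == j)%:R * 'X_l - (i == l)%:R * 'X_j)) H.
  exists sigma; split=> [j a|i j jl]; [exact: (sE j).1|exact: (sE j).2].
have [->|jl] := eqVneq j l; first by exists 0; split=> // a; exact: hd0.
pose z : 'cV[S]_n :=
  \col_i ('X_l ^+ N * ((i == j)%:R * 'X_l - (i == l)%:R * 'X_j)).
have zc : z \in @cycle_pred k n.
  rewrite unfold_in /delta1; apply/eqP.
  under eq_bigr => i _ do rewrite mxE mulrCA mulrBr.
  rewrite -mulr_sumr sumrB (bigD1 j) //= big1 => [|i /negbTE ->]; last by rewrite mul0r mulr0.
  rewrite (bigD1 l) //= big1 => [|i /negbTE ->]; last by rewrite mul0r mulr0.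
  by rewrite !eqxx !mul1r !addr0 ['X_j * _]mulrC subrr mulr0.
have zh i : hd (N%:Z + 1) (z i 0).
  rewrite mxE; apply: hdM; first by have := hdXn (a := N) (@hdX k n l); rewrite mulr1.
  apply: hdD; first by apply: hd_nat; exact: hdX.
  rewrite -mulN1r -[-1]expr1; apply: hd_sign; apply: hd_nat; exact: hdX.
have /boundaryP[kappa kE] : Cycle zc \in boundary K.
  by apply: ((koszul_comp_eq0 K N%:Z).1 (N0P _ N0N)).
exists (fun a => hpart N%:Z (kappa a)); split=> [a|i _]; first exact: hd_hpart.
have := homogeneous_comb (@KPhi_hd k n K) zh kE i; rewrite mxE => ->.
by apply: eq_bigr => a _; rewrite mulrC.
Qed.

Let n_gt1 : (1 < n)%N := ltnW n_ge3.
Let XPhi := @XKPhi k n K K_ext2.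
Let PhiH := @KPhi_hd k n K.

Lemma boundary_enc dl j (z : Defs.cycle k n) : (forall i, hd (j + 1) (val z i 0)) ->
  z \in boundary K <-> exists2 G, gr 2 j G & dX Phi dl 0 1 G = @enc k m n (val z).
Proof.
move=> zh; rewrite boundaryP (bnd_enc _ PhiH zh); split=> [[kappa kE]|[kappa _ kE]].
  exists (fun a => hpart j (kappa a)); first by move=> a; exact: hd_hpart.
  exact: homogeneous_comb PhiH zh kE.
by exists kappa.
Qed.

Lemma exact_koszul_comp dl e j : exact_from Phi dl 0 1 e -> e <= j -> forall w : W j, w = 0.
Proof.
move=> ex ej; apply/koszul_comp_eq0 => z zh.
have [||G [Gh _ dG]] := ex j (@enc k m n (val z)) ej (gr_enc _ zh).
- exact: evU_stage0.
- by apply/(dX0_enc _ _ zh); exact: delta1_cycle.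
by apply/(boundary_enc dl zh); exists G.
Qed.

Lemma koszul_vanishing j : 2 * n%:Z - 7 <= j -> forall w : W j, w = 0.
Proof.
move=> jn; have [dl DeltaP] := exists_Delta XPhi n_gt1.
have [n3|n3] := leqP n 3; last first.
  exact: exact_koszul_comp (exact_one PhiH XPhi n_ge3 DeltaP vanishing_generically_onto n3) jn.
have nE : n = 3%N by apply/eqP; rewrite eqn_leq n3.
have [j0|j0] := lerP 0 j.
  exact: exact_koszul_comp
    (exact_one_three PhiH XPhi n_ge3 DeltaP vanishing_generically_onto nE) j0.
by apply: koszul_comp_neg => //; lia.
Qed.

Hypotheses (n_gt3 : (3 < n)%N) (mE : m = (2 * n - 3)%N).
Local Notation e := (2 * n%:Z - 8).

Lemma koszul_top_nz : binom_nz k n -> forall w : W e, w = 0.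
Proof.
move=> nz; have [dl DeltaP] := exists_Delta XPhi n_gt1.
have [P [Pt _ _ Pb]] := top_relation PhiH XPhi n_ge3 DeltaP vanishing_generically_onto n_gt3 mE.
apply/koszul_comp_eq0 => z zh; have zc : cyc Phi dl 0 (@enc k m n (val z)).
  split; [by rewrite addr0; exact: gr_enc|exact: evU_stage0|].
  by apply/(dX0_enc _ _ zh); exact: delta1_cycle.
have [t Pz] := Pt _ zc; have [_ []] := Pb _ t zc Pz; first by right.
move=> G; rewrite addr0 => -[Gh _ dG].
by apply/(boundary_enc dl zh); exists G.
Qed.

(** With all the binomial coefficients zero, the scalar attached to a cycle by [top_relation] is
    zero exactly on boundaries, so the relation descends to an isomorphism from W_(2n - 8) to k. *)
Lemma koszul_top_line : ~~ binom_nz k n -> exists phi : {linear W e -> k^o}, bijective phi.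
Proof.
move=> nz; have [dl DeltaP] := exists_Delta XPhi n_gt1.
have [P [Pt Ps Pl Pb]] := top_relation PhiH XPhi n_ge3 DeltaP vanishing_generically_onto n_gt3 mE.
pose En := @enc k m n.
have cycE (z : Defs.cycle k n) : (forall i, hd (e + 1) (val z i 0)) -> cyc Phi dl 0 (En (val z)).
  move=> zh; split; [by rewrite addr0; exact: gr_enc|exact: evU_stage0|].
  by apply/(dX0_enc _ _ zh); exact: delta1_cycle.
pose R (w : W e) t := exists z : Defs.cycle k n, [/\ forall i, hd (e + 1) (val z i 0),
  val w = @koszul_class k n K z & P (En (val z)) t].
(* By linearity, independence of the choices reduces to the zero class, where failure of [binom_nz]
   leaves only [t = 0]. *)
have R0 w t : R w t -> w = 0 <-> t = 0.
  case=> z [zh wE Pz]; have := Pb _ t (cycE z zh) Pz.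
  rewrite (_ : bnd _ _ _ _ <-> z \in boundary K); last first.
    rewrite (boundary_enc dl zh) /bnd addr0; split=> [[G [Gh _ dG]]|[G Gh dG]].
      by exists G.
    by exists G; split=> //; exact: evU_stage0.
  rewrite -koszul_class_eq0 -wE => H; split=> [w0|/(or_introl (B := binom_nz k n))/H/eqP w0].
    by case: (H.1 _); rewrite ?w0 ?eqxx // => nz'; rewrite nz' in nz.
  exact: val_inj.
have Rlin a w w' t t' : R w t -> R w' t' -> R (a *: w + w') (a * t + t').
  case=> z [zh wE Pz] [z' [zh' wE' Pz']]; exists (a%:MP *: z + z'); split.
  - move=> i; rewrite linearP /= !mxE; apply: hdD => //; rewrite -[_ + 1]add0r.
    by apply: hdM => //; exact: hd_const.
  - have -> : val (a *: w + w') = koszul_scale a%:MP (val w) + val w' by rewrite raddfD.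
    by rewrite wE wE' -koszul_class_scale -raddfD.
  by rewrite linearP /= /En enc_comb; exact: Pl.
have Rex w : exists t, R w t.
  have [z zh wE] := koszul_comp_class w.
  by have [t Pz] := Pt _ (cycE z zh); exists t, z.
have [f fP] := @boolp.choice _ _ R Rex.
have Runiq w t : R w t -> f w = t.
  move=> Rt; have := Rlin (-1) _ _ _ _ Rt (fP w); rewrite scaleN1r addNr mulN1r => /R0[/(_ erefl)].
  by rewrite addrC => /eqP; rewrite subr_eq0 => /eqP.
have flin : linear (f : W e -> k^o).
  by move=> a w w'; apply: Runiq; apply: Rlin; exact: fP.
pose phi : {linear W e -> k^o} := HB.pack (f : W e -> k^o)
  (GRing.isLinear.Build k (W e) k^o *:%R (f : W e -> k^o) flin).
exists phi; have fsurj t : exists w, f w = t.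
  have [c cc Pc] := Ps t; case: (cc) => ch _ dc; rewrite addr0 in ch.
  have dh i : hd (e + 1) (dec c i 0) by exact: hd_dec ch.
  have cE : En (dec c) = c by exact: decK ch.
  have zc : dec c \in @cycle_pred k n.
    by apply/eqP/(dX0_enc Phi dl dh); rewrite -/En cE.
  have [w wE] := @class_koszul_comp k n K e (Cycle zc) dh.
  by exists w; apply: Runiq; exists (Cycle zc); split; rewrite //= cE.
have [g gK] := boolp.choice fsurj; exists g => // w.
apply/eqP; rewrite -subr_eq0; apply/eqP; apply: (R0 _ _ (fP _)).2.
have -> : f (g (phi w) - w) = phi (g (phi w) - w) by [].
by rewrite linearB /= gK subrr.
Qed.

End Vanishing.

Theorem mainTheorem9 (k : closedFieldType) (n m : nat) (n_ge3 : (3 <= n)%N)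
    (K : {vspace 'M[k]_n}) (K_ext2 : (K <= ext2 k n)%VS) (dimK : \dim K = m) :
  let W := koszul_comp K in
  ((exists N : int, forall j : int, N <= j -> forall w : W j, w = 0) <->
   (forall j : int, 2 * n%:Z - 7 <= j -> forall w : W j, w = 0))
  /\
  (forall p : nat, m = (2 * n - 3)%N -> p \in [pchar k] ->
     (exists N : int, forall j : int, N <= j -> forall w : W j, w = 0) ->
     let a := exists w : W (2 * n%:Z - 8), w <> 0 in
     let b := exists phi : {linear W (2 * n%:Z - 8) -> k^o}, bijective phi in
     let c := exists e : nat, n = (3 + p ^ e)%N in
     (a <-> b) /\ (b <-> c)).
Proof.
split; first by split=> [V j|V]; [exact: koszul_vanishing|exists (2 * n%:Z - 7)].
move=> p mE pk V a b c; rewrite -dimK in mE.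
have noab : (forall w : koszul_comp K (2 * n%:Z - 8), w = 0) -> ~ a /\ ~ b.
  move=> W0; split=> [[w]|[phi [g phiK gK]]]; first by rewrite (W0 w).
  have := gK 1; rewrite (W0 (g 1)) raddf0 => /esym/eqP.
  by rewrite oner_eq0.
(* For n = 3 all three conditions fail: the degree 2n - 8 = -2 is negative, and 3 + p^e > 3. *)
have [n3|n3] := leqP n 3.
  have nE : n = 3%N by apply/eqP; rewrite eqn_leq n3.
  have [|na nb] := noab; first by apply: koszul_comp_neg => //; rewrite nE.
  have nc : ~ c.
    case=> i nE'; have := prime_gt0 (pcharf_prime pk); rewrite nE' in nE.
    by have : (0 < p ^ i)%N; [rewrite expn_gt0 prime_gt0 // (pcharf_prime pk)|lia].
  by split; split.
have [nz|nz] := boolP (binom_nz k n).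
  have [na nb] := noab (koszul_top_nz n_ge3 K_ext2 V n3 mE nz).
  have nc : ~ c by move=> /(binom_nzP pk n3); rewrite nz.
  by split; split.
have cT : c by apply/(binom_nzP pk n3).
have bT : b by exact: koszul_top_line.
split; split=> // _; have [phi [g phiK gK]] := bT.
exists (g 1) => g0; have := gK 1; rewrite g0 raddf0 => /esym/eqP.
by rewrite oner_eq0.
Qed.
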